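(* Let $X=(X_1,\ldots,X_n)$ be a vector of random variables taking values in a Polish space $\Lambda=\Lambda_1\times\cdots\times\Lambda_n$ (each $\Lambda_i$ Polish), equipped with the Borel $\sigma$-algebra $\mathcal{F}$. Let $\mu$ be the probability measure on $\Lambda$ induced by $X$. Let $A$ be a Dobrushin interdependence matrix for $X$, and suppose that $\|A\|_1<1$ and $\|A\|_\infty\le1$. Then for any $S\in\mathcal{F}$, $$\mathbb{E}\left[e^{d_T(X,S)^2\cdot(1-\|A\|_1)/26.1}\right]\le\frac{1}{\mu(S)}.$$
   Context: For $x\in\Lambda$, $x_{-i}$ denotes $x$ with its $i$th coordinate dropped, and $\mu_i(\cdot|x_{-i})=\mathbb{P}(X_i\in\cdot\,|\,X_{-i}=x_{-i})$ is a (regular) conditional distribution of $X_i$ given the other coordinates; it is assumed to be defined for every $x_{-i}$. $d_{\mathrm{TV}}(\nu_1,\nu_2)=\sup_S|\nu_1(S)-\nu_2(S)|$ (supremum over measurable $S$) is the total variation distance. Dobrushin interdependence matrix: an $n\times n$ matrix $A=(a_{ij})$ with non-negative entries and zeros on the diagonal is a Dobrushin interdependence matrix for $X$ if for every $i\in[n]=\{1,\ldots,n\}$ and every $x,y\in\Lambda$, $$d_{\mathrm{TV}}(\mu_i(\cdot|x_{-i}),\mu_i(\cdot|y_{-i}))\le\sum_{j\in[n]\setminus\{i\}}a_{ij}\mathbf{1}[x_j\ne y_j].$$ Norms: $\|A\|_1=\max_{j}\sum_{i}|a_{ij}|$ and $\|A\|_\infty=\max_i\sum_j|a_{ij}|$.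 Talagrand's convex distance: for $c\in\mathbb{R}_+^n$ and $x,y\in\Lambda$ let $d_c(x,y)=\sum_{i=1}^nc_i\mathbf{1}[x_i\ne y_i]$, for $S\subset\Lambda$ let $d_c(x,S)=\min_{y\in S}d_c(x,y)$, and let $$d_T(x,S)=\sup_{c\in\mathbb{R}_+^n,\ \|c\|_2=1}d_c(x,S).$$ When $\mu(S)=0$ the right-hand side $1/\mu(S)$ is read as $+\infty$. *)

(* Defs.v *)
From HB Require Import structures.
From mathcomp Require Import all_boot all_order all_algebra.
From mathcomp Require Import all_classical all_reals all_analysis.

Set Implicit Arguments.
Unset Strict Implicit.
Unset Printing Implicit Defensive.

Import Order.TTheory GRing.Theory Num.Theory.
Import numFieldNormedType.Exports.

Local Open Scope classical_set_scope.
Local Open Scope ring_scope.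

HB.instance Definition _ (I : Type) (L : I -> ptopologicalType) :=
  Pointed.copy (prod_topology L) (forall i, L i).

Notation borel T := (g_sigma_algebraType (@open T)).

Definition polish (R : realType) (T : topologicalType) : Prop :=
  (exists2 D : set T, countable D & dense D) /\
  exists (M : metricType R) (f : T -> M) (g : M -> T),
    [/\ cancel f g, cancel g f, continuous f, continuous g &
        forall F : set_system M, ProperFilter F -> cauchy F ->
          exists l : M, F --> l].

Section TotalVariation.
Local Open Scope ereal_scope.

Definition dTV d (T : measurableType d) (R : realType)
    (nu1 nu2 : {measure set T -> \bar R}) : \bar R :=
  ereal_sup [set `|nu1 B - nu2 B| | B in measurable].

(* The defining property of k as a regular version of
   P(Y \in . | Z = .); the measurability of z |-> k z A and the fact that each
   k z is a probability are part of the type of k. *)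
Definition cond_dist d (T : measurableType d) (R : realType)
    (P : probability T R)
    d1 (T1 : measurableType d1) d2 (T2 : measurableType d2)
    (Y : T -> T1) (Z : T -> T2) (k : R.-pker T2 ~> T1) : Prop :=
  forall (A : set T1) (B : set T2), measurable A -> measurable B ->
    P (Y @^-1` A `&` Z @^-1` B) = \int[P]_(w in Z @^-1` B) k (Z w) A.

End TotalVariation.

Section Coordinates.
Context {n : nat} (L : 'I_n -> ptopologicalType).

Definition omit (i : 'I_n) : ptopologicalType :=
  prod_topology (fun j : {j : 'I_n | j != i} => L (val j)).

Definition drop_coord (i : 'I_n) (x : prod_topology L) : omit i :=
  fun j => x (val j).

End Coordinates.

Arguments drop_coord {n L} i x.

Section Dobrushin.
Context {R : realType} {n : nat} (L : 'I_n -> ptopologicalType).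

(* mu_ i z stands for mu_i( . | x_{-i}) at x_{-i} = z. *)
Definition dobrushin_matrix
    (mu_ : forall i, R.-pker (borel (omit L i)) ~> (borel (L i)))
    (A : 'M[R]_n) : Prop :=
  [/\ forall i j, 0 <= A i j,
      forall i, A i i = 0 &
      forall (i : 'I_n) (x y : prod_topology L),
        (dTV (mu_ i (drop_coord i x)) (mu_ i (drop_coord i y)) <=
         (\sum_(j < n | j != i) A i j * (x j != y j)%:R)%:E)%E].

End Dobrushin.

Section MatrixNorms.
Context {R : realType} {n : nat}.

Definition mx_norm_1 (A : 'M[R]_n) : R :=
  \big[Order.max/0]_(j < n) \sum_(i < n) `|A i j|.

Definition mx_norm_oo (A : 'M[R]_n) : R :=
  \big[Order.max/0]_(i < n) \sum_(j < n) `|A i j|.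

End MatrixNorms.

Section ConvexDistance.
Context {R : realType} {n : nat} (L : 'I_n -> ptopologicalType).
Implicit Types (c : 'rV[R]_n) (x y : prod_topology L) (S : set (prod_topology L)).

Definition weighted_hamming c x y : R :=
  \sum_(i < n) c 0 i * (x i != y i)%:R.

(* For fixed c and x, weighted_hamming c x takes finitely many values, so for
   nonempty S the infimum is a minimum. For empty S it is 0. *)
Definition weighted_hamming_set c x S : R :=
  inf [set weighted_hamming c x y | y in S].

(* For Borel S, the function convex_dist ^~ S is in general only universally
   measurable. The integral of such a nonnegative function, which the library
   defines as a supremum over measurable simple functions below it, is the
   integral with respect to the completed measure. *)
Definition convex_dist x S : R :=
  sup [set weighted_hamming_set c x S | c in
        [set c : 'rV[R]_n | (forall i, 0 <= c 0 i) /\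
                 Num.sqrt (\sum_(i < n) c 0 i ^+ 2) = 1]].

End ConvexDistance.

(* Main.v *)
(** Inner regularity of the law of [X] on a product of Polish spaces reduces the
    claim to a compact [K] inside [S]. There [f = d_T(., K)^2] is Borel, vanishes
    on [K], and has one-sided bounded differences: replacing [d_T] by the supremum
    over weights with [c_i = 0] gives [b_i], independent of the [i]th coordinate,
    with [b_i <= f <= b_i + 1] and [\sum_i (f - b_i)^2 <= 4 f]. It then suffices
    to show [E exp(t f) * E exp(- s f) <= 1] for [t = d / 26.1] and a well chosen
    [s], where [d = 1 - ||A||_1].

    Let [K_i] resample the [i]th coordinate from its conditional law. For [h > 0]
    let [J_i h] be the minimum of [E ((h - c)^2 / h)] over [c] independent of the
    [i]th coordinate. One step of the lazy Gibbs sampler with a small step size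
    contracts [\sum_i J_i h]: the row and column sums of [A] bound the influence of
    [K_j] on [J_i], up to the Lipschitz constant of [log h], which decays as well.
    Summing the differences of [E (f * h_k)] along the iterates [h_k -> E h] bounds
    [E (f h) - E f * E h] in terms of [\sum_i J_i h] and [E (f h)]. For
    [h = exp(+- l f)] the differences [f - b_i] bound [\sum_i J_i h] by a multiple
    of [l^2 * E (f h)], so this compares the tilted means of [f] with [E f].
    Integrating in [l] over a short grid gives the two exponential moments. *)

(* Because [f = 0] on [K], [E exp(- s f)] is at least the mass of [K]; this is how a product of two
   exponential moments gives the claim. The only unknown in the two bounds is [d * E f]: the
   exponents are [0.055] and [- 0.056] times it, so it cancels. The tilts are taken of order [d]
   because errors accumulate to factors [exp (O(l / d))]. The passage to [K] is forced by
   measurability: the resampling operators act on Borel functions, and [d_T(., S)] need not be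
   Borel. The heart is the influence of resampling [j] on the square root of [J_i]. It is governed
   by the rate at which alternating conditional expectations in [i] and [j] converge, about
   [sqrt (a_ij * a_ji)]. This is at most [(a_ij + a_ji) / 2], and half a row sum plus half a column
   sum is at most [1 - d / 2]; hence both norms enter, and one strict inequality suffices. The
   obstacle is that [J_i] carries the weight [1 / h], for which neither [h] nor its resampled
   version gives exact projections at both sites. The mismatch is of the order of the Lipschitz
   constant of [log h], so it costs a constant factor once these constants are summed along the
   iterates. *)
Require Import Defs.
From HB Require Import structures.
From mathcomp Require Import all_boot all_order all_algebra.
From mathcomp Require Import all_classical all_reals all_analysis.
From mathcomp Require Import measurable_realfun borel_hierarchy.
From mathcomp Require Import ring lra.

Set Implicit Arguments.
Unset Strict Implicit.
Unset Printing Implicit Defensive.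

Import Order.TTheory GRing.Theory Num.Theory.
Import numFieldNormedType.Exports.

Local Open Scope classical_set_scope.
Local Open Scope ring_scope.

(** * Abstract Gibbs resampling *)

Section Gibbs.
Context {R : realType} {T : Type} {n : nat}.

(* [adj i x y]: the points [x] and [y] differ at most in coordinate [i];
   [bm]: bounded and measurable; [K i]: resampling of coordinate [i].
   [K_dobrushin] compares resampling of coordinate [j] at two points that differ
   in coordinate [k], where [F x' <= F' y'] holds for each common new value. *)
Record gibbs (adj : 'I_n -> T -> T -> Prop) (bm : (T -> R) -> Prop)
    (E : (T -> R) -> R) (K : 'I_n -> (T -> R) -> T -> R) (a : 'I_n -> 'I_n -> R) :
    Prop := Gibbs {
  adj_refl : forall i x, adj i x x ;
  adj_sym : forall i x y, adj i x y -> adj i y x ;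
  adj_trans : forall i x y z, adj i x y -> adj i y z -> adj i x z ;
  adj_comm : forall i j x y z, adj j x y -> adj i y z ->
    exists2 t, adj i x t & adj j t z ;
  bm_cst : forall c, bm (fun=> c) ;
  bmD : forall F G, bm F -> bm G -> bm (fun x => F x + G x) ;
  bmM : forall F G, bm F -> bm G -> bm (fun x => F x * G x) ;
  bmV : forall F m, bm F -> 0 < m -> (forall x, m <= F x) -> bm (fun x => (F x)^-1) ;
  bm_expR : forall F, bm F -> bm (fun x => expR (F x)) ;
  bmK : forall i F, bm F -> bm (K i F) ;
  bm_bounded : forall F, bm F -> exists M, forall x, `|F x| <= M ;
  E_cst : forall c, E (fun=> c) = c ;
  ED : forall F G, bm F -> bm G -> E (fun x => F x + G x) = E F + E G ;
  EZ : forall c F, bm F -> E (fun x => c * F x) = c * E F ;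
  E_ge0 : forall F, bm F -> (forall x, 0 <= F x) -> 0 <= E F ;
  KD : forall i F G x, bm F -> bm G -> K i (fun y => F y + G y) x = K i F x + K i G x ;
  KM : forall i g F x, bm g -> bm F -> (forall y z, adj i y z -> g y = g z) ->
    K i (fun y => g y * F y) x = g x * K i F x ;
  K_le : forall i F x c, bm F -> (forall y, adj i x y -> F y <= c) -> K i F x <= c ;
  K_ind : forall i F, bm F -> forall x y, adj i x y -> K i F x = K i F y ;
  EK : forall i F, bm F -> E (K i F) = E F ;
  K_dobrushin : forall j k x y F F' m M, j != k -> adj k x y -> bm F -> bm F' ->
    (forall x' y', adj j x x' -> adj j y y' -> adj k x' y' -> F x' <= F' y') ->
    (forall y', adj j y y' -> m <= F' y' <= M) ->
    K j F x <= K j F' y + a j k * (M - m)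
}.

Definition ind (adj : 'I_n -> T -> T -> Prop) i (F : T -> R) :=
  forall x y, adj i x y -> F x = F y.
Definition pos (F : T -> R) := exists2 m, 0 < m & forall x, m <= F x.

Variables (adj : 'I_n -> T -> T -> Prop) (bm : (T -> R) -> Prop)
  (E : (T -> R) -> R) (K : 'I_n -> (T -> R) -> T -> R) (a : 'I_n -> 'I_n -> R).
Hypothesis G : gibbs adj bm E K a.

Lemma bm_inv F : bm F -> pos F -> bm (fun x => (F x)^-1).
Proof. by move=> bF [m m0 mF]; exact: (bmV G bF m0 mF). Qed.

Lemma bmN F : bm F -> bm (fun x => - F x).
Proof.
move=> bF; have := bmM G (bm_cst G (-1)) bF.
by congr bm; apply/funext => x; rewrite mulN1r.
Qed.

Lemma bmX F k : bm F -> bm (fun x => F x ^+ k).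
Proof.
move=> bF; elim: k => [|k IH].
  by have := bm_cst G 1; congr bm; apply/funext => x; rewrite expr0.
by have := bmM G bF IH; congr bm; apply/funext => x; rewrite exprS.
Qed.

Lemma pos_gt0 F x : pos F -> 0 < F x.
Proof. by move=> [m m0 mF]; exact: lt_le_trans (mF x). Qed.

Lemma pos_neq0 F x : pos F -> F x != 0.
Proof. by move=> pF; rewrite gt_eqF// pos_gt0. Qed.

Lemma posV F : bm F -> pos F -> pos (fun x => (F x)^-1).
Proof.
move=> bF pF; have [M FM] := bm_bounded G bF.
have M0 x : 0 < F x <= `|M| + 1.
  rewrite pos_gt0//=; have := FM x; have := ler_norm (F x); have := ler_norm M.
  by lra.
exists (`|M| + 1)^-1; first by rewrite invr_gt0; have := normr_ge0 M; lra.
by move=> x; rewrite lef_pV2 ?posrE//; have := M0 x; have := normr_ge0 M; lra.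
Qed.

Lemma indV i F : ind adj i F -> ind adj i (fun x => (F x)^-1).
Proof. by move=> iF x y /iF ->. Qed.

(** [K_le] bounds both [K i c] and [K i (- c)] from above. Their sum is [K i 0], which vanishes
    because the factor [0] can be pulled out. *)
Lemma K_cst i c x : K i (fun=> c) x = c.
Proof.
apply/eqP; rewrite eq_le; apply/andP; split.
  by apply: (K_le G) => //; exact: (bm_cst G).
have : K i (fun=> - c) x <= - c by apply: (K_le G) => //; exact: (bm_cst G).
have := KD G i x (bm_cst G c) (bm_cst G (- c)).
have -> : K i (fun=> c + - c) x = 0 * K i (fun=> 1) x.
  rewrite -(KM G (g := fun=> 0))//; try exact: (bm_cst G).
  by congr (K i _ x); apply/funext => y; rewrite mul0r subrr.
by lra.
Qed.

Lemma KZ i c F x : bm F -> K i (fun y => c * F y) x = c * K i F x.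
Proof. by move=> bF; rewrite (KM G (g := fun=> c))//; exact: (bm_cst G). Qed.

Lemma KN i F x : bm F -> K i (fun y => - F y) x = - K i F x.
Proof.
move=> bF; rewrite -mulN1r -KZ//.
by congr (K i _ x); apply/funext => y; rewrite mulN1r.
Qed.

Lemma KB i F F' x : bm F -> bm F' -> K i (fun y => F y - F' y) x = K i F x - K i F' x.
Proof. by move=> bF bF'; rewrite (KD G)// ?KN//; exact: bmN. Qed.

Lemma EN F : bm F -> E (fun y => - F y) = - E F.
Proof.
move=> bF; rewrite -mulN1r -(EZ G)//.
by congr E; apply/funext => y; rewrite mulN1r.
Qed.

Lemma EB F F' : bm F -> bm F' -> E (fun y => F y - F' y) = E F - E F'.
Proof. by move=> bF bF'; rewrite (ED G)// ?EN//; exact: bmN. Qed.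

Lemma E_le F F' : bm F -> bm F' -> (forall x, F x <= F' x) -> E F <= E F'.
Proof.
move=> bF bF' FF'; rewrite -subr_ge0 -EB//; apply: (E_ge0 G).
  by apply: (bmD G) => //; exact: bmN.
by move=> x; rewrite subr_ge0.
Qed.

Lemma K_ge i F x c : bm F -> (forall y, adj i x y -> c <= F y) -> c <= K i F x.
Proof.
move=> bF cF; rewrite -lerN2 -KN//; apply: (K_le G); first exact: bmN.
by move=> y xy; rewrite lerN2 cF.
Qed.

Lemma K_mono i F F' x : bm F -> bm F' -> (forall y, adj i x y -> F y <= F' y) ->
  K i F x <= K i F' x.
Proof.
move=> bF bF' FF'; rewrite -subr_ge0 -KB//; apply: K_ge.
  by apply: (bmD G) => //; exact: bmN.
by move=> y xy; rewrite subr_ge0 FF'.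
Qed.

Lemma posK i F : bm F -> pos F -> pos (K i F).
Proof. by move=> bF [m m0 mF]; exists m => // x; apply: K_ge. Qed.

Lemma K_id i F x : bm F -> ind adj i F -> K i F x = F x.
Proof.
move=> bF iF; have := KM G x bF (bm_cst G 1) iF; rewrite K_cst mulr1 => <-.
by congr (K i _ x); apply/funext => y; rewrite mulr1.
Qed.

Lemma indK i F : bm F -> ind adj i (K i F).
Proof. by move=> bF; exact: (K_ind G). Qed.

(** [g] passes through [K i], and [E] is invariant under [K i]: the operator acts as a conditional
    expectation given the other coordinates. *)
Lemma E_indK i g F : bm g -> bm F -> ind adj i g ->
  E (fun x => g x * K i F x) = E (fun x => g x * F x).
Proof.
move=> bg bF ig; rewrite -(EK G i (bmM G bg bF)).
by congr E; apply/funext => x; rewrite (KM G).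
Qed.

Lemma E_ind0 i g F : bm g -> bm F -> ind adj i g -> (forall x, K i F x = 0) ->
  E (fun x => g x * F x) = 0.
Proof.
move=> bg bF ig F0; rewrite -(@E_indK i)//.
rewrite -(E_cst G 0); congr E; apply/funext => x; by rewrite F0 mulr0.
Qed.

End Gibbs.

Ltac bmt := match goal with G : gibbs _ _ _ _ _ |- _ =>
  repeat first [ assumption | exact: (bm_cst G) | apply: (bmK G) |
  apply: (bmM G) | apply: (bmD G) | apply: (bmN G) | apply: (bmX G) |
  apply: (bm_inv G) ] end.

(** * The one-site energy and its dual form *)

Section Functional.
Context {R : realType} {T : Type} {n : nat}.
Variables (adj : 'I_n -> T -> T -> Prop) (bm : (T -> R) -> Prop)
  (E : (T -> R) -> R) (K : 'I_n -> (T -> R) -> T -> R) (a : 'I_n -> 'I_n -> R).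
Hypothesis G : gibbs adj bm E K a.

(** The quadratic form [E (p * (s F + t F')^2)] is nonnegative. It may degenerate, so the case
    [v = 0] needs its own choices of [s] and [t]. *)
Lemma E_cauchy p F F' : bm p -> bm F -> bm F' -> (forall x, 0 <= p x) ->
  E (fun x => p x * F x * F' x) ^+ 2 <=
  E (fun x => p x * F x ^+ 2) * E (fun x => p x * F' x ^+ 2).
Proof.
move=> bp bF bF' p0.
set u := E _; set v := E _; set w := E _.
have key s t : 0 <= s ^+ 2 * v + 2 * s * t * u + t ^+ 2 * w.
  have -> : s ^+ 2 * v + 2 * s * t * u + t ^+ 2 * w =
      E (fun x => p x * (s * F x + t * F' x) ^+ 2).
    rewrite /u /v /w -!(EZ G)//; bmt; rewrite -!(ED G)//; bmt.
    by congr E; apply/funext => x; ring.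
  by apply: (E_ge0 G); [bmt | move=> x; rewrite mulr_ge0// sqr_ge0].
have v0 : 0 <= v by have := key 1 0; lra.
have w0 : 0 <= w by have := key 0 1; lra.
have [v00|vn0] := eqVneq v 0.
  have [w00|wn0] := eqVneq w 0.
    have := key 1 1; have := key 1 (-1); rewrite v00 w00.
    by move=> ? ?; have -> : u = 0 by lra.
  have := key (- u) (w^-1 * (u ^+ 2)); rewrite v00.
  have [u0|un0] := eqVneq u 0; first by rewrite u0; lra.
  have := key (- (w + 1)) u; have := key (- w) u; rewrite v00 => A B.
  by nra.
have : 0 < v by rewrite lt_neqAle eq_sym vn0.
by have := key (- u) v; nra.
Qed.

(* [cm i h] is the function [c] independent of coordinate [i] that minimizes
   [E ((h - c)^2 / h)], and [J i h] is the minimum. *)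
Definition cm i (h : T -> R) x := (K i (fun y => (h y)^-1) x)^-1.
(** The relative residual [(h - c) / h] of the minimizer. For the weight [h] it represents the
    functional [phi |-> E (h * phi)] on the functions with [K i phi = 0], and [J i h] is its squared
    norm. *)
Definition ph i (h : T -> R) x := 1 - cm i h x * (h x)^-1.
Definition J i (h : T -> R) := E h - E (cm i h).

Section OneSite.
Variables (i : 'I_n) (h : T -> R).
Hypotheses (bh : bm h) (hpos : pos h).

Lemma bm_cm : bm (cm i h).
Proof. by rewrite /cm; bmt; apply: (posK G); bmt; apply: (posV G). Qed.

Lemma pos_cm : pos (cm i h).
Proof.
apply: (posV G); first by bmt.
by apply: (posK G); bmt; apply: (posV G).
Qed.

Lemma ind_cm : ind adj i (cm i h).
Proof. by apply: indV; apply: (indK G); bmt. Qed.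

Let bcm := bm_cm.
Let icm := ind_cm.

Lemma bm_ph : bm (ph i h).
Proof. by rewrite /ph; bmt. Qed.

Let bph := bm_ph.

Lemma K_inv x : K i (fun y => (h y)^-1) x = (cm i h x)^-1.
Proof. by rewrite /cm invrK. Qed.

Lemma K_ph x : K i (ph i h) x = 0.
Proof.
rewrite /ph (KB G); [|by bmt..].
by rewrite (K_cst G) (KM G) ?K_inv ?divff ?subrr//; bmt; exact/pos_neq0/pos_cm.
Qed.

(** [h * ph] is [h - cm], and [cm] is independent of coordinate [i], hence orthogonal to [phi]. *)
Lemma E_ph phi : bm phi -> (forall x, K i phi x = 0) ->
  E (fun x => h x * ph i h x * phi x) = E (fun x => h x * phi x).
Proof.
move=> bphi Kphi.
have -> : (fun x => h x * ph i h x * phi x) =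
    (fun x => h x * phi x - cm i h x * phi x).
  apply/funext => x; rewrite /ph; have := pos_neq0 x hpos; move=> ?; field.
  by [].
by rewrite (EB G); [|bmt..]; rewrite (E_ind0 G (i := i) (g := cm i h))// subr0.
Qed.

Lemma J_ph : J i h = E (fun x => h x * ph i h x).
Proof.
rewrite /J -(EB G)//; congr E; apply/funext => x; rewrite /ph.
by have := pos_neq0 x hpos; move=> ?; field.
Qed.

Lemma J_ph2 : J i h = E (fun x => h x * ph i h x ^+ 2).
Proof.
rewrite J_ph -(E_ph bph K_ph); congr E; apply/funext => x; ring.
Qed.

Lemma J_ge0 : 0 <= J i h.
Proof.
rewrite J_ph2; apply: (E_ge0 G); first by bmt.
by move=> x; rewrite mulr_ge0 ?sqr_ge0// ltW// pos_gt0.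
Qed.

(** For fixed [phi] the first term is linear in [h] and the second is nonnegative, so [J] is a
    maximum of linear functionals and is convex in [h]. The exact form of the defect serves to bound
    the second-order term of a mixture. *)
Lemma J_variation phi : bm phi -> (forall x, K i phi x = 0) ->
  J i h = E (fun x => h x * (2 * phi x - phi x ^+ 2)) +
          E (fun x => h x * (phi x - ph i h x) ^+ 2).
Proof.
move=> bphi Kphi; rewrite -(ED G); [|by bmt..].
have -> : (fun x => h x * (2 * phi x - phi x ^+ 2) +
     h x * (phi x - ph i h x) ^+ 2) =
   (fun x => h x * ph i h x ^+ 2 + 2 * (h x * phi x - h x * ph i h x * phi x)).
  by apply/funext => x; ring.
rewrite (ED G); [|by bmt..]; rewrite (EZ G); last by bmt.
by rewrite (EB G); [|by bmt..]; rewrite E_ph// subrr mulr0 addr0 -J_ph2.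
Qed.

Lemma J_cauchy phi : bm phi -> (forall x, K i phi x = 0) ->
  E (fun x => h x * phi x) ^+ 2 <= J i h * E (fun x => h x * phi x ^+ 2).
Proof.
move=> bphi Kphi; rewrite -(E_ph bphi Kphi) J_ph2.
by apply: E_cauchy => // x; rewrite ltW// pos_gt0.
Qed.

(** Since [b] ignores coordinate [i], the factor [1 / h] of [b^2] may be replaced by its conditional
    mean [1 / c]. The excess over [J] is then [(b - c)^2 / c], nonnegative at every point. *)
Lemma J_le b : bm b -> ind adj i b ->
  J i h <= E (fun x => (h x - b x) ^+ 2 * (h x)^-1).
Proof.
move=> bb ib.
have -> : (fun x => (h x - b x) ^+ 2 * (h x)^-1) =
    (fun x => h x - 2 * b x + b x ^+ 2 * (h x)^-1).
  by apply/funext => x; have := pos_neq0 x hpos; move=> ?; field.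
rewrite (ED G); [|by bmt..]; rewrite -(E_indK G (i := i) (g := fun x => b x ^+ 2)); [|by bmt..|]; last first.
  by move=> x y xy; rewrite (ib x y).
rewrite -(ED G); [|by bmt..]; rewrite /J -(EB G); [|by bmt..].
apply: (E_le G); [by bmt..|move=> x].
rewrite K_inv; have c0 := pos_gt0 x pos_cm.
have -> : h x - 2 * b x + b x ^+ 2 * (cm i h x)^-1 =
   h x - cm i h x + (b x - cm i h x) ^+ 2 * (cm i h x)^-1.
  by field; rewrite gt_eqF.
by rewrite lerDl mulr_ge0 ?sqr_ge0// invr_ge0 ltW.
Qed.

End OneSite.

Lemma J_ind i h : bm h -> pos h -> ind adj i h -> forall x, ph i h x = 0.
Proof.
move=> bh hpos ih x; rewrite /ph /cm (K_id G) ?invrK ?divff ?subrr//.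
- exact: pos_neq0.
- by bmt.
- exact: indV.
Qed.

End Functional.

(** * Contraction of alternating projections *)

Section LogConvex.
Context {R : realType}.

Lemma bernoulli_ineq (x : R) k : 0 <= x -> 1 + k%:R * x <= (1 + x) ^+ k.
Proof.
move=> x0; elim: k => [|k IH]; first by rewrite expr0 mul0r addr0.
rewrite exprS -natr1; have k0 : 0 <= k%:R :> R by [].
have : 0 <= k%:R * x * x by rewrite !mulr_ge0.
nra.
Qed.

(** The ratios of consecutive terms do not decrease. If the first one, [t], exceeded [r], then
    [s (2 m) >= t^(2 m) * s 0] would outgrow [C * r^(2 m)] by Bernoulli's inequality. *)
Lemma log_convex_decay (s : nat -> R) C r : 0 <= r -> (forall k, 0 <= s k) ->
  (forall k, s k.+1 ^+ 2 <= s k * s k.+2) ->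
  (forall m, s m.*2 <= C * (r ^+ m) ^+ 2) -> s 1%N <= r * s 0%N.
Proof.
move=> r0 s0 slc sC.
have [s00|sn0] := eqVneq (s 0%N) 0.
  have := slc 0%N; rewrite s00 mul0r mulr0 => H.
  have : s 1%N ^+ 2 = 0 by apply/eqP; rewrite eq_le H sqr_ge0.
  by move/eqP; rewrite sqrf_eq0 => /eqP ->.
have s0p : 0 < s 0%N by rewrite lt_neqAle eq_sym sn0 s0.
rewrite leNgt; apply/negP => rs.
pose t := s 1%N / s 0%N.
have rt : r < t by rewrite /t ltr_pdivlMr.
have t0 : 0 < t by exact: le_lt_trans rt.
have st k : 0 < s k /\ t * s k <= s k.+1.
  elim: k => [|k [skp IH]]; first by split=> //; rewrite /t divfK.
  have sk1 : 0 < s k.+1 by apply: lt_le_trans IH; rewrite mulr_gt0.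
  split=> //; rewrite -(ler_pM2l skp) mulrCA mulrA.
  by apply: le_trans (slc k); rewrite expr2 ler_pM2r.
have stk k : t ^+ k * s 0%N <= s k.
  elim: k => [|k IH]; first by rewrite expr0 mul1r.
  rewrite exprS -mulrA; apply: le_trans (st k).2.
  by rewrite ler_pM2l.
have [r00|rn0] := eqVneq r 0.
  have := sC 1%N; rewrite r00 expr1 expr0n/= mulr0 => H.
  by have := (st 2).1; rewrite ltNge H.
have rp : 0 < r by rewrite lt_neqAle eq_sym rn0 r0.
clearbody t; pose x := (t / r) ^+ 2 - 1.
have x0 : 0 < x.
  by rewrite /x subr_gt0 exprn_egt1// ltr_pdivlMr// mul1r.
have key m : (1 + m%:R * x) * s 0%N <= C.
  apply: (@le_trans _ _ ((1 + x) ^+ m * s 0%N)).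
    by rewrite ler_pM2r//; apply/bernoulli_ineq/ltW.
  have -> : 1 + x = t ^+ 2 / r ^+ 2 by rewrite /x expr_div_n; ring.
  have rm : 0 < (r ^+ 2) ^+ m by rewrite !exprn_gt0.
  have := le_trans (stk m.*2) (sC m).
  by rewrite -mul2n exprM -(exprAC r 2 m) expr_div_n mulrAC ler_pdivrMr.
have C0 : 0 <= C by have := key 0%N; rewrite mul0r addr0 mul1r; lra.
have := archi_boundP (divr_ge0 C0 (ltW (mulr_gt0 x0 s0p)));
set N := Num.bound _; rewrite ltr_pdivrMr ?mulr_gt0//.
by have := key N; nra.
Qed.

End LogConvex.

Section Alternating.
Context {R : realType} {T : Type} {n : nat}.
Variables (adj : 'I_n -> T -> T -> Prop) (bm : (T -> R) -> Prop)
  (E : (T -> R) -> R) (K : 'I_n -> (T -> R) -> T -> R) (a : 'I_n -> 'I_n -> R).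
Hypothesis G : gibbs adj bm E K a.
Hypothesis a_ge0 : forall i j, 0 <= a i j.

Lemma fibre_range j F d y : bm F ->
  (forall x z, adj j x z -> F x - F z <= d) ->
  exists m, forall z, adj j y z -> m <= F z <= m + d.
Proof.
move=> bF oF; pose S := [set F z | z in [set z | adj j y z]]%classic.
have [M FM] := bm_bounded G bF.
have Sy : S (F y) by exists y => //; exact: (adj_refl G).
have hS : has_inf S.
  split; first by exists (F y).
  exists (- M) => _ [z _ <-]; have := FM z; rewrite ler_norml => /andP[]; lra.
exists (inf S) => z yz; apply/andP; split.
  by apply: ge_inf; [exact: hS.2 | exists z].
rewrite -lerBlDr; apply: lb_le_inf; first by exists (F y).
move=> _ [w yw <-]; have := oF z w; rewrite lerBlDr lerBlDl addrC; apply.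
exact: (adj_trans G) (adj_sym G yz) yw.
Qed.

(** [F] ignores coordinate [i], so moving that coordinate changes only the law with which [K j]
    averages. *)
Lemma osc_K i j F d x y : i != j -> bm F -> ind adj i F ->
  (forall x z, adj j x z -> F x - F z <= d) ->
  adj i x y -> K j F x - K j F y <= a j i * d.
Proof.
move=> ij bF iF oF xy; have [m mF] := fibre_range y bF oF.
rewrite lerBlDl; have := K_dobrushin G (j := j) (k := i) (x := x) (y := y)
  (F := F) (F' := F) (m := m) (M := m + d).
rewrite addrAC subrr add0r; apply => //; first by rewrite eq_sym.
by move=> x' y' _ _ /iF ->.
Qed.

Variables (i j : 'I_n) (H : T -> R) (q : R).
Hypotheses (ij : i != j) (bH : bm H) (pH : pos H) (jH : ind adj j H).
Hypotheses (q_ge1 : 1 <= q) (qH : forall x y, adj i x y -> H x <= q * H y).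

Let g x := (H x)^-1.
Let bg : bm g. Proof. exact: (bm_inv G). Qed.
Let pg : pos g. Proof. exact: (posV G). Qed.
Let jg : ind adj j g. Proof. exact: indV. Qed.
Let bc : bm (cm K i H) := bm_cm G i bH pH.
Let pc : pos (cm K i H) := pos_cm G i bH pH.
Let ic : ind adj i (cm K i H) := ind_cm G bH pH (i := i).

(** The conditional expectation at site [i] for the law reweighted by [1 / H]. It maps [H] itself to
    [cm K i H]. *)
Definition tiltK (F : T -> R) x := K i (fun y => (H y)^-1 * F y) x * cm K i H x.

Lemma bm_tiltK F : bm F -> bm (tiltK F).
Proof. by move=> bF; rewrite /tiltK; bmt. Qed.

Lemma ind_tiltK F : bm F -> ind adj i (tiltK F).
Proof.
move=> bF x y xy; rewrite /tiltK (ic xy); congr (_ * _).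
by apply: (K_ind G) => //; bmt.
Qed.

Lemma tiltK_id F x : bm F -> ind adj i F -> tiltK F x = F x.
Proof.
move=> bF iF; rewrite /tiltK.
have -> : (fun y => (H y)^-1 * F y) = (fun y => F y * (H y)^-1).
  by apply/funext => y; rewrite mulrC.
by rewrite (KM G)// K_inv -mulrA mulVf ?mulr1//; exact: pos_neq0.
Qed.

Let ip F F' := E (fun x => g x * F x * F' x).

(** The identity says at once that [tiltK] is self-adjoint and idempotent for the weight [1 / H].
    The analogue [ip_K] holds because [H] ignores coordinate [j]. *)
Lemma ip_tiltK F F' : bm F -> bm F' -> ip F (tiltK F') = ip (tiltK F) (tiltK F').
Proof.
move=> bF bF'.
have bA := bm_tiltK bF; have bA' := bm_tiltK bF'.
have iA := ind_tiltK bF; have iA' := ind_tiltK bF'.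
have -> : ip F (tiltK F') = E (fun x => tiltK F' x * (g x * F x)).
  by congr E; apply/funext => x; ring.
have -> : ip (tiltK F) (tiltK F') = E (fun x => (tiltK F x * tiltK F' x) * g x).
  by congr E; apply/funext => x; ring.
rewrite -(E_indK G (i := i) (g := tiltK F')) //; [|by bmt..].
rewrite -(E_indK G (i := i) (g := fun x => tiltK F x * tiltK F' x));
  [|by bmt..|by move=> x y xy; rewrite (iA x y)// (iA' x y)].
congr E; apply/funext => x.
rewrite /g K_inv {2}/tiltK -/g.
by have := pos_neq0 x pc; move=> ?; field.
Qed.

Lemma ip_K F F' : bm F -> bm F' -> ip F (K j F') = ip (K j F) (K j F').
Proof.
move=> bF bF'.
have -> : ip F (K j F') = E (fun x => (g x * K j F' x) * F x).
  by congr E; apply/funext => x; ring.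
have -> : ip (K j F) (K j F') = E (fun x => (g x * K j F' x) * K j F x).
  by congr E; apply/funext => x; ring.
rewrite -[LHS](E_indK G (i := j))//; first by bmt.
by move=> x y xy; rewrite (jg xy); congr (_ * _); exact: (K_ind G).
Qed.

Lemma ipC F F' : ip F F' = ip F' F.
Proof. by congr E; apply/funext => x; ring. Qed.

(** A Dobrushin bound for the tilted conditional law. The weight [1 / H] does not see the move in
    [j]; replacing it by an upper bound along the [i]-fibre costs the factor [q], and normalization
    cancels [K i g x]. *)
Lemma osc_tiltK F d x y : bm F -> ind adj j F ->
  (forall x z, adj i x z -> F x - F z <= d) ->
  adj j x y -> tiltK F x - tiltK F y <= q * a i j * d.
Proof.
move=> bF jF oF xy; have [m mF] := fibre_range y bF oF.
set t := tiltK F y.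
have bgF : bm (fun z => (H z)^-1 * F z) by bmt.
have Kg z : 0 < K i g z by exact/pos_gt0/(posK G).
have tE z : K i (fun z => (H z)^-1 * F z) z = tiltK F z * K i g z.
  by rewrite /tiltK /g K_inv mulfK// pos_neq0.
have tm : m <= t <= m + d.
  apply/andP; split; rewrite -(ler_pM2r (Kg y)) -tE -(KZ G)//; apply: (K_mono G) => //;
    try (by bmt); move=> z /mF /andP[mz mz']; have := pos_gt0 z pg;
    rewrite -/(g z); nra.
pose F1 z := (H z)^-1 * (F z - t).
have bF1 : bm F1 by rewrite /F1; bmt.
have KF1 z : K i F1 z = (tiltK F z - t) * K i g z.
  have -> : F1 = (fun z => (H z)^-1 * F z - t * g z).
    by apply/funext => z'; rewrite /F1 /g; ring.
  by rewrite (KB G)//; [rewrite (KZ G)// tE; ring | bmt].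
pose g1 := q * K i g x.
have g1ub z : adj i y z -> 0 <= (H z)^-1 <= g1.
  move=> yz; rewrite invr_ge0 (ltW (pos_gt0 _ pH))//=.
  have [w xw wz] := adj_comm G (adj_sym G (adj_sym G xy)) yz.
  rewrite -[(H z)^-1](@jg w z wz) /g1 -(KZ G)//; apply: (K_ge G); first by bmt.
  move=> v xv; rewrite /g; have Hw := pos_gt0 w pH; have Hv := pos_gt0 v pH.
  rewrite ler_pdivlMr// mulrC ler_pdivrMr//; apply: qH.
  exact: (adj_trans G) (adj_sym G xv) xw.
have := K_dobrushin G (j := i) (k := j) (x := x) (y := y) (F := F1) (F' := F1)
   (m := g1 * (m - t)) (M := g1 * (m + d - t)).
move=> /(_ ij xy bF1 bF1).
have -> : K i F1 y = 0 by rewrite KF1 subrr mul0r.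
rewrite KF1 add0r => KD.
have : (tiltK F x - t) * K i g x <= a i j * (g1 * (m + d - t) - g1 * (m - t)).
  apply: KD.
    by move=> x' y' _ _ xy'; rewrite /F1 (jF _ _ xy') (jH xy').
  move=> z yz; have := mF z yz; have := g1ub z yz; rewrite /F1.
  move: ((H z)^-1) => u /andP[u0 u1] /andP[? ?]; move/andP: tm => [? ?].
  by apply/andP; split; nra.
have -> : a i j * (g1 * (m + d - t) - g1 * (m - t)) = q * a i j * d * K i g x.
  by rewrite /g1; ring.
by rewrite ler_pM2r.
Qed.

Fixpoint alt k := if k is k'.+1 then
  if odd k' then K j (alt k') else tiltK (alt k') else H.

Lemma bm_alt k : bm (alt k).
Proof.
elim: k => //= k IH; case: ifP => _; first by bmt.
exact: bm_tiltK.
Qed.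

Lemma ind_alt k : ind adj (if odd k then i else j) (alt k).
Proof.
case: k => //= k; case: (odd k) => /=.
  exact: (indK G) (bm_alt k).
exact: ind_tiltK (bm_alt k).
Qed.

Let s k := ip (fun x => alt k x - alt k.+1 x) (fun x => alt k x - alt k.+1 x).

Let Q k := if odd k then K j else tiltK.
Let ipQ k F F' : bm F -> bm F' -> ip F (Q k F') = ip (Q k F) (Q k F').
Proof. by rewrite /Q; case: (odd k); [exact: ip_K | exact: ip_tiltK]. Qed.
Let altS k : alt k.+1 = Q k (alt k).
Proof. by rewrite /= /Q; case: (odd k). Qed.
Let Qalt k : Q k.+1 (alt k) = alt k.
Proof.
rewrite /Q /=; have := @ind_alt k; have := bm_alt k; case: (odd k) => /= b1 i1.
  by apply/funext => x; rewrite tiltK_id.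
by apply/funext => x; rewrite (K_id G).
Qed.

Let ipB F F1 F2 : bm F -> bm F1 -> bm F2 ->
  ip F (fun x => F1 x - F2 x) = ip F F1 - ip F F2.
Proof.
move=> b b1 b2; rewrite /ip -(EB G); [|by bmt..].
by congr E; apply/funext => x; ring.
Qed.

Let ip_sub F F1 F2 F3 : bm F -> bm F1 -> bm F2 -> bm F3 ->
  ip (fun x => F x - F1 x) (fun x => F2 x - F3 x) =
  ip F F2 - ip F F3 - ip F1 F2 + ip F1 F3.
Proof.
move=> b b1 b2 b3; rewrite ipB//; last by bmt.
rewrite ![ip (fun x => F x - F1 x) _]ipC !ipB//.
rewrite ![ip _ F]ipC ![ip _ F1]ipC; ring.
Qed.

Let sE k : s k = ip (alt k) (alt k) - ip (alt k.+1) (alt k.+1).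
Proof.
have bk := bm_alt; rewrite /s ip_sub// [ip (alt k.+1) (alt k)]ipC altS.
by rewrite (@ipQ k (alt k) (alt k))//; rewrite -altS; ring.
Qed.

(** All inner products of iterates reduce to squared norms by [ipQ]. Writing [s k.+1] as a product
    of the increments [k] and [k.+2] makes log-convexity an instance of the Cauchy-Schwarz
    inequality. *)
Let s_cross k : s k.+1 = ip (fun x => alt k x - alt k.+1 x)
                            (fun x => alt k.+2 x - alt k.+3 x).
Proof.
have bk := bm_alt; rewrite ip_sub// sE.
have QQ : Q k.+2 = Q k by rewrite /Q /= negbK.
have -> : ip (alt k) (alt k.+3) = ip (alt k.+1) (alt k.+3).
  by rewrite (altS k.+2) QQ ipQ// -altS.
have Qsym F F' : bm F -> bm F' -> ip F (Q k.+1 F') = ip (Q k.+1 F) F'.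
  by move=> b b'; rewrite ipQ// [RHS]ipC [RHS]ipQ// ipC.
have -> : ip (alt k) (alt k.+2) = ip (alt k.+1) (alt k.+1).
  by rewrite (altS k.+1) Qsym// Qalt altS ipQ.
have -> : ip (alt k.+1) (alt k.+2) = ip (alt k.+2) (alt k.+2).
  by rewrite (altS k.+1) ipQ.
ring.
Qed.

Let s_ge0 k : 0 <= s k.
Proof.
have bk := bm_alt; apply: (E_ge0 G); first by bmt.
move=> x; rewrite -mulrA mulr_ge0//; first exact/ltW/pos_gt0.
by rewrite -expr2 sqr_ge0.
Qed.

Let s_log_convex k : s k.+1 ^+ 2 <= s k * s k.+2.
Proof.
have bk := bm_alt; rewrite s_cross; apply: le_trans (E_cauchy G _ _ _ _) _; [by bmt..| |].
  by move=> x; exact/ltW/pos_gt0.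
rewrite le_eqVlt; apply/orP; left; apply/eqP; rewrite /s /ip.
by congr (E _ * E _); apply/funext => x; ring.
Qed.

(** One round trip costs the factor [q * a i j] in [tiltK] and the factor [a j i] in [K j]. *)
Let osc_alt : exists2 D, 0 <= D & forall m x y, adj i x y ->
  alt m.*2 x - alt m.*2 y <= D * (q * a i j * a j i) ^+ m.
Proof.
have [M HM] := bm_bounded G bH.
exists (2 * `|M|); first by rewrite mulr_ge0.
elim=> [|m IH] x y xy.
  rewrite expr0 mulr1 /=; have := HM x; have := HM y; have := ler_norm M.
  rewrite !ler_norml => ? /andP[? ?] /andP[? ?]; lra.
have := @ind_alt m.*2; rewrite odd_double => im.
rewrite doubleS /= odd_double /=.
have H1 z w : adj j z w -> tiltK (alt m.*2) z - tiltK (alt m.*2) w <=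
    q * a i j * (2 * `|M| * (q * a i j * a j i) ^+ m).
  by move=> zw; apply: (osc_tiltK (bm_alt _) im _ zw).
have ji : j != i by rewrite eq_sym.
have := osc_K ij (bm_tiltK (bm_alt _)) (ind_tiltK (bm_alt m.*2)) H1 xy.
by rewrite exprS => /le_trans; apply; rewrite le_eqVlt; apply/orP; left; apply/eqP; ring.
Qed.

(* [tiltK] and [K j] are orthogonal projections for the weight [1 / H], so the
   squared increments of their alternating iterates are log-convex. They decay
   geometrically because oscillations contract, and for a log-convex sequence the
   first ratio is then at most the rate. *)
Lemma alternating_contraction :
  E (fun x => (H x)^-1 * (cm K i H x - K j (cm K i H) x) ^+ 2) <=
  q * a i j * a j i * E (fun x => (H x)^-1 * (H x - cm K i H x) ^+ 2).
Proof.
have tH : tiltK H = cm K i H.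
  apply/funext => x; rewrite /tiltK.
  have -> : (fun y => (H y)^-1 * H y) = (fun=> 1).
    by apply/funext => y; rewrite mulVf ?pos_neq0.
  by rewrite (K_cst G) mul1r.
have s0E : s 0%N = E (fun x => (H x)^-1 * (H x - cm K i H x) ^+ 2).
  by rewrite /s /ip /= tH; congr E; apply/funext => x; rewrite /g; ring.
have s1E : s 1%N = E (fun x => (H x)^-1 * (cm K i H x - K j (cm K i H) x) ^+ 2).
  by rewrite /s /ip /= tH; congr E; apply/funext => x; rewrite /g; ring.
rewrite -s0E -s1E; have [D D0 oD] := osc_alt.
have r0 : 0 <= q * a i j * a j i.
  by rewrite !mulr_ge0 ?a_ge0//; exact: le_trans ler01 q_ge1.
apply: (@log_convex_decay _ s (D ^+ 2 * E g)) => // m.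
have bk := bm_alt; rewrite /s /ip [X in _ <= X]mulrAC -exprMn -(EZ G)//.
apply: (E_le G); [by bmt..|move=> x].
rewrite -mulrA -expr2 mulrC ler_pM2r ?pos_gt0//.
rewrite -ler_sqrt ?sqr_ge0// !sqrtr_sqr [X in _ <= X]ger0_norm ?mulr_ge0 ?exprn_ge0//.
have -> : alt m.*2.+1 = tiltK (alt m.*2) by rewrite /= odd_double.
have bm2 := bm_alt m.*2.
have tE z : K i (fun z => (H z)^-1 * alt m.*2 z) z = tiltK (alt m.*2) z * K i g z.
  by rewrite /tiltK /g K_inv mulfK// pos_neq0.
have Kg z : 0 < K i g z by exact/pos_gt0/(posK G).
set d := D * _; have od := oD m; rewrite -/d in od.
(* [tiltK] averages over the [i]-fibre, so it moves a function by at most its oscillation there.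
   This is the source of the constant [D^2 * E g]. *)
have lo : alt m.*2 x - d <= tiltK (alt m.*2) x.
  rewrite -(ler_pM2r (Kg x)) -tE -(KZ G)//; apply: (K_mono G) => //; try by bmt.
  move=> y xy; have := od _ _ xy; have := pos_gt0 y pg.
  by rewrite -/(g y) => gy oy; rewrite [X in _ <= X]mulrC ler_pM2r//; lra.
have hi : tiltK (alt m.*2) x <= alt m.*2 x + d.
  rewrite -(ler_pM2r (Kg x)) -tE -(KZ G)//; apply: (K_mono G) => //; try by bmt.
  move=> y xy; have := od _ _ (adj_sym G xy); have := pos_gt0 y pg.
  by rewrite -/(g y) => gy oy; rewrite [X in X <= _]mulrC ler_pM2r//; lra.
by rewrite ler_norml; apply/andP; split; lra.
Qed.

End Alternating.

(** * Influence of a resampling step on the energies *)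

Section PairArithmetic.
Context {R : realType}.

(** Here [y^2] and [x^2] are the energies at [i] of [K j h] and [h], and [A^2] is the energy of [h]
    at [j]. The main hypothesis is the Cauchy-Schwarz bound for [h] tested with the representer of
    [K j h]; [e1] and [e2] are the errors of replacing [h] by [K j h] in it. The factor [q] in the
    conclusion absorbs [e2]. *)
Lemma sqrt_pair_bound (x y A p q e1 e2 : R) : 0 <= x -> 0 <= y -> 0 <= A ->
  0 <= p -> 1 <= q -> (y ^+ 2 + e1) ^+ 2 <= x ^+ 2 * (y ^+ 2 + e2) ->
  `|e1| <= p * A * y -> `|e2| <= 2 * (q - 1) * (p * A * y) ->
  y <= x + q * p * A.
Proof.
move=> x0 y0 A0 p0 q1 H; rewrite !ler_norml => /andP[e1l _] /andP[_ e2u].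
rewrite leNgt; apply/negP => xy.
have pA : 0 <= p * A by rewrite mulr_ge0.
set w := p * A in pA e1l e2u; have xyw : x + q * w < y by rewrite /w mulrA.
clearbody w; clear xy.
have q1w : 0 <= (q - 1) * w by rewrite mulr_ge0// subr_ge0.
have yp : 0 < y by nra.
have yw : 0 <= y - w by nra.
have K1 : (y * (y - w)) ^+ 2 <= x ^+ 2 * (y ^+ 2 + 2 * (q - 1) * (w * y)).
  apply: le_trans (le_trans H _); last by rewrite ler_wpM2l ?sqr_ge0// lerD2l.
  by rewrite lerXn2r// ?nnegrE; [exact: mulr_ge0|nra|nra].
have K2 : y * (y - w) ^+ 2 <= x ^+ 2 * (y + 2 * (q - 1) * w).
  rewrite -(ler_pM2l yp); apply: le_trans (le_trans _ K1) _.
    by rewrite le_eqVlt; apply/orP; left; apply/eqP; ring.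
  by rewrite le_eqVlt; apply/orP; left; apply/eqP; ring.
have K3 : (y - w) ^+ 2 <= x ^+ 2 + x * (2 * ((q - 1) * w)).
  rewrite -(ler_pM2l yp); apply: le_trans K2 _.
  have : x ^+ 2 * (2 * ((q - 1) * w)) <= y * (x * (2 * ((q - 1) * w))).
    rewrite expr2 -mulrA; apply: ler_wpM2r; last by nra.
    by apply: mulr_ge0 => //; exact: mulr_ge0.
  nra.
have : (x + (q - 1) * w) ^+ 2 < (y - w) ^+ 2.
  by rewrite ltrXn2r// ?nnegrE//; nra.
have : x ^+ 2 + x * (2 * ((q - 1) * w)) <= (x + (q - 1) * w) ^+ 2 by nra.
lra.
Qed.

Lemma sqr_two_sub_le (q u v : R) : 1 <= q ->
  (q^-1 <= u <= q) && (q^-1 <= v <= q) ->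
  (2 - (u + v)) ^+ 2 <= (2 * (q - 1)) ^+ 2.
Proof.
move=> q1; have q0 : 0 < q by exact: lt_le_trans ltr01 q1.
have qi : 1 - (q - 1) <= q^-1.
  by rewrite -(ler_pM2l q0) mulfV ?gt_eqF//; have := sqr_ge0 (q - 1); nra.
move=> /andP[/andP[? ?] /andP[? ?]].
rewrite -ler_sqrt ?sqr_ge0// !sqrtr_sqr [X in _ <= X]ger0_norm; last by lra.
by rewrite ler_norml; apply/andP; split; lra.
Qed.

End PairArithmetic.

Section Pair.
Context {R : realType} {T : Type} {n : nat}.
Variables (adj : 'I_n -> T -> T -> Prop) (bm : (T -> R) -> Prop)
  (E : (T -> R) -> R) (K : 'I_n -> (T -> R) -> T -> R) (a : 'I_n -> 'I_n -> R).
Hypothesis G : gibbs adj bm E K a.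
Hypothesis a_ge0 : forall i j, 0 <= a i j.
Hypothesis a_le1 : forall i j, a i j <= 1.

(** A Lipschitz bound for [log h] along every coordinate, in a form linear in [h], to which
    averaging operators apply directly. *)
Definition lip (adj : 'I_n -> T -> T -> Prop) s (h : T -> R) :=
  forall i x y, adj i x y -> h x <= (1 + s) * h y.

Variables (s : R) (h : T -> R).
Hypotheses (s0 : 0 <= s) (bh : bm h) (hpos : pos h) (lh : lip adj s h).

(** The factor [1 + s] is the direct dependence of [h] on coordinate [i]. The other one is the
    change of the conditional law at [j]: along the [j]-fibre [h] has range at most [s * m], where
    [m <= K j h]. *)
Lemma K_lip i j x y : i != j -> adj i x y ->
  K j h x <= (1 + s) * (1 + a j i * s) * K j h y.
Proof.
have s0' := s0; move=> ij xy; pose S := [set h z | z in [set z | adj j y z]]%classic.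
have Sy : S (h y) by exists y => //; exact: (adj_refl G).
have hS : has_inf S.
  split; first by exists (h y).
  by case: hpos => m m0 mh; exists m => _ [z _ <-].
set m := inf S.
have mh z : adj j y z -> m <= h z <= (1 + s) * m.
  move=> yz; apply/andP; split; first by apply: ge_inf; [exact: hS.2|exists z].
  have s1 : 0 < 1 + s by lra.
  rewrite mulrC -ler_pdivrMr//; apply: lb_le_inf; first by exists (h y).
  move=> _ [w yw <-]; rewrite ler_pdivrMr// mulrC; apply: (lh (i := j)).
  exact: (adj_trans G) (adj_sym G yz) yw.
have mK : m <= K j h y by apply: (K_ge G) => // z /mh /andP[].
have := K_dobrushin G (j := j) (k := i) (x := x) (y := y)
  (F := h) (F' := fun x => (1 + s) * h x) (m := (1 + s) * m) (M := (1 + s) * ((1 + s) * m)).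
rewrite eq_sym => /(_ ij xy bh).
have -> : K j (fun x => (1 + s) * h x) y = (1 + s) * K j h y by rewrite (KZ G).
have bh' : bm (fun x => (1 + s) * h x) by bmt.
move=> /(_ bh') => H; apply: le_trans (H _ _) _.
- by move=> x' y' _ _; exact: lh.
- by move=> y' /mh /andP[? ?]; apply/andP; split; rewrite ler_wpM2l//; lra.
- have := ler_wpM2l (mulr_ge0 (a_ge0 j i) s0) mK.
  have : 0 <= 1 + s by lra.
  nra.
Qed.

Lemma lip_K_le j x : K j h x <= (1 + s) * h x.
Proof. by apply: (K_le G) => // y xy; apply: lh; exact: (adj_sym G) xy. Qed.

Lemma le_lip_K j x : h x <= (1 + s) * K j h x.
Proof. by rewrite -(KZ G)//; apply: (K_ge G); [bmt|move=> y xy; exact: lh xy]. Qed.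

Section TwoSites.
Variables (i j : 'I_n).
Hypothesis ij : i != j.
Let H := K j h.
Let q := (1 + s) * (1 + a j i * s).
Let bH : bm H. Proof. by rewrite /H; bmt. Qed.
Let pH : pos H. Proof. exact: (posK G). Qed.
Let jH : ind adj j H. Proof. exact: (indK G). Qed.
Let q1 : 1 <= q.
Proof. have s0' := s0; have := mulr_ge0 (a_ge0 j i) s0; rewrite /q; nra. Qed.
Let qH x y : adj i x y -> H x <= q * H y. Proof. exact: K_lip. Qed.

Let c := cm K i H.
Let b := K j c.
Let bc : bm c := bm_cm G i bH pH.
Let pc : pos c := pos_cm G i bH pH.
Let bb : bm b. Proof. by rewrite /b; bmt. Qed.
Let jb : ind adj j b. Proof. exact: (indK G). Qed.
Let S := E (fun x => (H x)^-1 * (c x - b x) ^+ 2).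

Let S_le : S <= q * a i j * a j i * J E K i H.
Proof.
rewrite (J_ph2 G)//.
have -> : E (fun x => H x * ph K i H x ^+ 2) = E (fun x => (H x)^-1 * (H x - c x) ^+ 2).
  congr E; apply/funext => x; rewrite /ph -/c; have := pos_neq0 x pH => ?.
  by field.
exact: (alternating_contraction G).
Qed.

Let p := ph K i H.
Let bp : bm p := bm_ph G i bH pH.
Let bVH : bm (fun x => (H x)^-1). Proof. exact: (bm_inv G). Qed.

Let E_jind g : bm g -> ind adj j g -> E (fun x => (h x - H x) * g x) = 0.
Proof.
move=> bg jg.
have -> : (fun x => (h x - H x) * g x) = (fun x => g x * h x - g x * H x).
  by apply/funext => x; ring.
by rewrite (EB G); [|by bmt..]; rewrite (E_indK G)// subrr.
Qed.

(** The left side is the square of [E ((h - H) * p)]. Split [p = g + chi]: [g] ignores coordinate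
    [j] and contributes nothing, while [chi = (b - c) / H] has [K j chi = 0], so the energy of [h]
    at [j] controls it. *)
Let first_error : (E (fun x => h x * p x) - J E K i H) ^+ 2 <= J E K j h * ((1 + s) * S).
Proof.
have s0' := s0; pose g x := 1 - b x * (H x)^-1.
have bg : bm g by rewrite /g; bmt.
have jg : ind adj j g by move=> x y xy; rewrite /g (jb xy) (jH xy).
pose chi x := (b x - c x) * (H x)^-1.
have bchi : bm chi by rewrite /chi; bmt.
have Kchi x : K j chi x = 0.
  have -> : chi = (fun x => (H x)^-1 * (b x - c x)).
    by apply/funext => y; rewrite mulrC.
  rewrite (KM G)//; [|by bmt..|exact: indV].
  by rewrite (KB G)// (K_id G)// subrr mulr0.
have -> : E (fun x => h x * p x) - J E K i H = E (fun x => h x * chi x).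
  rewrite (J_ph G)// -(EB G); [|by bmt..].
  transitivity (E (fun x => (h x - H x) * g x + (h x * chi x - (b x - c x)))).
    congr E; apply/funext => x; rewrite /g /chi /p /ph -/c.
    by have := pos_neq0 x pH => ?; field.
  rewrite (ED G); [|by bmt..]; rewrite E_jind// add0r (EB G); [|by bmt..].
  by rewrite [X in _ - X](EB G)// (EK G)// subrr subr0.
apply: le_trans (J_cauchy G bh hpos bchi Kchi) _.
rewrite ler_wpM2l ?(J_ge0 G)// /S -(EZ G); last by bmt.
apply: (E_le G); [by bmt..|move=> x].
have -> : (1 + s) * ((H x)^-1 * (c x - b x) ^+ 2) = (1 + s) * H x * chi x ^+ 2.
  by rewrite /chi; have := pos_neq0 x pH => ?; field.
by rewrite ler_wpM2r ?sqr_ge0// le_lip_K.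
Qed.

Let cH x : (q^-1 <= c x * (H x)^-1 <= q) && (q^-1 <= b x * (H x)^-1 <= q).
Proof.
have q0 : 0 < q by exact: lt_le_trans ltr01 q1.
have cb y : H y <= q * c y /\ c y <= q * H y.
  have Hy := pos_gt0 y pH; have cy := pos_gt0 y pc.
  have [B1 B2] : (H y)^-1 <= q * (c y)^-1 /\ (c y)^-1 <= q * (H y)^-1.
    rewrite -K_inv; split.
      rewrite -(KZ G)//; apply: (K_ge G); first by bmt.
      move=> z yz; have Hz := pos_gt0 z pH.
      by rewrite ler_pdivlMr// mulrC ler_pdivrMr//; apply: qH; exact: (adj_sym G).
    apply: (K_le G) => // z yz; have Hz := pos_gt0 z pH.
    by rewrite ler_pdivlMr// mulrC ler_pdivrMr//; exact: qH.
  move: B1 B2; rewrite ler_pdivlMr// mulrC ler_pdivrMr// => B1.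
  by rewrite ler_pdivlMr// mulrC ler_pdivrMr// => B2.
have bb' y : H y <= q * b y /\ b y <= q * H y.
  split.
    rewrite /b -(KZ G)//; apply: (K_ge G); first by bmt.
    by move=> z yz; rewrite (jH yz); case: (cb z).
  by apply: (K_le G) => // z yz; rewrite (jH yz); case: (cb z).
have Hx := pos_gt0 x pH; have [? ?] := cb x; have [? ?] := bb' x.
by rewrite !ler_pdivlMr// !ler_pdivrMr// ![q^-1 * _]mulrC !ler_pdivrMr//
  ![_ * q]mulrC; apply/andP; split; apply/andP.
Qed.

(** The same splitting for [p^2]. The part [psi] that depends on [j] is [(b - c) / H] times
    [2 - (c / H + b / H)], and this second factor is only of order [q - 1]. *)
Let second_error : (E (fun x => h x * p x ^+ 2) - J E K i H) ^+ 2 <=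
  J E K j h * ((2 * (q - 1)) ^+ 2 * ((1 + s) * S)).
Proof.
have s0' := s0; pose g x := (1 - b x * (H x)^-1) ^+ 2.
have bg : bm g by rewrite /g; bmt.
have jg : ind adj j g by move=> x y xy; rewrite /g (jb xy) (jH xy).
pose psi x := p x ^+ 2 - g x.
have bpsi : bm psi by rewrite /psi; bmt.
have bK := bmK G j bpsi.
have jK : ind adj j (K j psi) := indK G bpsi.
pose chi x := psi x - K j psi x.
have bchi : bm chi by rewrite /chi; bmt.
have Kchi x : K j chi x = 0 by rewrite (KB G)// (K_id G (F := K j psi))// subrr.
have -> : E (fun x => h x * p x ^+ 2) - J E K i H = E (fun x => h x * chi x).
  rewrite (J_ph2 G)// -(EB G); [|by bmt..].
  transitivity (E (fun x => (h x - H x) * g x + ((h x - H x) * K j psi x +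
      (h x * chi x - H x * chi x)))).
    by congr E; apply/funext => x; rewrite /chi /psi -/p; ring.
  rewrite (ED G); [|by bmt..]; rewrite E_jind// add0r (ED G); [|by bmt..].
  rewrite E_jind// add0r (EB G); [|by bmt..].
  by rewrite [X in _ - X](E_ind0 G (i := j))// subr0.
apply: le_trans (J_cauchy G bh hpos bchi Kchi) _.
rewrite ler_wpM2l ?(J_ge0 G)//.
apply: (@le_trans _ _ ((1 + s) * E (fun x => H x * psi x ^+ 2))); last first.
  rewrite mulrCA ler_wpM2l//; first by lra.
  rewrite /S -(EZ G); last by bmt.
  apply: (E_le G); [by bmt..|move=> x].
  have -> : psi x = ((b x - c x) * (H x)^-1) * (2 - (c x * (H x)^-1 + b x * (H x)^-1)).
    by rewrite /psi /g /p /ph -/c; ring.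
  have -> : (2 * (q - 1)) ^+ 2 * ((H x)^-1 * (c x - b x) ^+ 2) =
     H x * ((b x - c x) * (H x)^-1) ^+ 2 * (2 * (q - 1)) ^+ 2.
    by have := pos_neq0 x pH => ?; field.
  rewrite exprMn mulrA ler_wpM2l//.
    by rewrite mulr_ge0 ?sqr_ge0// ltW// pos_gt0.
  exact: (sqr_two_sub_le q1 (cH x)).
rewrite -(EZ G); last by bmt.
apply: (@le_trans _ _ (E (fun x => (1 + s) * (H x * chi x ^+ 2)))).
  apply: (E_le G); [by bmt..|move=> x].
  by rewrite mulrA ler_wpM2r ?sqr_ge0// le_lip_K.
rewrite !(EZ G); [|by bmt..]; rewrite ler_wpM2l//; first by lra.
have -> : (fun x => H x * psi x ^+ 2) = (fun x => H x * chi x ^+ 2 +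
    (2 * ((H x * K j psi x) * chi x) + H x * K j psi x ^+ 2)).
  by apply/funext => x; rewrite /chi; ring.
rewrite (ED G); [|by bmt..]; rewrite lerDl (ED G); [|by bmt..].
rewrite (EZ G); [|by bmt..]; rewrite (E_ind0 G (i := j))//; [|by bmt|]; last first.
  by move=> x y xy; rewrite (jH xy) (jK x y).
rewrite mulr0 add0r; apply: (E_ge0 G); first by bmt.
by move=> x; rewrite mulr_ge0 ?sqr_ge0// ltW// pos_gt0.
Qed.

(** The representer [p] of [K j h] at site [i] is an admissible test function for the energy of [h]
    there. Together with the two error bounds this is the situation of [sqrt_pair_bound]. *)
Lemma sqrt_J_K : Num.sqrt (J E K i H) <= Num.sqrt (J E K i h) +
  q * Num.sqrt ((1 + s) * (q * a i j * a j i)) * Num.sqrt (J E K j h).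
Proof.
have s0' := s0; have Jh := J_ge0 G i bh hpos; have JH := J_ge0 G i bH pH.
have Jj := J_ge0 G j bh hpos.
have Kp x : K i p x = 0 := K_ph G i bH pH x.
have cs := J_cauchy G bh hpos bp Kp.
set y := Num.sqrt (J E K i H); set A := Num.sqrt (J E K j h).
set r := Num.sqrt (_ * (q * _ * _)).
have yE : y ^+ 2 = J E K i H by rewrite sqr_sqrtr.
have rE : r ^+ 2 = (1 + s) * (q * a i j * a j i).
  rewrite sqr_sqrtr//; apply: mulr_ge0; first by lra.
  by do 2 (apply: mulr_ge0 => //); exact: le_trans ler01 q1.
have AE : A ^+ 2 = J E K j h by rewrite sqr_sqrtr.
have sS : (1 + s) * S <= (r * y) ^+ 2.
  rewrite exprMn rE yE -[X in _ <= X]mulrA; apply: ler_wpM2l; first by lra.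
  exact: S_le.
have rAy : 0 <= r * A * y by rewrite !mulr_ge0// sqrtr_ge0.
apply: (@sqrt_pair_bound _ _ _ _ _ _ (E (fun x => h x * p x) - J E K i H)
   (E (fun x => h x * p x ^+ 2) - J E K i H)); rewrite ?sqrtr_ge0//.
- by rewrite yE !subrKC sqr_sqrtr.
- rewrite -ler_sqr ?nnegrE// real_normK ?num_real//.
  apply: le_trans first_error _; rewrite -AE.
  have -> : r * A * y = A * (r * y) by ring.
  by rewrite exprMn ler_wpM2l ?sqr_ge0.
- have q1' := q1; have q10 : 0 <= 2 * (q - 1) by lra.
  have W : 0 <= 2 * (q - 1) * (r * A * y) by exact: mulr_ge0.
  rewrite -ler_sqr ?nnegrE// real_normK ?num_real//.
  apply: le_trans second_error _; rewrite -AE.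
  have -> : 2 * (q - 1) * (r * A * y) = A * (2 * (q - 1) * (r * y)) by ring.
  rewrite [X in _ <= X]exprMn; apply: ler_wpM2l; first exact: sqr_ge0.
  rewrite [X in _ <= X]exprMn.
  by apply: ler_wpM2l => //; exact: sqr_ge0.
Qed.

End TwoSites.
End Pair.

Section StepArithmetic.
Context {R : realType}.

Lemma le_of_sqr_le (t u : R) : 0 <= t -> 0 <= u -> t ^+ 2 <= u * t -> t <= u.
Proof.
move=> t0 u0 H; have [->//|tn0] := eqVneq t 0.
have tp : 0 < t by rewrite lt_neqAle eq_sym tn0.
by rewrite -(ler_pM2r tp) -expr2.
Qed.

(** The balance of one step: [2 - d] bounds a row sum plus a column sum, and [1 + (1 + s)^-1] is the
    relative decrease at the resampled site. Of the [9 * s], eight come from the fourth power and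
    one from the inverse; the condition on [s] makes the second-order terms nonpositive. *)
Lemma step_rate (d s : R) : 0 <= s -> d <= 1 -> s <= d / 5 ->
  (1 + s) ^+ 4 * (2 - d) - 1 - (1 + s)^-1 <= 9 * s - d.
Proof.
move=> s0 d1 sd.
have i1 : 1 - s <= (1 + s)^-1.
  have p : 0 < 1 + s by lra.
  by rewrite -(ler_pM2l p) mulfV ?gt_eqF//; nra.
have s4 : (1 + s) ^+ 4 <= 1 + 4 * s + 7 * s ^+ 2.
  have -> : (1 + s) ^+ 4 = 1 + 4 * s + s ^+ 2 * (6 + 4 * s + s ^+ 2) by ring.
  by have : 0 <= s ^+ 2 by [exact: sqr_ge0]; nra.
have : (1 + s) ^+ 4 * (2 - d) <= (1 + 4 * s + 7 * s ^+ 2) * (2 - d).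
  by apply: ler_wpM2r => //; lra.
have -> : (1 + 4 * s + 7 * s ^+ 2) * (2 - d) =
  2 - d + 8 * s + s * (14 * s - 4 * d) - 7 * (s ^+ 2 * d) by ring.
have : 0 <= s ^+ 2 * d by rewrite mulr_ge0 ?sqr_ge0//; lra.
have : 0 <= s * (4 * d - 14 * s) by rewrite mulr_ge0//; lra.
lra.
Qed.

(** Arithmetic behind [J_mix_other], with [u = a i j] and [t = a j i]. To first order
    [2 v <= 2 y w], where [y <= x + q p A], and [2 x w - w^2 <= x^2] removes [w] from the main
    term. *)
Lemma mix_arith (s e u t x y A w v B : R) :
  0 <= s <= 1 / 5 -> 0 <= e <= 1 -> 0 <= u <= 1 -> 0 <= t <= 1 ->
  0 <= x -> 0 <= y -> 0 <= A -> 0 <= w ->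
  y <= x + (1 + s) * (1 + t * s) *
    Num.sqrt ((1 + s) * ((1 + s) * (1 + t * s) * u * t)) * A ->
  v ^+ 2 <= y ^+ 2 * w ^+ 2 -> w ^+ 2 <= (1 + s) * x ^+ 2 ->
  B <= 2 * w ^+ 2 + 2 * y ^+ 2 ->
  (1 - e) * x ^+ 2 + e * (2 * v - w ^+ 2) + e ^+ 2 * (1 + s) * B <=
  x ^+ 2 + (e * ((1 + s) ^+ 4 * ((u + t) / 2)) + 32 * e ^+ 2) * (x ^+ 2 + A ^+ 2).
Proof.
move=> /andP[s0 s1] /andP[e0 e1] /andP[u0 u1] /andP[t0 t1] x0 y0 A0 w0.
set q := (1 + s) * (1 + t * s); set p := Num.sqrt _.
move=> yx vyw wx Bwy.
have ts : 0 <= t * s <= s by apply/andP; split; nra.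
have q0 : 1 <= q <= (1 + s) ^+ 2.
  by rewrite /q expr2; case/andP: ts => ? ?; apply/andP; split; nra.
have s1p : 0 < 1 + s by lra.
have r0 : 0 <= (1 + s) * (q * u * t).
  by case/andP: q0 => ? ?; rewrite !mulr_ge0//; lra.
have p0 : 0 <= p by exact: sqrtr_ge0.
have pE : p ^+ 2 = (1 + s) * (q * u * t) by rewrite sqr_sqrtr.
have qp0 : 0 <= q * p by case/andP: q0 => ? ?; rewrite mulr_ge0//; lra.
have q3 : q ^+ 3 <= (1 + s) ^+ 6.
  rewrite (_ : 6%N = (2 * 3)%N)// exprM; case/andP: q0 => ? ?.
  by rewrite lerXn2r// nnegrE; lra.
have ut : u * t <= ((u + t) / 2) ^+ 2 by have := sqr_ge0 (u - t); lra.
have ut0 : 0 <= u * t by exact: mulr_ge0.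
have cE : (q * p) ^+ 2 = (1 + s) * (q ^+ 3 * (u * t)).
  by rewrite exprMn pE; ring.
have vl : v <= y * w.
  apply: le_trans (ler_norm v) _.
  by rewrite -ler_sqr ?nnegrE ?mulr_ge0// real_normK ?num_real// exprMn.
(* The square of the left side has at most [(1 + s)^7] from [q^2 p^2] and [1 + s] from [w^2]; the
   root of the product is [(1 + s)^4]. The root of [u * t] is bounded by the arithmetic mean. *)
have cross : q * p * w <= (1 + s) ^+ 4 * ((u + t) / 2) * x.
  have L0 : 0 <= q * p * w by exact: mulr_ge0.
  have R0 : 0 <= (1 + s) ^+ 4 * ((u + t) / 2) * x.
    rewrite mulr_ge0// mulr_ge0//; first by rewrite exprn_ge0// ltW.
    by lra.
  rewrite -ler_sqr ?nnegrE// exprMn cE.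
  apply: (@le_trans _ _ ((1 + s) * ((1 + s) ^+ 6 * (u * t)) * ((1 + s) * x ^+ 2))).
    apply: ler_pM => //; [|exact: sqr_ge0|].
      by apply: mulr_ge0; [lra|apply: mulr_ge0 => //; rewrite exprn_ge0//; lra].
    by apply: ler_wpM2l; [lra | exact: ler_wpM2r].
  have -> : (1 + s) * ((1 + s) ^+ 6 * (u * t)) * ((1 + s) * x ^+ 2) =
     ((1 + s) ^+ 8 * x ^+ 2) * (u * t) by ring.
  have -> : ((1 + s) ^+ 4 * ((u + t) / 2) * x) ^+ 2 =
     ((1 + s) ^+ 8 * x ^+ 2) * ((u + t) / 2) ^+ 2 by ring.
  by rewrite ler_wpM2l// mulr_ge0 ?sqr_ge0 ?exprn_ge0// ltW.
have c4 : (q * p) ^+ 2 <= 4.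
  rewrite cE; apply: (@le_trans _ _ ((1 + s) * ((1 + s) ^+ 6 * 1))).
    apply: ler_wpM2l; first by lra.
    by apply: ler_pM => //; [rewrite exprn_ge0//; lra | nra].
  rewrite mulr1 -exprS.
  apply: (@le_trans _ _ ((6 / 5) ^+ 7)); last by lra.
  by rewrite lerXn2r ?nnegrE//; lra.
have y2 : y ^+ 2 <= 2 * x ^+ 2 + 8 * A ^+ 2.
  have : y ^+ 2 <= (x + q * p * A) ^+ 2.
    by rewrite lerXn2r// nnegrE addr_ge0// mulr_ge0.
  have : (q * p) ^+ 2 * A ^+ 2 <= 4 * A ^+ 2 by rewrite ler_wpM2r ?sqr_ge0.
  have := sqr_ge0 (x - q * p * A); rewrite -exprMn; nra.
set C := (1 + s) ^+ 4 * ((u + t) / 2).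
have C0 : 0 <= C by rewrite /C mulr_ge0 ?exprn_ge0//; lra.
have main : 2 * v - w ^+ 2 <= x ^+ 2 + C * (x ^+ 2 + A ^+ 2).
  have h1 : y * w <= (x + q * p * A) * w by exact: ler_wpM2r.
  have h2 : q * p * w * A <= C * x * A by exact: ler_wpM2r.
  have h3 : C * (2 * x * A) <= C * (x ^+ 2 + A ^+ 2).
    by rewrite ler_wpM2l//; have := sqr_ge0 (x - A); lra.
  have := sqr_ge0 (x - w); lra.
have rem : e ^+ 2 * ((1 + s) * B) <= e ^+ 2 * (32 * (x ^+ 2 + A ^+ 2)).
  rewrite ler_wpM2l ?sqr_ge0//.
  have x2 : 0 <= x ^+ 2 by exact: sqr_ge0.
  have A2 : 0 <= A ^+ 2 by exact: sqr_ge0.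
  have w2 : w ^+ 2 <= 6 / 5 * x ^+ 2.
    by apply: le_trans wx _; rewrite ler_wpM2r//; lra.
  apply: (@le_trans _ _ ((1 + s) * (2 * w ^+ 2 + 2 * y ^+ 2))).
    by rewrite ler_wpM2l//; lra.
  have z0 : 0 <= 2 * w ^+ 2 + 2 * y ^+ 2 by rewrite addr_ge0// mulr_ge0 ?sqr_ge0.
  apply: (@le_trans _ _ (6 / 5 * (2 * w ^+ 2 + 2 * y ^+ 2))).
    by rewrite ler_wpM2r//; lra.
  lra.
have := ler_wpM2l e0 main.
lra.
Qed.

End StepArithmetic.

Section Mix.
Context {R : realType} {T : Type} {n : nat}.
Variables (adj : 'I_n -> T -> T -> Prop) (bm : (T -> R) -> Prop)
  (E : (T -> R) -> R) (K : 'I_n -> (T -> R) -> T -> R) (a : 'I_n -> 'I_n -> R).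
Hypothesis G : gibbs adj bm E K a.

Definition mix (e : R) (h H : T -> R) x := (1 - e) * h x + e * H x.

Lemma bm_mix e h H : bm h -> bm H -> bm (mix e h H).
Proof. by move=> bh bH; rewrite /mix; bmt. Qed.

Lemma pos_mix e h H : 0 <= e <= 1 -> pos h -> pos H -> pos (mix e h H).
Proof.
move=> /andP[e0 e1] [m m0 mh] [m' m0' mH]; exists (Num.min m m').
  by rewrite lt_min m0.
move=> x; have := mh x; have := mH x.
have : Num.min m m' <= m by rewrite ge_min lexx.
have : Num.min m m' <= m' by rewrite ge_min lexx orbT.
rewrite /mix; nra.
Qed.

Lemma E_mix e h H F : bm h -> bm H -> bm F ->
  E (fun x => mix e h H x * F x) =
  (1 - e) * E (fun x => h x * F x) + e * E (fun x => H x * F x).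
Proof.
move=> bh bH bF; rewrite -!(EZ G); [|by bmt..]; rewrite -(ED G); [|by bmt..].
by congr E; apply/funext => x; rewrite /mix; ring.
Qed.

Variables (i : 'I_n) (s e : R) (h H : T -> R).
Hypotheses (s0 : 0 <= s) (e01 : 0 <= e <= 1).
Hypotheses (bh : bm h) (ph0 : pos h) (bH : bm H) (pH : pos H).
Hypothesis Hh : forall x, H x <= (1 + s) * h x.

(** The representer [p] of the old [h] serves as test function in [J_variation]. The first two terms
    are exact; the defect [t] satisfies a quadratic inequality that bounds it by a multiple of
    [e^2]. *)
Lemma J_mix : J E K i (mix e h H) <= (1 - e) * J E K i h +
  e * (2 * E (fun x => H x * ph K i h x) - E (fun x => H x * ph K i h x ^+ 2)) +
  e ^+ 2 * (1 + s) * E (fun x => H x * (ph K i h x - ph K i H x) ^+ 2).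
Proof.
have s0' := s0; have /andP[e0 e1] := e01.
set u := mix e h H.
have bu : bm u := bm_mix e bh bH.
have pu : pos u := pos_mix e01 ph0 pH.
set p := ph K i h; set p' := ph K i H; set p2 := ph K i u.
have bp : bm p := bm_ph G i bh ph0.
have bp' : bm p' := bm_ph G i bH pH.
have bp2 : bm p2 := bm_ph G i bu pu.
have Kp x : K i p x = 0 := K_ph G i bh ph0 x.
have Kp2 x : K i p2 x = 0 := K_ph G i bu pu x.
rewrite (J_variation G bu pu bp Kp) -/p2 E_mix//; last by bmt.
have -> : E (fun x => h x * (2 * p x - p x ^+ 2)) = J E K i h.
  have -> : (fun x => h x * (2 * p x - p x ^+ 2)) =
     (fun x => 2 * (h x * p x) - h x * p x ^+ 2) by apply/funext => x; ring.
  rewrite (EB G); [|by bmt..]; rewrite (EZ G); [|by bmt..].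
  by rewrite -(J_ph G i bh ph0) -(J_ph2 G i bh ph0); ring.
have -> : E (fun x => H x * (2 * p x - p x ^+ 2)) =
    2 * E (fun x => H x * p x) - E (fun x => H x * p x ^+ 2).
  have -> : (fun x => H x * (2 * p x - p x ^+ 2)) =
     (fun x => 2 * (H x * p x) - H x * p x ^+ 2) by apply/funext => x; ring.
  by rewrite (EB G); [|by bmt..]; rewrite (EZ G); [|by bmt..].
rewrite lerD2l.
pose chi x := p x - p2 x.
have bchi : bm chi by rewrite /chi; bmt.
have Kchi x : K i chi x = 0 by rewrite (KB G)// Kp Kp2 subrr.
set t := E _; set B := E (fun x => H x * (p x - p' x) ^+ 2).
have t0 : 0 <= t.
  apply: (E_ge0 G); first by bmt.
  by move=> x; rewrite mulr_ge0 ?sqr_ge0// ltW// pos_gt0.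
have B0 : 0 <= B.
  apply: (E_ge0 G); first by bmt.
  by move=> x; rewrite mulr_ge0 ?sqr_ge0// ltW// pos_gt0.
(* Each representer reproduces [E (_ * chi)] for its own density. The contributions of [h] cancel,
   which leaves a factor [e]. *)
have tE : t = e * E (fun x => H x * (p x - p' x) * chi x).
  have -> : t = E (fun x => u x * (p x * chi x)) - E (fun x => u x * p2 x * chi x).
    by rewrite /t -(EB G); [|by bmt..]; congr E; apply/funext => x; rewrite /chi; ring.
  rewrite (E_ph G bu pu bchi Kchi) !E_mix//; [|by bmt..].
  have -> : E (fun x => h x * (p x * chi x)) = E (fun x => h x * chi x).
    rewrite -(E_ph G bh ph0 bchi Kchi); congr E; apply/funext => x.
    by rewrite -/p; ring.
  rewrite -(E_ph G bH pH bchi Kchi) -/p'.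
  have -> : E (fun x => H x * (p x - p' x) * chi x) =
     E (fun x => H x * (p x * chi x)) - E (fun x => H x * p' x * chi x).
    by rewrite -(EB G); [|by bmt..]; congr E; apply/funext => x; ring.
  ring.
have Hchi : E (fun x => H x * chi x ^+ 2) <= (1 + s) * t.
  rewrite /t -(EZ G); last by bmt.
  apply: (E_le G); [by bmt..|move=> x].
  rewrite mulrA ler_wpM2r ?sqr_ge0//.
  have Hx := pos_gt0 x pH.
  have e1' : 0 <= 1 - e by lra.
  have := ler_wpM2l e1' (Hh x).
  have : 0 <= e * s * H x by rewrite !mulr_ge0// ltW.
  by rewrite /u /mix; lra.
apply: le_of_sqr_le => //.
  by rewrite !mulr_ge0 ?exprn_ge0//; lra.
rewrite {1}tE exprMn.
have -> : e ^+ 2 * (1 + s) * B * t = e ^+ 2 * (B * ((1 + s) * t)) by ring.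
rewrite ler_wpM2l ?sqr_ge0//.
apply: le_trans (E_cauchy G bH _ bchi _) _; [by bmt|by move=> x; exact/ltW/pos_gt0|].
exact: ler_wpM2l.
Qed.

End Mix.

Section Step.
Context {R : realType} {T : Type} {n : nat}.
Variables (adj : 'I_n -> T -> T -> Prop) (bm : (T -> R) -> Prop)
  (E : (T -> R) -> R) (K : 'I_n -> (T -> R) -> T -> R) (a : 'I_n -> 'I_n -> R).
Hypothesis G : gibbs adj bm E K a.
Hypothesis a_ge0 : forall i j, 0 <= a i j.
Hypothesis a_le1 : forall i j, a i j <= 1.
Hypothesis a_diag : forall i, a i i = 0.

Section OneStep.
Variables (s e : R) (h : T -> R).
Hypotheses (s01 : 0 <= s <= 1 / 5) (e01 : 0 <= e <= 1).
Hypotheses (bh : bm h) (hpos : pos h) (lh : lip adj s h).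

Let s0 : 0 <= s. Proof. by case/andP: s01. Qed.

(** [K i h] has no energy at [i] and pairs to zero with [p]. Beyond the loss [e] from the weight
    [1 - e], the term [- e * z] with [z >= (1 + s)^-1 * J] gives a second loss of nearly the same
    size. *)
Lemma J_mix_same i : J E K i (mix e h (K i h)) <=
  (1 - e - e * (1 + s)^-1 + 4 * e ^+ 2) * J E K i h.
Proof.
have s0' := s0; have /andP[_ s1] := s01; have /andP[e0 e1] := e01.
have bH : bm (K i h) by bmt.
have pH : pos (K i h) by exact: (posK G).
have JH := J_ge0 G i bh hpos.
have := J_mix G i s0 e01 bh hpos bH pH (lip_K_le G bh lh i).
have iH : ind adj i (K i h) := indK G bh.
set p := ph K i h; have bp : bm p := bm_ph G i bh hpos.
rewrite (_ : (fun x => K i h x * (p x - ph K i (K i h) x) ^+ 2) =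
  (fun x => K i h x * p x ^+ 2)); last first.
  by apply/funext => x; rewrite (J_ind G bH pH iH) subr0.
rewrite (E_ind0 G (i := i) (g := K i h) bH bp iH (K_ph G i bh hpos)) mulr0 sub0r.
set x2 := J E K i h; set z := E _ => H.
have zl : (1 + s)^-1 * x2 <= z.
  rewrite /x2 (J_ph2 G i bh hpos) -(EZ G); last by bmt.
  apply: (E_le G); [by bmt..|move=> x]; rewrite mulrA ler_wpM2r ?sqr_ge0//.
  have s1' : 0 < 1 + s by lra.
  by rewrite mulrC ler_pdivrMr// mulrC; exact: (le_lip_K G bh lh).
have zu : z <= (1 + s) * x2.
  rewrite /x2 (J_ph2 G i bh hpos) -(EZ G); last by bmt.
  apply: (E_le G); [by bmt..|move=> x]; rewrite mulrA ler_wpM2r ?sqr_ge0//.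
  exact: (lip_K_le G bh lh).
have e2 : 0 <= e ^+ 2 by exact: sqr_ge0.
have : e ^+ 2 * (1 + s) * z <= e ^+ 2 * (4 * x2).
  rewrite -mulrA ler_wpM2l//; apply: (@le_trans _ _ ((1 + s) * ((1 + s) * x2))).
    by rewrite ler_wpM2l//; lra.
  by rewrite mulrA ler_wpM2r//; nra.
have : e * ((1 + s)^-1 * x2) <= e * z by exact: ler_wpM2l.
move: H; rewrite -/x2; nra.
Qed.

Lemma J_mix_other i j : i != j -> J E K i (mix e h (K j h)) <=
  J E K i h + (e * ((1 + s) ^+ 4 * ((a i j + a j i) / 2)) + 32 * e ^+ 2) *
              (J E K i h + J E K j h).
Proof.
move=> ij; have s0' := s0; have /andP[_ s1] := s01; have /andP[e0 e1] := e01.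
have bH : bm (K j h) by bmt.
have pH : pos (K j h) by exact: (posK G).
have Jh := J_ge0 G i bh hpos; have JH := J_ge0 G i bH pH.
have Jj := J_ge0 G j bh hpos.
have := J_mix G i s0 e01 bh hpos bH pH (lip_K_le G bh lh j).
have sJ := sqrt_J_K G a_ge0 s0 bh hpos lh ij.
set p := ph K i h; have bp : bm p := bm_ph G i bh hpos.
set p' := ph K i (K j h); have bp' : bm p' := bm_ph G i bH pH.
set v := E (fun x => K j h x * p x); set z := E (fun x => K j h x * p x ^+ 2).
set B := E (fun x => K j h x * (p x - p' x) ^+ 2).
have z0 : 0 <= z.
  apply: (E_ge0 G); first by bmt.
  by move=> x; rewrite mulr_ge0 ?sqr_ge0// ltW// pos_gt0.
have vz : v ^+ 2 <= J E K i (K j h) * z.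
  exact: (J_cauchy G bH pH bp (K_ph G i bh hpos)).
have zu : z <= (1 + s) * J E K i h.
  rewrite (J_ph2 G i bh hpos) -(EZ G); last by bmt.
  apply: (E_le G); [by bmt..|move=> x]; rewrite mulrA ler_wpM2r ?sqr_ge0//.
  exact: (lip_K_le G bh lh).
have Bu : B <= 2 * z + 2 * J E K i (K j h).
  rewrite (J_ph2 G i bH pH) -!(EZ G); [|by bmt..]; rewrite -(ED G); [|by bmt..].
  apply: (E_le G); [by bmt..|move=> x]; rewrite -/p'.
  have -> : 2 * (K j h x * p x ^+ 2) + 2 * (K j h x * p' x ^+ 2) =
     K j h x * (p x - p' x) ^+ 2 + K j h x * (p x + p' x) ^+ 2 by ring.
  by rewrite lerDl mulr_ge0 ?sqr_ge0// ltW// pos_gt0.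
have xE : Num.sqrt (J E K i h) ^+ 2 = J E K i h by rewrite sqr_sqrtr.
have yE : Num.sqrt (J E K i (K j h)) ^+ 2 = J E K i (K j h) by rewrite sqr_sqrtr.
have AE : Num.sqrt (J E K j h) ^+ 2 = J E K j h by rewrite sqr_sqrtr.
have wE : Num.sqrt z ^+ 2 = z by rewrite sqr_sqrtr.
have := @mix_arith _ s e (a i j) (a j i) (Num.sqrt (J E K i h))
  (Num.sqrt (J E K i (K j h))) (Num.sqrt (J E K j h)) (Num.sqrt z) v B.
rewrite xE yE AE wE !sqrtr_ge0 !a_ge0 !a_le1 => M H; apply: le_trans H _.
exact: M.
Qed.

End OneStep.
End Step.

(** * The lazy Gibbs sampler *)

Lemma double_sum (R : realType) n (x : 'I_n -> R) (w : 'I_n -> 'I_n -> R) (b : R) :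
  (forall i j, w i j = w j i) ->
  \sum_i \sum_j (x i - (i == j)%:R * (b * x i) + w i j * (x i + x j)) =
  n%:R * \sum_i x i - b * \sum_i x i + \sum_i \sum_j (2 * w i j) * x i.
Proof.
move=> wC.
have sw : \sum_i \sum_j w i j * x j = \sum_i \sum_j w i j * x i.
  by rewrite exchange_big; apply: eq_bigr => i _; apply: eq_bigr => j _; rewrite wC.
transitivity (\sum_i \sum_(j < n) x i - \sum_i \sum_j (i == j)%:R * (b * x i) +
    (\sum_i \sum_j w i j * x i + \sum_i \sum_j w i j * x j)).
  under eq_bigr => i _.
    under eq_bigr => j _ do rewrite mulrDr.
    rewrite !big_split/= sumrN; over.
  by rewrite !big_split/= sumrN.
rewrite sw; congr (_ - _ + _).
- rewrite mulr_sumr; apply: eq_bigr => i _.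
  by rewrite sumr_const card_ord mulr_natl.
- rewrite mulr_sumr; apply: eq_bigr => i _; rewrite (bigD1 i)//= eqxx mul1r.
  by rewrite big1 ?addr0// => j; rewrite eq_sym => /negPf ->; rewrite mul0r.
- rewrite -big_split/=; apply: eq_bigr => i _; rewrite -big_split/=.
  by apply: eq_bigr => j _; ring.
Qed.

Section Dynamics.
Context {R : realType} {T : Type} {n : nat}.
Variables (adj : 'I_n -> T -> T -> Prop) (bm : (T -> R) -> Prop)
  (E : (T -> R) -> R) (K : 'I_n -> (T -> R) -> T -> R) (a : 'I_n -> 'I_n -> R).
Hypothesis G : gibbs adj bm E K a.
Variable d : R.
Hypothesis a_ge0 : forall i j, 0 <= a i j.
Hypothesis a_diag : forall i, a i i = 0.
Hypothesis d01 : 0 < d <= 1.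
Hypothesis a_row : forall i, \sum_j a i j <= 1.
Hypothesis a_col : forall j, \sum_i a i j <= 1 - d.
Hypothesis n_gt0 : (0 < n)%N.

Let nR : 0 < n%:R :> R. Proof. by rewrite ltr0n. Qed.

Lemma a_le1 i j : a i j <= 1.
Proof.
apply: le_trans (a_row i); rewrite (bigD1 j)//= lerDl.
by apply: sumr_ge0 => k _; exact: a_ge0.
Qed.

Lemma bm_sum (I : Type) (r : seq I) (F : I -> T -> R) :
  (forall k, bm (F k)) -> bm (fun x => \sum_(k <- r) F k x).
Proof.
move=> bF; elim: r => [|k r IH].
  by have := bm_cst G 0; congr bm; apply/funext => x; rewrite big_nil.
have := bmD G (bF k) IH; congr bm; apply/funext => x; by rewrite big_cons.
Qed.

Lemma E_sum (I : Type) (r : seq I) (F : I -> T -> R) :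
  (forall k, bm (F k)) -> E (fun x => \sum_(k <- r) F k x) = \sum_(k <- r) E (F k).
Proof.
move=> bF; elim: r => [|k r IH].
  by rewrite big_nil -[RHS](E_cst G 0); congr E; apply/funext => x; rewrite big_nil.
rewrite big_cons -IH -(ED G)//; last exact: bm_sum.
by congr E; apply/funext => x; rewrite big_cons.
Qed.

Definition lazy e (h : T -> R) x := (1 - e) * h x + e / n%:R * \sum_j K j h x.

Definition Jtot (h : T -> R) := \sum_i J E K i h.

Lemma lazy_mix e h x : lazy e h x = n%:R^-1 * \sum_j mix e h (K j h) x.
Proof.
rewrite /lazy /mix big_split/= -!mulr_sumr sumr_const card_ord -[h x *+ n]mulr_natr.
by field; rewrite gt_eqF.
Qed.

Section OneStep.
Variables (s e : R) (h : T -> R).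
Hypotheses (s0 : 0 <= s) (sd : s <= d / 5) (e01 : 0 <= e <= 1).
Hypotheses (bh : bm h) (hpos : pos h) (lh : lip adj s h).

Lemma bm_lazy : bm (lazy e h).
Proof. by rewrite /lazy; bmt; apply: bm_sum => k; bmt. Qed.

(** Each [K i] is symmetric for [E], so the increment of the dynamics can be moved from [h] to the
    test function. *)
Lemma E_lazy F : bm F -> E (fun x => F x * lazy e h x) =
  E (fun x => F x * h x) - e / n%:R * \sum_i E (fun x => h x * (F x - K i F x)).
Proof.
move=> bF; have bs := bm_lazy.
have -> : (fun x => F x * lazy e h x) = (fun x => F x * h x -
    e / n%:R * \sum_i (F x * h x - F x * K i h x)).
  apply/funext => x; rewrite /lazy sumrB -!mulr_sumr sumr_const card_ord -[h x *+ n]mulr_natr.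
  by field; rewrite gt_eqF.
have bS : bm (fun x => \sum_i (F x * h x - F x * K i h x)).
  by apply: bm_sum => k; bmt.
rewrite (EB G); [|by bmt..]; rewrite (EZ G)//; congr (_ - _ * _).
rewrite E_sum; last by move=> k; bmt.
apply: eq_bigr => i _; rewrite (EB G); [|by bmt..].
have -> : (fun x => h x * (F x - K i F x)) = (fun x => h x * F x - K i F x * h x).
  by apply/funext => x; ring.
rewrite (EB G); [|by bmt..]; congr (_ - _); first by congr E; apply/funext => x; rewrite mulrC.
have -> : (fun x => F x * K i h x) = (fun x => K i h x * F x) by apply/funext => x; ring.
rewrite -(E_indK G (i := i) (g := K i h)); [|by bmt..|exact: (indK G)].
rewrite -(E_indK G (i := i) (g := K i F)); [|by bmt..|exact: (indK G)].
by congr E; apply/funext => x; rewrite mulrC.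
Qed.

Lemma lazy_bounds m M : (forall x, m <= h x <= M) -> forall x, m <= lazy e h x <= M.
Proof.
move=> hmM x; have /andP[e0 e1] := e01.
have key j : m <= mix e h (K j h) x <= M.
  have /andP[? ?] := hmM x; rewrite /mix.
  have : m <= K j h x by apply: (K_ge G) => // y _; case/andP: (hmM y).
  have : K j h x <= M by apply: (K_le G) => // y _; case/andP: (hmM y).
  by move=> ? ?; apply/andP; split; nra.
rewrite lazy_mix; apply/andP; split; rewrite -(ler_pM2l nR) mulrA mulfV ?gt_eqF// mul1r.
- rewrite mulr_natl -[X in _ *+ X]card_ord -sumr_const; apply: ler_sum => j _.
  by case/andP: (key j).
- rewrite mulr_natl -[X in _ *+ X]card_ord -sumr_const; apply: ler_sum => j _.
  by case/andP: (key j).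
Qed.

Lemma pos_lazy : pos (lazy e h).
Proof.
have [M hM] := bm_bounded G bh; case: hpos => m m0 mh; exists m => // x.
have := @lazy_bounds m M _ x; case/(_ _)/andP => // y; rewrite mh/=.
exact: le_trans (ler_norm _) (hM y).
Qed.

(** By convexity the energy of the averaged step is at most the average over [j] of the energies of
    the single mixtures. After symmetrizing in [i] and [j], the coefficient of [J E K i h] contains
    a row sum plus a column sum, at most [2 - d]. *)
Lemma Jtot_lazy : Jtot (lazy e h) <=
  (1 - e / n%:R * (d - 9 * s) + 64 * e ^+ 2) * Jtot h.
Proof.
have s0' := s0; have sd' := sd; have /andP[d0 d1] := d01; have /andP[e0 e1] := e01.
have nR' := nR.
have s01 : 0 <= s <= 1 / 5 by rewrite s0 /=; lra.
have Jh i : 0 <= J E K i h := J_ge0 G i bh hpos.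
pose u j := mix e h (K j h).
have bu j : bm (u j) by apply: (bm_mix G) => //; bmt.
have pu j : pos (u j) by apply: pos_mix => //; exact: (posK G).
have bQ := bm_lazy; have pQ := pos_lazy.
have Javg i : n%:R * J E K i (lazy e h) <= \sum_j J E K i (u j).
  set p := ph K i (lazy e h); have bp : bm p := bm_ph G i bQ pQ.
  have Kp x : K i p x = 0 := K_ph G i bQ pQ x.
  have -> : J E K i (lazy e h) = E (fun x => lazy e h x * (2 * p x - p x ^+ 2)).
    have -> : (fun x => lazy e h x * (2 * p x - p x ^+ 2)) =
       (fun x => 2 * (lazy e h x * p x) - lazy e h x * p x ^+ 2).
      by apply/funext => x; ring.
    rewrite (EB G); [|by bmt..]; rewrite (EZ G); [|by bmt..].
    by rewrite -(J_ph G i bQ pQ) -(J_ph2 G i bQ pQ); ring.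
  rewrite -(EZ G); last by bmt.
  have -> : (fun x => n%:R * (lazy e h x * (2 * p x - p x ^+ 2))) =
     (fun x => \sum_j u j x * (2 * p x - p x ^+ 2)).
    by apply/funext => x; rewrite lazy_mix mulrA mulrA mulfV ?gt_eqF// mul1r -mulr_suml.
  rewrite E_sum; last by move=> k; bmt.
  apply: ler_sum => j _; rewrite (J_variation G (bu j) (pu j) bp Kp) lerDl.
  apply: (E_ge0 G); first by have := bm_ph G i (bu j) (pu j) => ?; bmt.
  by move=> x; rewrite mulr_ge0 ?sqr_ge0// ltW// pos_gt0.
pose c := (1 + s) ^+ 4.
have step i j : J E K i (u j) <= J E K i h - (i == j)%:R * ((e + e * (1 + s)^-1) * J E K i h) +
   (e * (c * ((a i j + a j i) / 2)) + 32 * e ^+ 2) * (J E K i h + J E K j h).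
  have [<-|ij] := eqVneq i j.
    apply: le_trans (J_mix_same G s01 e01 bh hpos lh i) _.
    rewrite a_diag mul1r; have := Jh i; have : 0 <= e ^+ 2 by exact: sqr_ge0.
    by move=> ? ?; have : 0 <= e ^+ 2 * J E K i h by [exact: mulr_ge0]; lra.
  by rewrite mul0r subr0; exact: (J_mix_other G a_ge0 a_le1 s01 e01 bh hpos lh ij).
rewrite -(ler_pM2l nR) /Jtot mulr_sumr.
apply: (@le_trans _ _ (\sum_i \sum_j (J E K i h -
   (i == j)%:R * ((e + e * (1 + s)^-1) * J E K i h) +
   (e * (c * ((a i j + a j i) / 2)) + 32 * e ^+ 2) * (J E K i h + J E K j h)))).
  by apply: ler_sum => i _; apply: le_trans (Javg i) _; apply: ler_sum => j _.
set I := \sum_i J E K i h.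
have I0 : 0 <= I by apply: sumr_ge0.
have -> : \sum_i \sum_j (J E K i h -
   (i == j)%:R * ((e + e * (1 + s)^-1) * J E K i h) +
   (e * (c * ((a i j + a j i) / 2)) + 32 * e ^+ 2) * (J E K i h + J E K j h)) =
  n%:R * I - (e + e * (1 + s)^-1) * I +
   \sum_i \sum_j (e * (c * (a i j + a j i) ) + 64 * e ^+ 2) * J E K i h.
  rewrite (@double_sum _ _ (fun i => J E K i h)); last first.
    by move=> i j; rewrite [a j i + _]addrC.
  congr (_ + _); apply: eq_bigr => i _; apply: eq_bigr => j _.
  by congr (_ * _); field.
have c0 : 0 <= c by rewrite exprn_ge0//; lra.
have : \sum_i \sum_j (e * (c * (a i j + a j i) ) + 64 * e ^+ 2) * J E K i h <=
   \sum_i (e * (c * (2 - d)) + n%:R * (64 * e ^+ 2)) * J E K i h.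
  apply: ler_sum => i _; rewrite -mulr_suml ler_wpM2r ?Jh//.
  rewrite big_split/= sumr_const card_ord -[X in _ + X]mulr_natl lerD2r -mulr_sumr ler_wpM2l//.
  rewrite -mulr_sumr ler_wpM2l// big_split/=.
  by have := a_row i; have := a_col i; lra.
rewrite -mulr_sumr -/I.
have := step_rate s0' d1 sd'; rewrite -/c => rate.
have := ler_wpM2r I0 (ler_wpM2l e0 rate).
set J2 := \sum_i \sum_j _ => H1 H2.
have -> : n%:R * ((1 - e / n%:R * (d - 9 * s) + 64 * e ^+ 2) * I) =
   n%:R * I - e * (d - 9 * s) * I + 64 * e ^+ 2 * n%:R * I.
  by field; rewrite gt_eqF.
lra.
Qed.

(** Resampling [i] removes the dependence on that coordinate. Resampling another [j] adds a relative
    [a j i * s], and these add up to at most [(1 - d) * s]; the net gain is of order [d * s], up to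
    second-order terms. *)
Lemma lip_lazy : lip adj (s * (1 - e / n%:R * (d - 3 * s))) (lazy e h).
Proof.
have s0' := s0; have sd' := sd; have /andP[d0 d1] := d01; have /andP[e0 e1] := e01.
have nR' := nR; have eN : 0 <= e / n%:R by rewrite divr_ge0// ltW.
move=> i x y xy.
have hy : 0 < h y := pos_gt0 y hpos.
have s1 : 0 < 1 + s by lra.
pose S := \sum_(j | j != i) K j h y.
have SE z : \sum_j K j h z = K i h z + \sum_(j | j != i) K j h z by rewrite (bigD1 i).
have Sx : \sum_(j | j != i) K j h x <= (1 + s) * S + (1 + s) * s * ((1 - d) * ((1 + s) * h y)).
  apply: (@le_trans _ _ (\sum_(j | j != i) ((1 + s) * K j h y + (1 + s) * s * (a j i * ((1 + s) * h y))))).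
    apply: ler_sum => j ji; have ij : i != j by rewrite eq_sym.
    apply: le_trans (K_lip G a_ge0 s0 bh hpos lh ij xy) _.
    have := lip_K_le G bh lh j y.
    have c0 : 0 <= (1 + s) * (a j i * s) by apply: mulr_ge0; [exact: ltW|exact: mulr_ge0].
    move=> /(ler_wpM2l c0); lra.
  rewrite big_split/= -mulr_sumr lerD2l -mulr_sumr ler_wpM2l//.
    by rewrite mulr_ge0// ltW.
  rewrite -mulr_suml ler_wpM2r//; first by rewrite mulr_ge0// ltW.
  apply: le_trans (a_col i); rewrite [X in _ <= X](bigD1 i)//= lerDr; exact: a_ge0.
have Ki : K i h x = K i h y by apply: (K_ind G).
have Kl := le_lip_K G bh lh i y.
have Qu : lazy e h y <= (1 + s) * h y.
  rewrite lazy_mix -(ler_pM2l nR) mulrA mulfV ?gt_eqF// mul1r mulr_natl.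
  rewrite -[X in _ *+ X]card_ord -sumr_const; apply: ler_sum => j _.
  have := ler_wpM2l e0 (lip_K_le G bh lh j y).
  have : 0 <= (1 - e) * (s * h y) by apply: mulr_ge0; [lra|exact: mulr_ge0 (ltW _)].
  by rewrite /mix; lra.
rewrite /lazy !SE Ki -/S; set Q := lazy e h y in Qu.
have QE : Q = (1 - e) * h y + e / n%:R * (K i h y + S) by rewrite /Q /lazy SE.
rewrite -QE; have hxy := lh xy.
apply: (@le_trans _ _ ((1 + s) * Q - e / n%:R * s * ((d - 3 * s) * ((1 + s) * h y)))); last first.
  have : 0 <= e / n%:R * s * (d - 3 * s) by rewrite !mulr_ge0//; lra.
  by move=> /ler_wpM2l /(_ _ _ Qu); lra.
have A1 : (1 - e) * h x <= (1 - e) * ((1 + s) * h y) by rewrite ler_wpM2l//; lra.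
have A2 : e / n%:R * (K i h y + \sum_(j | j != i) K j h x) <= e / n%:R *
  (K i h y + ((1 + s) * S + (1 + s) * s * ((1 - d) * ((1 + s) * h y)))).
  by rewrite ler_wpM2l// lerD2l.
apply: le_trans (lerD A1 A2) _; rewrite QE.
rewrite -subr_ge0.
have -> : (1 + s) * ((1 - e) * h y + e / n%:R * (K i h y + S)) -
  e / n%:R * s * ((d - 3 * s) * ((1 + s) * h y)) -
  ((1 - e) * ((1 + s) * h y) + e / n%:R * (K i h y + ((1 + s) * S + (1 + s) * s * ((1 - d) * ((1 + s) * h y))))) =
  e / n%:R * s * (K i h y - ((d - 3 * s) * ((1 + s) * h y) + (1 + s) * ((1 - d) * ((1 + s) * h y)))).
  by field; rewrite gt_eqF.
rewrite mulr_ge0//; first by rewrite mulr_ge0.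
rewrite subr_ge0 -(ler_pM2l s1); apply: le_trans Kl.
have -> : (1 + s) * ((d - 3 * s) * ((1 + s) * h y) + (1 + s) * ((1 - d) * ((1 + s) * h y))) =
  (1 + s) ^+ 2 * ((d - 3 * s) + (1 + s) * (1 - d)) * h y by ring.
rewrite -[X in _ <= X]mul1r ler_wpM2r ?(ltW hy)//.
have -> : (1 + s) ^+ 2 * ((d - 3 * s) + (1 + s) * (1 - d)) =
  1 - (s * d + 3 * s ^+ 2 + 2 * (s ^+ 2 * d) + 2 * s ^+ 3 + s ^+ 3 * d) by ring.
have d0' := ltW d0.
rewrite lerBlDr lerDl; repeat (apply: addr_ge0 => //); rewrite ?mulr_ge0// ?exprn_ge0//.
Qed.

End OneStep.
End Dynamics.

(** * Summation of errors *)

Section SumArithmetic.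
Context {R : realType}.

Lemma sum_cauchy (I : Type) (r : seq I) (t p q : I -> R) :
  (forall i, 0 <= p i) -> (forall i, 0 <= q i) -> (forall i, t i ^+ 2 <= p i * q i) ->
  (\sum_(i <- r) t i) ^+ 2 <= (\sum_(i <- r) p i) * (\sum_(i <- r) q i).
Proof.
move=> p0 q0 tpq; elim: r => [|i r IH]; first by rewrite !big_nil expr0n/= mul0r.
rewrite !big_cons; have := tpq i; have := p0 i; have := q0 i.
have : 0 <= \sum_(j <- r) p j by exact: sumr_ge0.
have : 0 <= \sum_(j <- r) q j by exact: sumr_ge0.
move: IH; move: (\sum_(j <- r) t j) (\sum_(j <- r) p j) (\sum_(j <- r) q j).
move: (t i) (p i) (q i) => u a b S P Q H Q0 P0 b0 a0 uab.
have H1 : (2 * (u * S)) ^+ 2 <= (a * Q + P * b) ^+ 2.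
  apply: (@le_trans _ _ (4 * ((a * Q) * (P * b)))); last first.
    by have := sqr_ge0 (a * Q - P * b); lra.
  have := ler_pM (sqr_ge0 u) (sqr_ge0 S) uab H; rewrite !exprMn; lra.
have : 2 * (u * S) <= a * Q + P * b.
  apply: le_trans (ler_norm _) _; rewrite -ler_sqr ?nnegrE//; last first.
    by rewrite addr_ge0// mulr_ge0.
  by rewrite real_normK ?num_real.
lra.
Qed.

Lemma expn_le_lin (s : R) n : 0 <= s <= 1 -> (1 + s) ^+ n <= 1 + s * 3%:R ^+ n.
Proof.
move=> /andP[s0 s1]; elim: n => [|n IH]; first by rewrite !expr0; lra.
rewrite !exprS; have : 1 <= (3%:R : R) ^+ n by rewrite exprn_ege1// ler1n.
move: IH; move: ((1 + s) ^+ n) (3%:R ^+ n) => u v uv v1.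
have s1' : 0 <= 1 + s by lra.
have := ler_wpM2l s1' uv; have : 0 <= s * (v - 1) by rewrite mulr_ge0//; lra.
have : 0 <= s * v * (1 - s) by rewrite !mulr_ge0//; lra.
lra.
Qed.

Lemma le_mul_eps (x y : R) : 0 <= y -> (forall eps, 0 < eps -> x <= (1 + eps) * y) -> x <= y.
Proof.
move=> y0 H; rewrite leNgt; apply/negP => yx.
have [y00|yn0] := eqVneq y 0.
  by have := H 1 ltr01; rewrite y00 mulr0 leNgt -{1}y00 yx.
have yp : 0 < y by rewrite lt_neqAle eq_sym yn0.
have ep : 0 < (x - y) / (2 * y) by rewrite divr_gt0 ?subr_gt0// mulr_gt0.
have := H _ ep; have -> : (1 + (x - y) / (2 * y)) * y = (x + y) / 2.
  by field; rewrite gt_eqF.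
lra.
Qed.

Lemma geometric_small (c r eps : R) : 0 <= r < 1 -> 0 < eps -> exists N, c * r ^+ N <= eps.
Proof.
move=> /andP[r0 r1] e0.
have := @cvg_geometric R c r; rewrite ger0_norm// => /(_ r1) /cvgrPdist_le /(_ _ e0).
case=> N _ /(_ N (leqnn N)); rewrite /= sub0r normrN /geometric /= => H.
by exists N; apply: le_trans (ler_norm _) H.
Qed.

(** The potential [W k = y k * expR (L * s k)] absorbs the error [B * s k]: its decrease contracts
    at the clean rate [A] and the sum telescopes. The factor [101 / 100] compensates [1 - A], since
    [A <= 1 / 101]. *)
Lemma decay_sum (y s : nat -> R) (A B L : R) : 0 < A <= 1 / 101 -> 0 <= B ->
  (forall k, 0 <= y k) -> (forall k, 0 <= s k) ->
  (forall k, y k.+1 <= (1 - A + B * s k) * y k) ->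
  (forall k, 101 / 100 * (B * s k) <= L * (s k - s k.+1)) -> 0 <= L ->
  forall N, \sum_(k < N) y k <= A^-1 * (y 0%N * expR (L * s 0%N)).
Proof.
move=> /andP[A0 A1] B0 y0 s0 ys sL L0.
pose W k := y k * expR (L * s k).
have W0 k : 0 <= W k by rewrite mulr_ge0// expR_ge0.
have yW k : y k <= W k.
  by rewrite ler_peMr// -[leLHS]expR0 ler_expR mulr_ge0.
have WS k : W k.+1 <= (1 - A) * W k.
  have Bs : 0 <= B * s k by rewrite mulr_ge0.
  apply: (@le_trans _ _ ((1 - A + B * s k) * y k * expR (L * s k.+1))).
    by rewrite ler_wpM2r ?expR_ge0.
  have -> : (1 - A) * W k = (1 - A) * expR (L * s k - L * s k.+1) * y k * expR (L * s k.+1).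
    rewrite /W expRD expRN; have := expR_gt0 (L * s k.+1) => ?.
    by field; rewrite gt_eqF.
  rewrite ler_wpM2r ?expR_ge0// ler_wpM2r//.
  apply: (@le_trans _ _ ((1 - A) * (1 + (L * s k - L * s k.+1)))).
    by have := sL k; nra.
  by rewrite ler_wpM2l ?expR_ge1Dx//; lra.
have tel N : A * \sum_(k < N) y k <= W 0%N - W N.
  elim: N => [|N IH]; first by rewrite big_ord0 mulr0 subrr.
  by rewrite big_ord_recr/= mulrDr; have := WS N; have := yW N; nra.
move=> N; rewrite -(ler_pM2l A0) mulrA mulfV ?gt_eqF// mul1r.
by have := tel N; have := W0 N; rewrite /W; lra.
Qed.

End SumArithmetic.

(** * Covariance bounds along the iterates *)

Section Iteration.
Context {R : realType} {T : Type} {n : nat}.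
Variables (adj : 'I_n -> T -> T -> Prop) (bm : (T -> R) -> Prop)
  (E : (T -> R) -> R) (K : 'I_n -> (T -> R) -> T -> R) (a : 'I_n -> 'I_n -> R).
Hypothesis G : gibbs adj bm E K a.
Variable d : R.
Hypothesis a_ge0 : forall i j, 0 <= a i j.
Hypothesis a_diag : forall i, a i i = 0.
Hypothesis d01 : 0 < d <= 1.
Hypothesis a_row : forall i, \sum_j a i j <= 1.
Hypothesis a_col : forall j, \sum_i a i j <= 1 - d.
Hypothesis n_gt0 : (0 < n)%N.
Hypothesis adj_path : forall x y, exists z : nat -> T,
  [/\ z 0%N = x, z n = y & forall i : 'I_n, adj i (z i) (z i.+1)].

Let nR : 0 < n%:R :> R. Proof. by rewrite ltr0n. Qed.
Let n1 : 1 <= n%:R :> R. Proof. by rewrite ler1n. Qed.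

Variable e : R.
Hypothesis e_gt0 : 0 < e.
(** With this choice the second-order term [64 * e^2] of a step is one percent of the contraction
    [e / n * d]. *)
Hypothesis e_small : 64 * (n%:R * e) = d / 100.

Let e_le : e <= 1 / 50.
Proof.
have /andP[d0 d1] := d01; have e0 := e_gt0; have es := e_small; have nR' := n1.
by have : e <= n%:R * e by [rewrite ler_peMl// ltW]; lra.
Qed.

Let e01 : 0 <= e <= 1.
Proof. by have e0 := e_gt0; have := e_le => ?; rewrite ltW//=; lra. Qed.

Section Start.
Variables (s : R) (h : T -> R).
Hypotheses (s0 : 0 <= s) (sd : s <= d / 5).
Hypotheses (bh : bm h) (hpos : pos h) (lh : lip adj s h).

Let hk k := iter k (lazy K e) h.
Let sk k := s * (1 - e / n%:R * (d - 3 * s)) ^+ k.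
Let rate01 : 0 <= 1 - e / n%:R * (d - 3 * s) < 1.
Proof.
have /andP[d0 d1] := d01; have s0' := s0; have sd' := sd; have nR' := n1.
have e0 := e_gt0; have e1 := e_le.
have p : 0 < e / n%:R <= 1.
  by rewrite divr_gt0//= ler_pdivrMr//; lra.
have q : 0 < d - 3 * s <= 1 by lra.
by move: p q => /andP[? ?] /andP[? ?]; apply/andP; split; nra.
Qed.

Let sk_bound k : 0 <= sk k <= s.
Proof.
have /andP[r0 r1] := rate01; rewrite /sk mulr_ge0 ?exprn_ge0//=.
by rewrite ler_piMr// exprn_ile1// ltW.
Qed.

Let hk_ok k : [/\ bm (hk k), pos (hk k) & lip adj (sk k) (hk k)].
Proof.
elim: k => [|k [b p l]]; first by rewrite /sk expr0 mulr1.
have /andP[k0 ks] := sk_bound k; have sd' := sd.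
have kd : sk k <= d / 5 by exact: le_trans ks sd.
split; [exact: (bm_lazy G)|exact: (pos_lazy G n_gt0 e01)|].
have l' := lip_lazy G a_ge0 d01 a_col n_gt0 k0 kd e01 b p l.
move=> i x y xy; apply: le_trans (l' i x y xy) _.
rewrite ler_wpM2r//; first by apply/ltW/pos_gt0/(pos_lazy G n_gt0 e01).
have -> : sk k.+1 = sk k * (1 - e / n%:R * (d - 3 * s)) by rewrite /sk exprSr mulrA.
rewrite lerD2l ler_wpM2l//.
rewrite lerD2l lerN2 ler_wpM2l//; last by lra.
by have /andP[? ?] := e01; rewrite divr_ge0// ltW.
Qed.

(** Bounds the sum of [e / n * sqrt (Jtot h_k)] relative to [sqrt (Jtot h)], uniformly in [e]. The
    prefactor is the inverse of [d / 2] less one percent. The exponent sums the errors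
    [9 / 2 * s_k], which decay at rate [d - 3 * s]; [23 / 5] exceeds [101 / 100 * 9 / 2]. *)
Definition growth_const := 200 / (99 * d) * expR (23 / 5 * (s / (d - 3 * s))).

Lemma growth_const_ge0 : 0 <= growth_const.
Proof.
have /andP[d0 d1] := d01; rewrite /growth_const mulr_ge0 ?expR_ge0// divr_ge0//.
by lra.
Qed.

Lemma sum_sqrt_Jtot N :
  \sum_(k < N) e / n%:R * Num.sqrt (Jtot E K (hk k)) <=
  growth_const * Num.sqrt (Jtot E K h).
Proof.
have /andP[d0 d1] := d01; have s0' := s0; have sd' := sd; have nR' := n1.
have /andP[e0 e1] := e01.
have ep := e_gt0; have el := e_le.
have en0 : 0 < e / n%:R by rewrite divr_gt0.
have en1 : e / n%:R * d <= 1 / 50.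
  have : e / n%:R <= e by rewrite ler_pdivrMr// ler_peMr.
  by move=> ?; apply: (@le_trans _ _ (e * 1)); [rewrite ler_pM//; lra|lra].
have e64 : 64 * e ^+ 2 = e / n%:R * (d / 100).
  by rewrite -e_small; field; rewrite gt_eqF.
have g0 : 0 < d - 3 * s by lra.
have Jn k : 0 <= Jtot E K (hk k).
  have [b p l] := hk_ok k; apply: sumr_ge0 => i _; exact: (J_ge0 G).
pose A := e / n%:R * (d / 2) * (99 / 100).
pose B := e / n%:R * (9 / 2).
pose L := 23 / 5 / (d - 3 * s).
rewrite -mulr_sumr.
have A0 : 0 < A by apply: mulr_gt0; [apply: mulr_gt0 => //; lra|lra].
have D := @decay_sum R (fun k => Num.sqrt (Jtot E K (hk k))) sk A B L.
have -> : growth_const * Num.sqrt (Jtot E K h) =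
   e / n%:R * (A^-1 * (Num.sqrt (Jtot E K (hk 0)) * expR (L * sk 0))).
  rewrite /growth_const /A /L /sk expr0 mulr1 /hk/=.
  rewrite (_ : 23 / 5 / (d - 3 * s) * s = 23 / 5 * (s / (d - 3 * s))); last first.
    by field; rewrite gt_eqF.
  move: (expR _) (Num.sqrt _) => u v; field.
  by rewrite !gt_eqF.
rewrite ler_pM2l//; apply: D.
- by rewrite A0 /= /A; lra.
- by rewrite /B mulr_ge0//; lra.
- by move=> k; rewrite sqrtr_ge0.
- by move=> k; case/andP: (sk_bound k).
- move=> k; have [b p l] := hk_ok k; have /andP[k0 ks] := sk_bound k.
  have kd : sk k <= d / 5 by exact: le_trans ks sd.
  have AB : 0 <= 1 - A + B * sk k.
    have : 0 <= B * sk k by rewrite mulr_ge0// /B mulr_ge0//; lra.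
    by rewrite /A; lra.
  (* Passing to square roots halves the rates, because the contraction factor
     [1 - 2 * A + 2 * B * s_k] is at most [(1 - A + B * s_k)^2]. *)
  rewrite -[X in _ <= X * _](ger0_norm AB) -sqrtr_sqr -sqrtrM ?sqr_ge0//.
  rewrite ler_wsqrtr//; apply: le_trans (Jtot_lazy G a_ge0 a_diag d01 a_row a_col n_gt0 k0 kd e01 b p l) _.
  rewrite ler_wpM2r ?Jn// e64.
  have := sqr_ge0 (A - B * sk k); rewrite /A /B; lra.
- move=> k; rewrite /sk exprSr.
  have -> : L * (s * (1 - e / n%:R * (d - 3 * s)) ^+ k -
     s * ((1 - e / n%:R * (d - 3 * s)) ^+ k * (1 - e / n%:R * (d - 3 * s)))) =
     23 / 5 * (e / n%:R) * (s * (1 - e / n%:R * (d - 3 * s)) ^+ k).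
    rewrite /L; move: (d - 3 * s) g0 => g g0; move: (_ ^+ k) => v; field.
    by rewrite !gt_eqF.
  have : 0 <= e / n%:R * sk k.
    by apply: mulr_ge0; [exact: ltW|case/andP: (sk_bound k)].
  by rewrite -/(sk k) /B; lra.
- by rewrite /L divr_ge0//; lra.
Qed.

Lemma E_hk k : E (hk k) = E h.
Proof.
elim: k => //= k IH; have [b p l] := hk_ok k.
have := E_lazy G n_gt0 e b (bm_cst G 1).
have -> : (fun x : T => (1 : R) * lazy K e (hk k) x) = lazy K e (hk k).
  by apply/funext => x; rewrite mul1r.
have -> : (fun x : T => (1 : R) * hk k x) = hk k by apply/funext => x; rewrite mul1r.
rewrite big1 ?mulr0 ?subr0 ?IH// => i _.
rewrite -(E_cst G 0); congr E; apply/funext => x.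
by rewrite (K_cst G) subrr mulr0.
Qed.

Lemma lip_path (t : R) (u : T -> R) x y : 0 <= t -> pos u -> lip adj t u -> u x <= (1 + t) ^+ n * u y.
Proof.
move=> t0 pu lu; have [z [<- <- zz]] := adj_path x y.
have key k : (k <= n)%N -> u (z 0%N) <= (1 + t) ^+ k * u (z k).
  elim: k => [|k IH] kn; first by rewrite expr0 mul1r.
  apply: le_trans (IH (ltnW kn)) _; rewrite exprSr -mulrA ler_wpM2l//.
    by rewrite exprn_ge0//; lra.
  exact: lu (zz (Ordinal kn)).
exact: key.
Qed.

(** Any two points are joined by [n] single-coordinate moves, so [h_N] varies by a factor of at most
    [(1 + s_N)^n]. This tends to [1], while the mean of [h_N] stays [E h]. *)
Lemma hk_limit eps : 0 < eps -> exists N, forall x,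
  hk N x <= (1 + eps) * E h /\ E h <= (1 + eps) * hk N x.
Proof.
move=> e0; have s0' := s0; have /andP[d0 d1] := d01; have sd' := sd.
have t0 : 0 < (3%:R : R) ^+ n by rewrite exprn_gt0.
have [N HN] := @geometric_small R s _ _ rate01 (divr_gt0 e0 t0).
have [b p l] := hk_ok N; have /andP[k0 ks] := sk_bound N.
exists N => x.
have c1 : (1 + sk N) ^+ n <= 1 + eps.
  apply: le_trans (expn_le_lin n _) _; first by rewrite k0/=; lra.
  by rewrite lerD2l -ler_pdivlMr.
have Eh0 : 0 <= E h by apply: (E_ge0 G) => // y; exact/ltW/pos_gt0.
have c0 : 0 <= (1 + sk N) ^+ n by rewrite exprn_ge0//; lra.
rewrite -(E_hk N); split.
- apply: (@le_trans _ _ ((1 + sk N) ^+ n * E (hk N))); last first.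
    by rewrite ler_wpM2r// E_hk.
  rewrite -(EZ G)// -[leLHS](E_cst G); apply: (E_le G) => //; [exact: (bm_cst G)|bmt|].
  by move=> y; exact: lip_path.
- apply: (@le_trans _ _ ((1 + sk N) ^+ n * hk N x)); last first.
    by rewrite ler_wpM2r// ltW// pos_gt0.
  rewrite -[leRHS](E_cst G); apply: (E_le G) => //; first exact: (bm_cst G).
  by move=> y; exact: lip_path.
Qed.

Section Covariance.
Variables (f : T -> R) (b : 'I_n -> T -> R).
Hypotheses (bf : bm f) (f0 : forall x, 0 <= f x) (bb : forall i, bm (b i)).
Hypothesis ib : forall i, ind adj i (b i).
Hypothesis fb : forall x, \sum_i (f x - b i x) ^+ 2 <= 4 * f x.

(** At each site [f - K i f] is an admissible test function for the energy of [u]. The sites are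
    combined by the Cauchy-Schwarz inequality, and the sum of the [(f - b i)^2] is at most
    [4 * f]. *)
Lemma cov_step (u : T -> R) (t : R) : 0 <= t -> bm u -> pos u -> lip adj t u ->
  `|\sum_i E (fun x => u x * (f x - K i f x))| <=
  2 * (1 + t) * Num.sqrt (Jtot E K u) * Num.sqrt (E (fun x => f x * u x)).
Proof.
move=> t0 bu pu lu.
have Ju i : 0 <= J E K i u := J_ge0 G i bu pu.
have bfb i : bm (fun x => u x * (f x - b i x) ^+ 2) by have := bb i => ?; bmt.
pose V i := (1 + t) ^+ 2 * E (fun x => u x * (f x - b i x) ^+ 2).
have V0 i : 0 <= V i.
  rewrite mulr_ge0 ?sqr_ge0//; apply: (E_ge0 G) => // x.
  by rewrite mulr_ge0 ?sqr_ge0// ltW// pos_gt0.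
have tV i : E (fun x => u x * (f x - K i f x)) ^+ 2 <= J E K i u * V i.
  have bbi := bb i; have ibi : ind adj i (b i) := @ib i.
  have bphi : bm (fun x => f x - K i f x) by bmt.
  have Kphi x : K i (fun x => f x - K i f x) x = 0.
    by rewrite (KB G)//; [rewrite (K_id G (F := K i f)) ?subrr//; [bmt|exact: (indK G)]|bmt].
  apply: le_trans (J_cauchy G bu pu bphi Kphi) _; rewrite ler_wpM2l//.
  apply: (@le_trans _ _ ((1 + t) * E (fun x => K i u x * (f x - K i f x) ^+ 2))).
    rewrite -(EZ G); last by bmt.
    apply: (E_le G); [by bmt..|move=> x].
    by rewrite mulrA ler_wpM2r ?sqr_ge0//; exact: (le_lip_K G bu lu).
  rewrite /V expr2 -mulrA ler_wpM2l//; first by lra.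
  (* [K i f] minimizes the mean square distance among functions independent of [i], but only for a
     weight that ignores [i]. Hence the detour from [u] to [K i u] and back, at the cost of
     [(1 + t)^2]. *)
  apply: (@le_trans _ _ (E (fun x => K i u x * (f x - b i x) ^+ 2))).
    have -> : (fun x => K i u x * (f x - b i x) ^+ 2) =
      (fun x => K i u x * (f x - K i f x) ^+ 2 +
       (2 * ((K i u x * (K i f x - b i x)) * (f x - K i f x)) +
        K i u x * (K i f x - b i x) ^+ 2)).
      by apply/funext => x; ring.
    rewrite (ED G); [|by bmt..]; rewrite lerDl (ED G); [|by bmt..].
    rewrite (EZ G); [|by bmt..]; rewrite (E_ind0 G (i := i))//; [|by bmt|].
      rewrite mulr0 add0r; apply: (E_ge0 G); first by bmt.
      move=> x; rewrite mulr_ge0 ?sqr_ge0//.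
      by apply/ltW/pos_gt0/(posK G).
    by move=> x y xy; rewrite (indK G bu xy) (indK G bf xy) (ibi _ _ xy).
  rewrite -(EZ G); last by bmt.
  apply: (E_le G); [by bmt..|move=> x].
  by rewrite mulrA ler_wpM2r ?sqr_ge0//; exact: (lip_K_le G bu lu).
have fu0 : 0 <= E (fun x => f x * u x).
  by apply: (E_ge0 G); [bmt|move=> x; rewrite mulr_ge0// ltW// pos_gt0].
have t1 : 0 <= 1 + t by lra.
have J0 : 0 <= Jtot E K u by exact: sumr_ge0.
rewrite -ler_sqr ?nnegrE//; last by rewrite !mulr_ge0 ?sqrtr_ge0.
rewrite real_normK ?num_real//.
apply: le_trans (sum_cauchy _ Ju V0 tV) _.
rewrite !exprMn !sqr_sqrtr// -/(Jtot E K u).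
rewrite [X in _ <= X]mulrAC [X in _ <= X]mulrC ler_wpM2l//.
rewrite /V -mulr_sumr -(E_sum G)//.
have -> : 2 ^+ 2 * (1 + t) ^+ 2 * E (fun x => f x * u x) =
  (1 + t) ^+ 2 * (4 * E (fun x => f x * u x)) by ring.
rewrite ler_wpM2l ?sqr_ge0// -(EZ G); last by bmt.
apply: (E_le G); [exact: (bm_sum G)|by bmt|move=> x].
rewrite -mulr_sumr mulrA mulrC ler_wpM2r// ltW// pos_gt0//.
Qed.

Let Rk k := E (fun x => f x * hk k x).
Let bet k := e / n%:R * Num.sqrt (Jtot E K (hk k)).

Let Rk_step k : `|Rk k.+1 - Rk k| <= 2 * (1 + s) * bet k * Num.sqrt (Rk k).
Proof.
have [b' p l] := hk_ok k; have /andP[k0 ks] := sk_bound k.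
have /andP[e0 e1] := e01; have en : 0 <= e / n%:R by rewrite divr_ge0// ltW.
rewrite /Rk (_ : hk k.+1 = lazy K e (hk k))// (E_lazy G)// addrAC subrr add0r.
rewrite normrN normrM (ger0_norm en).
have -> : 2 * (1 + s) * bet k * Num.sqrt (E (fun x => f x * hk k x)) =
  e / n%:R * (2 * (1 + s) * Num.sqrt (Jtot E K (hk k)) * Num.sqrt (E (fun x => f x * hk k x))).
  by rewrite /bet; ring.
rewrite ler_wpM2l//; apply: le_trans (cov_step k0 b' p l) _.
do 2 (rewrite ler_wpM2r ?sqrtr_ge0//).
by rewrite ler_wpM2l// lerD2l.
Qed.

Let Rk0 k : 0 <= Rk k.
Proof.
have [b' p l] := hk_ok k.
by apply: (E_ge0 G); [bmt|move=> x; rewrite mulr_ge0// ltW// pos_gt0].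
Qed.

(** The increment of [R_k] carries the unknown factor [sqrt R_k]. Working with [sqrt R_k] removes
    it: each step raises the root by at most [(1 + s) * bet k], and [R_k] tends to [E f * E h]. *)
Lemma lower_covariance : Num.sqrt (E f * E h) <=
  Num.sqrt (E (fun x => f x * h x)) +
  (1 + s) * growth_const * Num.sqrt (Jtot E K h).
Proof.
have s0' := s0.
have Ef0 : 0 <= E f by exact: (E_ge0 G).
have Eh0 : 0 <= E h by apply: (E_ge0 G) => // y; exact/ltW/pos_gt0.
have bet0 k : 0 <= bet k.
  by have /andP[e0 _] := e01; rewrite /bet mulr_ge0 ?sqrtr_ge0// divr_ge0// ltW.
have key N : Num.sqrt (Rk N) <= Num.sqrt (Rk 0%N) + (1 + s) * \sum_(k < N) bet k.
  elim: N => [|N IH]; first by rewrite big_ord0 mulr0 addr0.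
  rewrite big_ord_recr/= mulrDr addrA.
  apply: (@le_trans _ _ (Num.sqrt (Rk N) + (1 + s) * bet N)); last by rewrite lerD2r.
  have s1 : 0 <= (1 + s) * bet N by rewrite mulr_ge0//; lra.
  rewrite -ler_sqr ?nnegrE ?sqrtr_ge0 ?addr_ge0 ?sqrtr_ge0// sqr_sqrtr//.
  have := Rk_step N; rewrite ler_norml => /andP[_].
  rewrite sqrrD sqr_sqrtr//; have := sqr_ge0 ((1 + s) * bet N); lra.
set c := Num.sqrt (E (fun x => f x * h x)) + _.
have c0 : 0 <= c.
  apply: addr_ge0; first exact: sqrtr_ge0.
  apply: mulr_ge0; last exact: sqrtr_ge0.
  by apply: mulr_ge0; [lra|exact: growth_const_ge0].
suff : E f * E h <= c ^+ 2.
  by move=> H; rewrite -[leRHS](ger0_norm c0) -sqrtr_sqr ler_wsqrtr.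
apply: le_mul_eps; first exact: sqr_ge0.
move=> eps eps0; have [N HN] := hk_limit eps0.
have [b' p l] := hk_ok N.
apply: (@le_trans _ _ ((1 + eps) * Rk N)).
  rewrite mulrC -!(EZ G)//; last by bmt.
  apply: (E_le G); [by bmt..|move=> x]; have [_ H] := HN x.
  by have := ler_wpM2l (f0 x) H; lra.
rewrite ler_wpM2l//; first by lra.
rewrite -[leLHS]sqr_sqrtr// lerXn2r ?nnegrE ?sqrtr_ge0//.
apply: le_trans (key N) _; rewrite lerD2l -mulrA ler_wpM2l//; first by lra.
exact: sum_sqrt_Jtot.
Qed.

(** Here the losses of [R_k] are summed, so [sqrt R_k] has to be bounded from above. For an
    exponential [h] the inequality [R_k <= R_0] holds all along the iteration. *)
Lemma upper_covariance lam : 0 < lam -> (forall x, h x = expR (lam * f x)) ->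
  E (fun x => f x * h x) <= E f * E h +
  2 * (1 + s) * growth_const * Num.sqrt (Jtot E K h) * Num.sqrt (E (fun x => f x * h x)).
Proof.
move=> lam0 hE; have s0' := s0.
have Ef0 : 0 <= E f by exact: (E_ge0 G).
have Eh0 : 0 <= E h by apply: (E_ge0 G) => // y; exact/ltW/pos_gt0.
pose gk k := iter k (lazy K e) (fun x => h x * f x).
have bg k : bm (gk k).
  by elim: k => [|k IH]; [rewrite /gk/=; bmt|exact: (bm_lazy G)].
have Egk k : E (gk k) = E (fun x => f x * h x).
  elim: k => [|k IH]; first by congr E; apply/funext => x; rewrite /gk/= mulrC.
  have := E_lazy G n_gt0 e (bg k) (bm_cst G 1).
  have -> : (fun x : T => (1 : R) * lazy K e (gk k) x) = gk k.+1.
    by apply/funext => x; rewrite mul1r.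
  have -> : (fun x : T => (1 : R) * gk k x) = gk k by apply/funext => x; rewrite mul1r.
  rewrite big1 ?mulr0 ?subr0 ?IH// => i _.
  rewrite -(E_cst G 0); congr E; apply/funext => x.
  by rewrite (K_cst G) subrr mulr0.
(* Young's inequality for the convex conjugate pair of the exponential,
   propagated by positivity of the Markov operators *)
have young k x : (f x + lam^-1) * hk k x - gk k x <= lam^-1 * h x.
  have lin c' k' : (fun y => c' * hk k' y - gk k' y) =
      iter k' (lazy K e) (fun y => c' * h y - h y * f y).
    elim: k' => [//|k' IH]; rewrite iterS -IH; apply/funext => y.
    have [b' p l] := hk_ok k'; have bgk := bg k'.
    rewrite /hk /gk !iterS -/(hk k') -/(gk k') /lazy.
    have -> : \sum_j K j (fun y0 => c' * hk k' y0 - gk k' y0) y =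
       c' * \sum_j K j (hk k') y - \sum_j K j (gk k') y.
      rewrite mulr_sumr -sumrB; apply: eq_bigr => j _.
      by rewrite (KB G)//; [rewrite (KZ G)|bmt].
    ring.
  have := congr1 (fun F => F x) (lin (f x + lam^-1) k) => /= ->.
  pose F y := (f x + lam^-1) * h y - h y * f y.
  have bF : bm F by rewrite /F; bmt.
  have Fle y : F y <= lam^-1 * h x.
    rewrite /F !hE; have li : 0 < lam^-1 by rewrite invr_gt0.
    have := expR_ge1Dx (lam * f x - lam * f y).
    rewrite expRD expRN -(ler_pM2r (expR_gt0 (lam * f y))) mulfVK ?gt_eqF ?expR_gt0//.
    move=> H; have := ler_wpM2l (ltW li) H.
    have -> : lam^-1 * ((1 + (lam * f x - lam * f y)) * expR (lam * f y)) =
      (f x + lam^-1) * expR (lam * f y) - expR (lam * f y) * f y.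
      by field; rewrite gt_eqF.
    exact.
  have [M FM] := bm_bounded G bF.
  have H k' : bm (iter k' (lazy K e) F) /\
      forall y, - M <= iter k' (lazy K e) F y <= lam^-1 * h x.
    elim: k' => [|k' [b' IH]].
      by split=> // y; rewrite Fle andbT; have := FM y; rewrite ler_norml => /andP[].
    by split; [exact: (bm_lazy G)|exact: (lazy_bounds G n_gt0 e01 b' IH)].
  by have [_ /(_ x)/andP[]] := H k.
(* Taking means in [young]: [gk k] has mean [R_0] and [hk k] has mean [E h], so the terms with
   [lam^-1] cancel. *)
have RkR0 k : Rk k <= Rk 0%N.
  have [b' p l] := hk_ok k; have bgk := bg k.
  have : E (fun x => (f x + lam^-1) * hk k x - gk k x) <= E (fun x => lam^-1 * h x).
    by apply: (E_le G); [by bmt|by bmt|exact: young].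
  rewrite (EB G)//; last by bmt.
  have -> : (fun x => (f x + lam^-1) * hk k x) = (fun x => f x * hk k x + lam^-1 * hk k x).
    by apply/funext => x; rewrite mulrDl.
  rewrite (ED G); [|by bmt..]; rewrite !(EZ G)// Egk E_hk.
  rewrite /Rk /hk/=; lra.
have bet0 k : 0 <= bet k.
  by have /andP[e0 _] := e01; rewrite /bet mulr_ge0 ?sqrtr_ge0// divr_ge0// ltW.
have key N : Rk 0%N <= Rk N + 2 * (1 + s) * Num.sqrt (Rk 0%N) * \sum_(k < N) bet k.
  elim: N => [|N IH]; first by rewrite big_ord0 mulr0 addr0.
  rewrite big_ord_recr/= mulrDr.
  have := Rk_step N; rewrite ler_norml => /andP[H _].
  have : 2 * (1 + s) * bet N * Num.sqrt (Rk N) <= 2 * (1 + s) * bet N * Num.sqrt (Rk 0%N).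
    rewrite ler_wpM2l ?ler_wsqrtr//; apply: mulr_ge0 => //; lra.
  lra.
rewrite -lerBlDr; set c := 2 * (1 + s) * _ * _ * _.
have key' N : Rk 0%N - c <= Rk N.
  rewrite lerBlDr; apply: le_trans (key N) _; rewrite lerD2l /c.
  have := sum_sqrt_Jtot N; rewrite -/(bet _) => H.
  have : 0 <= 2 * (1 + s) * Num.sqrt (Rk 0%N) by rewrite !mulr_ge0 ?sqrtr_ge0//; lra.
  move=> /ler_wpM2l /(_ _ _ H); rewrite /Rk /hk/=; lra.
apply: le_mul_eps; first exact: mulr_ge0.
move=> eps eps0; have [N HN] := hk_limit eps0.
have [b' p l] := hk_ok N.
apply: le_trans (key' N) _; rewrite /Rk.
have -> : (1 + eps) * (E f * E h) = (1 + eps) * E h * E f by ring.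
rewrite -(EZ G)//; apply: (E_le G); [by bmt..|move=> x]; have [H _] := HN x.
by have := ler_wpM2l (f0 x) H; lra.
Qed.

End Covariance.
End Start.
End Iteration.

(** * Exponential tilting *)

Section ExpBounds.
Context {R : realType}.

(** The fourth power of [1 - x / 4 <= exp (- x / 4)] reduces the bound to a polynomial inequality.
    [expR_le16] uses the sixteenth power in the same way, to make numerical checks rational. *)
Lemma expR_quadratic (x : R) : 0 <= x <= 1 / 5 -> expR x <= 1 + x + 7 / 10 * x ^+ 2.
Proof.
move=> /andP[x0 x1].
have p : 0 < 1 - x / 4 by lra.
have H : expR x * (1 - x / 4) ^+ 4 <= 1.
  apply: (@le_trans _ _ (expR x * expR (- (x / 4)) ^+ 4)).
    rewrite ler_wpM2l ?expR_ge0// lerXn2r ?nnegrE ?expR_ge0//; first by lra.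
    by have := expR_ge1Dx (- (x / 4)); lra.
  rewrite -expRM_natl -expRD; rewrite (_ : x + _ = 0) ?expR0//.
  by rewrite -[4%:R]/(4 : R); lra.
have p4 : 0 < (1 - x / 4) ^+ 4 by rewrite exprn_gt0.
rewrite -(ler_pM2r p4); apply: le_trans H _.
have [y [-> y0 y1]] : exists y, [/\ x = 4 * y, 0 <= y & y <= 1 / 20].
  by exists (x / 4); split; [field|lra|lra].
have -> : (1 + 4 * y + 7 / 10 * (4 * y) ^+ 2) * (1 - 4 * y / 4) ^+ 4 =
  1 + y ^+ 2 * (6 / 5 - 124 / 5 * y + y ^+ 2 * (261 / 5 - 204 / 5 * y) +
    56 / 5 * y ^+ 4) by field.
rewrite lerDl; apply: mulr_ge0; first exact: sqr_ge0.
have : 0 <= y ^+ 4 by exact: exprn_ge0.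
have : 50 * y ^+ 2 <= y ^+ 2 * (261 / 5 - 204 / 5 * y).
  by rewrite mulrC; apply: ler_wpM2l; [exact: sqr_ge0|lra].
nra.
Qed.

Lemma expR_le16 (x : R) : x < 16 -> expR x <= ((1 - x / 16) ^+ 16)^-1.
Proof.
move=> x16; have p : 0 < 1 - x / 16 by lra.
have H : expR x * (1 - x / 16) ^+ 16 <= 1.
  apply: (@le_trans _ _ (expR x * expR (- (x / 16)) ^+ 16)).
    rewrite ler_wpM2l ?expR_ge0// lerXn2r ?nnegrE ?expR_ge0//; first by lra.
    by have := expR_ge1Dx (- (x / 16)); lra.
  rewrite -expRM_natl -expRD; rewrite (_ : x + _ = 0) ?expR0//.
  by field.
by rewrite -[_^-1]mul1r ler_pdivlMr// exprn_gt0.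
Qed.

End ExpBounds.

Section Tilt.
Context {R : realType} {T : Type} {n : nat}.
Variables (adj : 'I_n -> T -> T -> Prop) (bm : (T -> R) -> Prop)
  (E : (T -> R) -> R) (K : 'I_n -> (T -> R) -> T -> R) (a : 'I_n -> 'I_n -> R).
Hypothesis G : gibbs adj bm E K a.
Variable d : R.
Hypothesis a_ge0 : forall i j, 0 <= a i j.
Hypothesis a_diag : forall i, a i i = 0.
Hypothesis d01 : 0 < d <= 1.
Hypothesis a_row : forall i, \sum_j a i j <= 1.
Hypothesis a_col : forall j, \sum_i a i j <= 1 - d.
Hypothesis n_gt0 : (0 < n)%N.
Hypothesis adj_path : forall x y, exists z : nat -> T,
  [/\ z 0%N = x, z n = y & forall i : 'I_n, adj i (z i) (z i.+1)].

Variables (f : T -> R) (b : 'I_n -> T -> R).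
Hypotheses (bf : bm f) (f0 : forall x, 0 <= f x) (bb : forall i, bm (b i)).
Hypothesis ib : forall i, ind adj i (b i).
Hypothesis bf1 : forall i x, b i x <= f x <= b i x + 1.
Hypothesis fb : forall x, \sum_i (f x - b i x) ^+ 2 <= 4 * f x.

Lemma bm_exp l : bm (fun x => expR (l * f x)).
Proof. by apply: (bm_expR G); bmt. Qed.

Lemma pos_exp l : pos (fun x => expR (l * f x)).
Proof.
have [M fM] := bm_bounded G bf; exists (expR (- (`|l| * `|M|))); first exact: expR_gt0.
move=> x; rewrite ler_expR lerNl -mulNr.
apply: le_trans (ler_norm _) _; rewrite normrM normrN ler_wpM2l//.
exact: le_trans (fM x) (ler_norm _).
Qed.

Lemma lip_exp l : 0 <= l -> lip adj (expR l - 1) (fun x => expR (l * f x)) /\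
  lip adj (expR l - 1) (fun x => expR (- l * f x)).
Proof.
move=> l0; have key i x y : adj i x y -> f x <= f y + 1.
  move=> xy; have /andP[_ H1] := bf1 i x; have /andP[H2 _] := bf1 i y.
  by apply: le_trans H1 _; rewrite lerD2r (@ib i x y).
split=> i x y xy; rewrite addrC subrK -expRD ler_expR.
- by have := ler_wpM2l l0 (key i x y xy); lra.
- by have := ler_wpM2l l0 (key i y x (adj_sym G xy)); lra.
Qed.

Let sqr_bound (l : R) (h c : T -> R) i : 0 <= l -> bm h -> pos h -> bm c -> ind adj i c ->
  forall k, 0 <= k -> (forall x, (h x - c x) ^+ 2 <= k * (l * (f x - b i x) * h x) ^+ 2) ->
  J E K i h <= k * l ^+ 2 * E (fun x => h x * (f x - b i x) ^+ 2).
Proof.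
move=> l0 bh hp bc ic k k0 H; have bbi := bb i.
apply: le_trans (J_le G bh hp bc ic) _.
have biv := bm_inv G bh hp.
rewrite -(EZ G); last by bmt.
apply: (E_le G); [by bmt..|move=> x].
have hx := pos_gt0 x hp; rewrite ler_pdivrMr//; apply: le_trans (H x) _.
by rewrite le_eqVlt; apply/orP; left; apply/eqP; ring.
Qed.

Let Jtot_bound (l k : R) (h : T -> R) : bm h -> pos h -> 0 <= k ->
  (forall i, J E K i h <= k * l ^+ 2 * E (fun x => h x * (f x - b i x) ^+ 2)) ->
  Jtot E K h <= k * (2 * l) ^+ 2 * E (fun x => f x * h x).
Proof.
move=> bh hp k0 H; rewrite /Jtot.
apply: (@le_trans _ _ (\sum_i k * l ^+ 2 * E (fun x => h x * (f x - b i x) ^+ 2))).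
  by apply: ler_sum => i _; exact: H.
have bhb i : bm (fun x => h x * (f x - b i x) ^+ 2) by have := bb i => ?; bmt.
rewrite -mulr_sumr -(E_sum G)//.
have -> : k * (2 * l) ^+ 2 * E (fun x => f x * h x) =
  k * l ^+ 2 * (4 * E (fun x => f x * h x)) by ring.
apply: ler_wpM2l; first by apply: mulr_ge0 => //; exact: sqr_ge0.
rewrite -(EZ G); last by bmt.
apply: (E_le G); [exact: (bm_sum G)|by bmt|move=> x].
by rewrite -mulr_sumr mulrA [leRHS]mulrC ler_wpM2l// ltW// pos_gt0.
Qed.

Lemma sqr_one_sub_exp (t u : R) : 0 <= t -> (u - expR (- t) * u) ^+ 2 <= (t * u) ^+ 2.
Proof.
move=> t0; have -> : u - expR (- t) * u = (1 - expR (- t)) * u by ring.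
rewrite !exprMn ler_wpM2r ?sqr_ge0// lerXn2r ?nnegrE//.
  by rewrite subr_ge0 -expR0 ler_expR oppr_le0.
by have := expR_ge1Dx (- t); lra.
Qed.

(** The competitor [exp (l * b i)] is independent of coordinate [i] and lies below [h], at distance
    at most [l * (f - b i) * h]. *)
Lemma Jtot_exp l : 0 <= l ->
  Jtot E K (fun x => expR (l * f x)) <=
  1 * (2 * l) ^+ 2 * E (fun x => f x * expR (l * f x)).
Proof.
move=> l0; apply: Jtot_bound => //; [exact: bm_exp|exact: pos_exp|move=> i].
have bbi := bb i.
apply: (@sqr_bound _ _ (fun x => expR (l * b i x))) => //.
- exact: bm_exp.
- exact: pos_exp.
- by apply: (bm_expR G); bmt.
- by move=> x y xy; rewrite (@ib i x y).
move=> x; rewrite mul1r; have /andP[B1 B2] := bf1 i x.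
have -> : expR (l * b i x) = expR (- (l * (f x - b i x))) * expR (l * f x).
  by rewrite -expRD; congr expR; ring.
by apply: sqr_one_sub_exp; rewrite mulr_ge0// subr_ge0.
Qed.

(** The competitor [exp (- l * b i)] now lies above [h]. Expressing the distance through [h] costs
    [exp (l * (f - b i)) <= exp l]. *)
Lemma Jtot_expN l : 0 <= l ->
  Jtot E K (fun x => expR (- l * f x)) <=
  expR l ^+ 2 * (2 * l) ^+ 2 * E (fun x => f x * expR (- l * f x)).
Proof.
move=> l0; apply: Jtot_bound => //; [exact: bm_exp|exact: pos_exp|move=> i].
have bbi := bb i.
apply: (@sqr_bound _ _ (fun x => expR (- l * b i x))) => //.
- exact: bm_exp.
- exact: pos_exp.
- by apply: (bm_expR G); bmt.
- by move=> x y xy; rewrite (@ib i x y).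
move=> x; have /andP[B1 B2] := bf1 i x.
have t0 : 0 <= l * (f x - b i x) by rewrite mulr_ge0// subr_ge0.
have := sqr_one_sub_exp (expR (- l * b i x)) t0.
have -> : expR (- (l * (f x - b i x))) * expR (- l * b i x) = expR (- l * f x).
  by rewrite -expRD; congr expR; ring.
have -> : (expR (- l * f x) - expR (- l * b i x)) ^+ 2 =
   (expR (- l * b i x) - expR (- l * f x)) ^+ 2 by ring.
move=> H; apply: le_trans H _.
have -> : expR (- l * b i x) = expR (l * (f x - b i x)) * expR (- l * f x).
  by rewrite -expRD; congr expR; ring.
have -> : l * (f x - b i x) * (expR (l * (f x - b i x)) * expR (- l * f x)) =
  expR (l * (f x - b i x)) * (l * (f x - b i x) * expR (- l * f x)) by ring.
rewrite [leLHS]exprMn ler_wpM2r ?sqr_ge0// lerXn2r ?nnegrE ?expR_ge0//.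
by rewrite ler_expR ler_piMr// lerBlDl.
Qed.

Let Ef0 : 0 <= E f. Proof. exact: (E_ge0 G). Qed.

(** Convexity of the logarithm of the moment generating function: its tangent at [t2] has the tilted
    mean as slope. The pointwise input is the tangent line of the exponential. *)
Lemma jensen_exp (t1 t2 : R) :
  E (fun x => expR (t2 * f x)) *
  expR ((t1 - t2) * (E (fun x => f x * expR (t2 * f x)) / E (fun x => expR (t2 * f x)))) <=
  E (fun x => expR (t1 * f x)).
Proof.
set m := E (fun x => expR (t2 * f x)); set r := E _ / m.
have b1 := bm_exp t1; have b2 := bm_exp t2.
have m0 : 0 < m.
  have [c c0 cf] := pos_exp t2; apply: lt_le_trans c0 _.
  by rewrite -[leLHS](E_cst G); apply: (E_le G) => //; exact: (bm_cst G).
set c := expR ((t1 - t2) * r).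
apply: (@le_trans _ _ (E (fun x => c * (expR (t2 * f x) +
   (t1 - t2) * (f x * expR (t2 * f x) - r * expR (t2 * f x)))))); last first.
  apply: (E_le G); [by bmt..|move=> x].
  have -> : expR (t1 * f x) = c * (expR (t2 * f x) * expR ((t1 - t2) * (f x - r))).
    by rewrite /c -!expRD; congr expR; ring.
  rewrite ler_wpM2l ?expR_ge0//.
  have -> : expR (t2 * f x) + (t1 - t2) * (f x * expR (t2 * f x) - r * expR (t2 * f x)) =
     expR (t2 * f x) * (1 + (t1 - t2) * (f x - r)) by ring.
  by rewrite ler_wpM2l ?expR_ge0// expR_ge1Dx.
rewrite (EZ G); last by bmt.
rewrite (ED G); [|by bmt..]; rewrite (EZ G); last by bmt.
rewrite (EB G); [|by bmt..]; rewrite (EZ G)// -/m.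
by rewrite /r divfK ?gt_eqF// subrr mulr0 addr0 mulrC.
Qed.

Lemma exists_step : exists2 e : R, 0 < e & 64 * (n%:R * e) = d / 100.
Proof.
have /andP[d0 d1] := d01; have nR : 0 < n%:R :> R by rewrite ltr0n.
exists (d / 100 / (64 * n%:R)).
  by rewrite divr_gt0// ?mulr_gt0// divr_gt0.
by field; rewrite gt_eqF.
Qed.

Section Tau.
(** Bounds free of [d]: with [l = t * d] the Lipschitz constant [s] is at most [d * u], [X] bounds
    the exponent in [growth_const], and [W] bounds [exp X] through [expR_le16]. The numerical checks
    then involve [t] alone. *)
Variables (t u X W : R).
Hypotheses (t01 : 0 < t <= 3 / 20) (ut : u = t + 7 / 10 * t ^+ 2).
Hypotheses (uX : 23 / 5 * u <= X * (1 - 3 * u)) (X16 : 0 <= X < 16).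
Hypothesis XW : 1 <= W * (1 - X / 16) ^+ 16.

Let l := t * d.
Let s := expR l - 1.

Let bounds : [/\ 0 < l, 0 <= s, s <= d * u, u <= 1 / 5 & s <= u].
Proof.
have /andP[d0 d1] := d01; have /andP[t0 t1] := t01; have uE := ut.
have l0 : 0 < l by rewrite mulr_gt0.
have l1 : l <= 1 / 5 by apply: (@le_trans _ _ (t * 1)); [rewrite ler_wpM2l// ltW|lra].
have su : s <= d * u.
  have := @expR_quadratic R l; rewrite (ltW l0) l1 => /(_ isT).
  rewrite /s uE => H.
  have : l ^+ 2 <= d * t ^+ 2.
    rewrite /l exprMn [leRHS]mulrC ler_wpM2l ?sqr_ge0//.
    by rewrite expr2 ler_piMr// ltW.
  by move: H; rewrite /l; lra.
have t2 : t ^+ 2 <= 3 / 20 * t by rewrite expr2 ler_wpM2r// ltW.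
have u0 : 0 <= u by rewrite uE; have := sqr_ge0 t; lra.
split=> //.
- by rewrite subr_ge0 -expR0 ler_expR ltW.
- by rewrite uE; lra.
- by apply: le_trans su _; rewrite ler_piMl.
Qed.

Let gc_le : l * growth_const d s <= t * (200 / 99) * W.
Proof.
have [l0 s0 su u15 _] := bounds; have /andP[d0 d1] := d01; have /andP[X0 X1] := X16.
have /andP[t0 t1] := t01; have uX' := uX.
have sX : 23 / 5 * (s / (d - 3 * s)) <= X.
  have p : 0 < d - 3 * s by have := ler_wpM2l (ltW d0) u15; lra.
  rewrite mulrA ler_pdivrMr//.
  apply: (@le_trans _ _ (d * (23 / 5 * u))); first by lra.
  apply: (@le_trans _ _ (d * (X * (1 - 3 * u)))); first by rewrite ler_wpM2l// ltW.
  have -> : d * (X * (1 - 3 * u)) = X * (d - 3 * (d * u)) by ring.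
  by apply: ler_wpM2l => //; lra.
have p16 : 0 < (1 - X / 16) ^+ 16 by apply: exprn_gt0; lra.
have W0 : 0 <= W by rewrite -(pmulr_lge0 _ p16); exact: le_trans ler01 XW.
have eW : expR (23 / 5 * (s / (d - 3 * s))) <= W.
  apply: (@le_trans _ _ (expR X)); first by rewrite ler_expR.
  by apply: le_trans (expR_le16 X1) _; rewrite -[_^-1]mul1r ler_pdivrMr.
have -> : l * growth_const d s = t * (200 / 99) * expR (23 / 5 * (s / (d - 3 * s))).
  rewrite /growth_const /l; move: (expR _) => v; field.
  by rewrite gt_eqF.
apply: ler_wpM2l eW; apply: mulr_ge0; first exact: ltW.
by lra.
Qed.

Let sd : s <= d / 5.
Proof.
have [l0 s0 su u15 _] := bounds; have /andP[d0 d1] := d01.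
by apply: le_trans su _; apply: ler_wpM2l; [exact: ltW|lra].
Qed.

Let gc0 : 0 <= growth_const d s.
Proof. exact: growth_const_ge0. Qed.

(** [upper_covariance] becomes [R0 <= E f * m + theta * R0], and the hypothesis on [c] says
    [c >= 1 / (1 - theta)]. *)
Lemma upper_tilt c : 0 < c -> 1 <= c * (1 - 4 * (1 + u) * (t * (200 / 99) * W)) ->
  E (fun x => f x * expR (l * f x)) <= c * E f * E (fun x => expR (l * f x)).
Proof.
move=> c0 Hc; have [l0 s0 su u15 su'] := bounds.
have [e e0 es] := exists_step.
have bh := bm_exp l; have ph := pos_exp l.
have [lh _] := lip_exp (ltW l0).
have H := upper_covariance G a_ge0 a_diag d01 a_row a_col n_gt0 adj_path e0 es
  s0 sd bh ph lh bf f0 bb ib fb l0 (fun x => erefl).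
set R0 := E (fun x => f x * expR (l * f x)) in H *.
have R00 : 0 <= R0.
  by apply: (E_ge0 G); [bmt|move=> x; rewrite mulr_ge0 ?expR_ge0].
have JR : Num.sqrt (Jtot E K (fun x => expR (l * f x))) <= 2 * l * Num.sqrt R0.
  have l20 : 0 <= 2 * l by lra.
  rewrite -[2 * l](ger0_norm l20) -sqrtr_sqr -sqrtrM ?sqr_ge0//.
  by rewrite ler_wsqrtr// -[X in X * R0]mul1r; exact: Jtot_exp (ltW l0).
have g2 : 0 <= 2 * (1 + s) * growth_const d s.
  by apply: mulr_ge0 => //; lra.
have : 2 * (1 + s) * growth_const d s * Num.sqrt (Jtot E K (fun x => expR (l * f x))) *
   Num.sqrt R0 <= 4 * (1 + u) * (t * (200 / 99) * W) * R0.
  apply: (@le_trans _ _ (2 * (1 + s) * growth_const d s * (2 * l * Num.sqrt R0) * Num.sqrt R0)).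
    by rewrite ler_wpM2r ?sqrtr_ge0// ler_wpM2l.
  have -> : 2 * (1 + s) * growth_const d s * (2 * l * Num.sqrt R0) * Num.sqrt R0 =
     4 * (1 + s) * (l * growth_const d s) * Num.sqrt R0 ^+ 2 by ring.
  rewrite sqr_sqrtr// ler_wpM2r//.
  apply: ler_pM; [lra|by rewrite mulr_ge0// ltW|lra|exact: gc_le].
set m := E _ in H *.
move=> H2; have := ler_wpM2r R00 Hc; have := ler_wpM2l (ltW c0) (le_trans H (lerD (lexx _) H2)).
lra.
Qed.

(** [lower_covariance] becomes [sqrt (E f * m) <= (1 + q) * sqrt R0], and the hypothesis on [c] says
    [c <= (1 + q)^-2]. *)
Lemma lower_tilt c : 0 < c -> c * (1 + 2 * (1 + u) ^+ 2 * (t * (200 / 99) * W)) ^+ 2 <= 1 ->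
  c * E f * E (fun x => expR (- l * f x)) <= E (fun x => f x * expR (- l * f x)).
Proof.
move=> c0 Hc; have [l0 s0 su u15 su'] := bounds.
have [e e0 es] := exists_step.
have bh := bm_exp (- l); have ph := pos_exp (- l).
have [_ lh] := lip_exp (ltW l0).
have H := lower_covariance G a_ge0 a_diag d01 a_row a_col n_gt0 adj_path e0 es
  s0 sd bh ph lh bf f0 bb ib fb.
set R0 := E (fun x => f x * expR (- l * f x)) in H *.
have R00 : 0 <= R0.
  by apply: (E_ge0 G); [bmt|move=> x; rewrite mulr_ge0 ?expR_ge0].
set m := E (fun x => expR _) in H *.
have m0 : 0 <= m by apply: (E_ge0 G) => // x; exact: expR_ge0.
have JR : Num.sqrt (Jtot E K (fun x => expR (- l * f x))) <= (1 + s) * (2 * l) * Num.sqrt R0.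
  have l20 : 0 <= (1 + s) * (2 * l) by rewrite mulr_ge0//; lra.
  rewrite -[(1 + s) * (2 * l)](ger0_norm l20) -sqrtr_sqr -sqrtrM ?sqr_ge0//.
  rewrite ler_wsqrtr// exprMn (_ : 1 + s = expR l); first exact: Jtot_expN (ltW l0).
  by rewrite /s addrC subrK.
have g2 : 0 <= (1 + s) * growth_const d s by apply: mulr_ge0 => //; lra.
have H2 : (1 + s) * growth_const d s * Num.sqrt (Jtot E K (fun x => expR (- l * f x))) <=
   2 * (1 + u) ^+ 2 * (t * (200 / 99) * W) * Num.sqrt R0.
  apply: (@le_trans _ _ ((1 + s) * growth_const d s * ((1 + s) * (2 * l) * Num.sqrt R0))).
    by rewrite ler_wpM2l.
  have -> : (1 + s) * growth_const d s * ((1 + s) * (2 * l) * Num.sqrt R0) =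
     2 * (1 + s) ^+ 2 * (l * growth_const d s) * Num.sqrt R0 by ring.
  rewrite ler_wpM2r ?sqrtr_ge0//.
  apply: ler_pM; [by rewrite mulr_ge0 ?sqr_ge0|by rewrite mulr_ge0// ltW| |exact: gc_le].
  by rewrite ler_wpM2l// lerXn2r ?nnegrE//; lra.
set q := 2 * (1 + u) ^+ 2 * (t * (200 / 99) * W) in H2 Hc.
have H3 : E f * m <= (1 + q) ^+ 2 * R0.
  have : Num.sqrt (E f * m) <= (1 + q) * Num.sqrt R0.
    by apply: le_trans H _; rewrite [leRHS]mulrDl mul1r; exact: lerD (lexx _) H2.
  move=> H4; rewrite -[leLHS]sqr_sqrtr ?mulr_ge0// -(sqr_sqrtr R00) -exprMn.
  rewrite lerXn2r ?nnegrE ?sqrtr_ge0//; exact: le_trans (sqrtr_ge0 _) H4.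
rewrite -mulrA; apply: le_trans (ler_wpM2l (ltW c0) H3) _.
by rewrite mulrA -[leRHS]mul1r ler_wpM2r.
Qed.

End Tau.

Let m t := E (fun x => expR (t * d * f x)).

Let m_gt0 t : 0 < m t.
Proof.
have [c c0 cf] := pos_exp (t * d); apply: lt_le_trans c0 _.
rewrite -[leLHS](E_cst G); apply: (E_le G) => //; first exact: (bm_cst G).
exact: bm_exp.
Qed.

(** Log-convexity of [m] replaces integration of the slope over [[t0, t]] by the slope at the right
    end, which [upper_tilt] bounds. *)
Lemma upper_step t0 t u X W c : 0 < t <= 3 / 20 -> u = t + 7 / 10 * t ^+ 2 ->
  23 / 5 * u <= X * (1 - 3 * u) -> 0 <= X < 16 -> 1 <= W * (1 - X / 16) ^+ 16 ->
  0 < c -> 1 <= c * (1 - 4 * (1 + u) * (t * (200 / 99) * W)) -> t0 <= t ->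
  m t <= m t0 * expR ((t - t0) * c * (d * E f)).
Proof.
move=> tP uE uX XP XW c0 Hc t0t; have /andP[d0 _] := d01.
have H := upper_tilt tP uE uX XP XW c0 Hc; have mt := m_gt0 t; rewrite -/(m t) in H.
have := jensen_exp (t0 * d) (t * d); rewrite -/(m t) -/(m t0).
set r := _ / m t; have rc : r <= c * E f by rewrite ler_pdivrMr.
move=> J1; rewrite -[(t - t0) * c * _]opprK expRN ler_pdivlMr ?expR_gt0//.
apply: le_trans J1; apply: ler_wpM2l; [exact: ltW|rewrite ler_expR].
have -> : (t0 * d - t * d) * r = - ((t - t0) * d * r) by ring.
rewrite lerN2; have -> : (t - t0) * c * (d * E f) = (t - t0) * d * (c * E f) by ring.
by apply: ler_wpM2l => //; apply: mulr_ge0; [rewrite subr_ge0|exact: ltW].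
Qed.

Lemma lower_step t0 t u X W c : 0 < t <= 3 / 20 -> u = t + 7 / 10 * t ^+ 2 ->
  23 / 5 * u <= X * (1 - 3 * u) -> 0 <= X < 16 -> 1 <= W * (1 - X / 16) ^+ 16 ->
  0 < c -> c * (1 + 2 * (1 + u) ^+ 2 * (t * (200 / 99) * W)) ^+ 2 <= 1 -> t0 <= t ->
  m (- t) <= m (- t0) * expR (- ((t - t0) * c * (d * E f))).
Proof.
move=> tP uE uX XP XW c0 Hc t0t; have /andP[d0 _] := d01.
have H := lower_tilt tP uE uX XP XW c0 Hc; have mt := m_gt0 (- t).
rewrite -mulNr -/(m (- t)) in H.
have := jensen_exp (- t0 * d) (- t * d); rewrite -/(m (- t)) -/(m (- t0)).
set r := _ / m (- t); have rc : c * E f <= r by rewrite ler_pdivlMr.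
move=> J1; rewrite expRN ler_pdivlMr ?expR_gt0//.
apply: le_trans J1; apply: ler_wpM2l; [exact: ltW|rewrite ler_expR].
have -> : (- t0 * d - - t * d) * r = (t - t0) * d * r by ring.
have -> : (t - t0) * c * (d * E f) = (t - t0) * d * (c * E f) by ring.
by apply: ler_wpM2l => //; apply: mulr_ge0; [rewrite subr_ge0|exact: ltW].
Qed.

Let m0 : m 0 = 1.
Proof.
rewrite -[RHS](E_cst G); congr E; apply/funext => x.
by rewrite !mul0r expR0.
Qed.

(** [10 / 261] is the constant [1 / 26.1], reached in two equal steps. The slopes [1.211] and
    [1.656] give the exponent [5 / 261 * 2.867 < 0.055]. *)
Lemma upper_bound : m (10 / 261) <= expR (55 / 1000 * (d * E f)).
Proof.
have H1 : m (5 / 261) <= m 0 * expR ((5 / 261 - 0) * (1211 / 1000) * (d * E f)).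
  by apply: (@upper_step _ _ (5 / 261 + 7 / 10 * (5 / 261) ^+ 2) (19 / 200) (11 / 10)); lra.
have H2 : m (10 / 261) <= m (5 / 261) * expR ((10 / 261 - 5 / 261) * (207 / 125) * (d * E f)).
  by apply: (@upper_step _ _ (10 / 261 + 7 / 10 * (10 / 261) ^+ 2) (103 / 500) (1231 / 1000)); lra.
apply: le_trans H2 _; apply: le_trans (ler_wpM2r (expR_ge0 _) H1) _.
rewrite m0 mul1r -expRD ler_expR -mulrDl.
apply: ler_wpM2r; last by lra.
by apply: mulr_ge0 => //; case/andP: d01 => /ltW.
Qed.

(* The grid points [k / 50] and the parameters [X], [W], [c] come from numerical
   optimization of the hypotheses of [lower_step]. *)
Lemma lower_bound : m (- (7 / 50)) <= expR (- (56 / 1000 * (d * E f))).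
Proof.
pose v k : R := k%:R / 50.
have key k X W c : (0 < k <= 7)%N ->
   23 / 5 * (v k + 7 / 10 * v k ^+ 2) <= X * (1 - 3 * (v k + 7 / 10 * v k ^+ 2)) -> 0 <= X < 16 -> 1 <= W * (1 - X / 16) ^+ 16 ->
   0 < c -> c * (1 + 2 * (1 + (v k + 7 / 10 * v k ^+ 2)) ^+ 2 * (v k * (200 / 99) * W)) ^+ 2 <= 1 ->
   m (- v k) <= m (- v k.-1) * expR (- (c / 50 * (d * E f))).
  case: k => // k /= k7.
  have kR : k.+1%:R <= 7 :> R by rewrite ler_nat.
  have k0 : 0 < k.+1%:R :> R by rewrite ltr0n.
  have vv : v k.+1 - v k = 1 / 50 by rewrite /v -mulrBl -[k.+1]add1n natrD addrK.
  have vP : 0 < v k.+1 <= 3 / 20 by rewrite /v; lra.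
  move=> H1 H2 H3 c0 H4; have := lower_step (t0 := v k) vP erefl H1 H2 H3 c0 H4.
  rewrite -subr_ge0 vv mul1r [50^-1 * c]mulrC; apply.
  by rewrite invr_ge0 ler0n.
have H1 : m (- v 1) <= m (- v 0) * expR (- (837 / 1000 / 50 * (d * E f))).
  by apply: (@key 1 (1/10) (553/500)); [by []|rewrite ?/v; lra..].
have H2 : m (- v 2) <= m (- v 1) * expR (- (337 / 500 / 50 * (d * E f))).
  by apply: (@key 2 (27/125) (1243/1000)); [by []|rewrite ?/v; clear H1; lra..].
have H3 : m (- v 3) <= m (- v 2) * expR (- (129 / 250 / 50 * (d * E f))).
  by apply: (@key 3 (177/500) (1431/1000)); [by []|rewrite ?/v; clear H1 H2; lra..].
have H4 : m (- v 4) <= m (- v 3) * expR (- (369 / 1000 / 50 * (d * E f))).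
  by apply: (@key 4 (521/1000) (1699/1000)); [by []|rewrite ?/v; clear H1 H2 H3; lra..].
have H5 : m (- v 5) <= m (- v 4) * expR (- (6 / 25 / 50 * (d * E f))).
  by apply: (@key 5 (29/40) (2101/1000)); [by []|rewrite ?/v; clear H1 H2 H3 H4; lra..].
have H6 : m (- v 6) <= m (- v 5) * expR (- (17 / 125 / 50 * (d * E f))).
  by apply: (@key 6 (491/500) (689/250)); [by []|rewrite ?/v; clear H1 H2 H3 H4 H5; lra..].
have H7 : m (- v 7) <= m (- v 6) * expR (- (63 / 1000 / 50 * (d * E f))).
  by apply: (@key 7 (1313/1000) (492/125)); [by []|rewrite ?/v; clear H1 H2 H3 H4 H5 H6; lra..].
have chain x y z (p q : R) : x <= y * expR p -> y <= z * expR q -> x <= z * expR (q + p).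
  by move=> A B; rewrite expRD mulrA; apply: le_trans A _; rewrite ler_wpM2r ?expR_ge0.
have := chain _ _ _ _ _ H7 (chain _ _ _ _ _ H6 (chain _ _ _ _ _ H5 (chain _ _ _ _ _ H4
  (chain _ _ _ _ _ H3 (chain _ _ _ _ _ H2 H1))))).
rewrite [v 0](_ : _ = 0) ?oppr0 ?m0 ?mul1r; last by rewrite /v mul0r.
(* The seven slopes add up to [2.835], so the exponent is [0.0567] times [d * E f]. *)
move=> H; apply: le_trans H _; rewrite ler_expR.
have : 0 <= d * E f by apply: mulr_ge0 => //; case/andP: d01 => /ltW.
lra.
Qed.

Lemma exp_moments : E (fun x => expR (10 / 261 * d * f x)) *
  E (fun x => expR (- (7 / 50) * d * f x)) <= 1.
Proof.
have H1 := upper_bound; have H2 := lower_bound.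
have dE : 0 <= d * E f by apply: mulr_ge0 => //; case/andP: d01 => /ltW.
apply: le_trans (ler_pM (ltW (m_gt0 _)) (ltW (m_gt0 _)) H1 H2) _.
by rewrite -expRD -[leRHS]expR0 ler_expR; lra.
Qed.

End Tilt.

(** * Integrals of bounded measurable functions *)

Section BoundedMeasurable.
Context d (Y : measurableType d) (R : realType).
Implicit Types (f g : Y -> R).

Definition bounded_measurable f :=
  measurable_fun [set: Y] f /\ exists M, forall x, `|f x| <= M.

Lemma bounded_measurable_cst c : bounded_measurable (fun=> c).
Proof. by split; [exact: measurable_cst|exists `|c|]. Qed.

Lemma bounded_measurableD f g : bounded_measurable f -> bounded_measurable g ->
  bounded_measurable (fun x => f x + g x).
Proof.
move=> [mf [M fM]] [mg [N gN]]; split; first exact: measurable_funD.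
by exists (M + N) => x; apply: le_trans (ler_normD _ _) _; exact: lerD.
Qed.

Lemma bounded_measurableM f g : bounded_measurable f -> bounded_measurable g ->
  bounded_measurable (fun x => f x * g x).
Proof.
move=> [mf [M fM]] [mg [N gN]]; split; first exact: measurable_funM.
by exists (M * N) => x; rewrite normrM; exact: ler_pM.
Qed.

Lemma bounded_measurableZ c f : bounded_measurable f ->
  bounded_measurable (fun x => c * f x).
Proof. by move=> bf; apply: bounded_measurableM bf; exact: bounded_measurable_cst. Qed.

Lemma bounded_measurable_sum (I : Type) (s : seq I) (h : I -> Y -> R) :
  (forall i, bounded_measurable (h i)) ->
  bounded_measurable (fun x => \sum_(i <- s) h i x).
Proof.
move=> bh; elim: s => [|i s IH].
  by under eq_fun do rewrite big_nil; exact: bounded_measurable_cst.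
by under eq_fun do rewrite big_cons; exact: bounded_measurableD.
Qed.

Lemma bounded_measurable_expR f : bounded_measurable f ->
  bounded_measurable (fun x => expR (f x)).
Proof.
move=> [mf [M fM]]; split; first exact: measurableT_comp.
exists (expR M) => x; rewrite ger0_norm ?expR_ge0// ler_expR.
exact: le_trans (ler_norm _) (fM x).
Qed.

Lemma bounded_measurableV f m : bounded_measurable f -> 0 < m ->
  (forall x, m <= f x) -> bounded_measurable (fun x => (f x)^-1).
Proof.
move=> [mf _] m0 fm; have f0 x : 0 < f x by exact: lt_le_trans m0 (fm x).
split; last first.
  by exists m^-1 => x; rewrite ger0_norm ?invr_ge0 ?(ltW (f0 x))// lef_pV2 ?posrE.
(* For positive [f] the reciprocal is [exp (- ln f)], a composition of measurable functions. *)
have -> : (fun x => (f x)^-1) = (fun x => expR (- ln (f x))).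
  by apply/funext => x; rewrite expRN lnK// posrE.
apply: measurableT_comp => //; apply: measurableT_comp => //.
by apply: measurableT_comp => //; exact: measurable_ln.
Qed.

Lemma bounded_measurable_indic (A : set Y) : measurable A ->
  bounded_measurable (\1_A : Y -> R).
Proof.
move=> mA; split; first exact: measurable_indic.
by exists 1 => x; rewrite indicE; case: (x \in A); rewrite ?normr0 ?normr1.
Qed.

Lemma sum_levels_le (y : R) m : 0 <= y -> \sum_(k < m) (k.+1%:R <= y)%R%:R <= y.
Proof.
move=> y0; elim: m => [|m IH]; first by rewrite big_ord0.
rewrite big_ord_recr/=; have [H|_] := boolP (m.+1%:R <= y); last by rewrite addr0.
apply: le_trans H; rewrite -natr1 lerD2r.
apply: (@le_trans _ _ (\sum_(i < m) 1)); last by rewrite sumr_const card_ord.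
by apply: ler_sum => i _; rewrite lern1 leq_b1.
Qed.

Lemma le_sum_levels (y : R) m : y <= m%:R -> y <= \sum_(k < m) (k.+1%:R <= y)%R%:R + 1.
Proof.
elim: m => [|m IH] ym; first by rewrite big_ord0 add0r (le_trans ym).
rewrite big_ord_recr/=; have [H|H] := leP y m%:R.
  by apply: le_trans (IH H) _; rewrite lerD2r lerDl.
apply: le_trans ym _; rewrite -natr1 lerD2r.
apply: (@le_trans _ _ (\sum_(i < m) 1)); first by rewrite sumr_const card_ord.
rewrite -[leLHS]addr0; apply: lerD => //.
apply: ler_sum => i _; rewrite (_ : _ <= y)//; apply: le_trans (ltW H).
by rewrite ler_nat.
Qed.

(** A layer-cake approximation from below, with error [1 / N] for values in [[0, 1]]. It carries
    statements about events, such as total variation bounds and conditional laws, over to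
    functions. *)
Definition staircase N f x : R :=
  N%:R^-1 * \sum_(k < N) (k.+1%:R <= N%:R * f x)%R%:R.

Lemma staircase_le N f x : 0 <= f x -> staircase N f x <= f x.
Proof.
move=> f0; rewrite /staircase; case: N => [|N]; first by rewrite invr0 mul0r.
have N0 : (0 : R) < N.+1%:R by rewrite ltr0n.
by rewrite ler_pdivrMl//; apply: sum_levels_le; rewrite mulr_ge0.
Qed.

Lemma le_staircase N f x : (0 < N)%N -> f x <= 1 -> f x <= staircase N f x + N%:R^-1.
Proof.
move=> N0 f1; rewrite /staircase.
have NR : (0 : R) < N%:R by rewrite ltr0n.
rewrite -[X in _ + X]mulr1 -mulrDr ler_pdivlMl//.
by apply: le_sum_levels; rewrite -[leRHS]mulr1 ler_pM2l.
Qed.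

Lemma measurable_level f (a b : R) : measurable_fun [set: Y] f ->
  measurable [set x | a <= b * f x].
Proof.
move=> mf; rewrite -[X in measurable X]setTI; apply: measurable_fun_le => //.
by apply: measurable_funM.
Qed.

Lemma staircaseE N f : staircase N f = fun x =>
  N%:R^-1 * \sum_(k < N) \1_[set x | k.+1%:R <= N%:R * f x] x.
Proof.
apply/funext => x; congr (_ * _); apply: eq_bigr => k _.
by rewrite indicE; rewrite mem_setE.
Qed.

End BoundedMeasurable.

Section ProbabilityIntegral.
Context d (Y : measurableType d) (R : realType).
Implicit Types (m : probability Y R) (f g : Y -> R).

Lemma bounded_measurable_integrable m f : bounded_measurable f ->
  m.-integrable [set: Y] (EFin \o f).
Proof.
move=> [mf [M fM]]; apply: measurable_bounded_integrable => //.
  by rewrite (le_lt_trans (probability_le1 m measurableT))// ltry.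
exists M; split; first exact: num_real.
by move=> N MN x _ /=; exact: le_trans (fM x) (ltW MN).
Qed.

Lemma prob_integral_cst m (c : R) : (\int[m]_x c)%R = c.
Proof.
rewrite Rintegral_cst// -[RHS]mulr1; congr (_ * _).
exact: (congr1 fine (probability_setT m)).
Qed.

Lemma prob_integralD m f g : bounded_measurable f -> bounded_measurable g ->
  (\int[m]_x (f x + g x) = \int[m]_x f x + \int[m]_x g x)%R.
Proof. by move=> bf bg; apply: RintegralD => //; exact: bounded_measurable_integrable. Qed.

Lemma prob_integralZ m (c : R) f : bounded_measurable f ->
  (\int[m]_x (c * f x) = c * \int[m]_x f x)%R.
Proof. by move=> bf; apply: RintegralZl => //; exact: bounded_measurable_integrable. Qed.

Lemma prob_integral_sum m (I : Type) (s : seq I) (h : I -> Y -> R) :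
  (forall i, bounded_measurable (h i)) ->
  (\int[m]_x (\sum_(i <- s) h i x) = \sum_(i <- s) \int[m]_x h i x)%R.
Proof.
move=> bh; elim: s => [|i s IH].
  by rewrite big_nil; under eq_Rintegral do rewrite big_nil; rewrite prob_integral_cst.
rewrite big_cons -IH -prob_integralD//; last exact: bounded_measurable_sum.
by apply: eq_Rintegral => x _; rewrite big_cons.
Qed.

Lemma le_prob_integral m f g : bounded_measurable f -> bounded_measurable g ->
  (forall x, f x <= g x) -> (\int[m]_x f x <= \int[m]_x g x)%R.
Proof. by move=> bf bg fg; apply: le_Rintegral => //; exact: bounded_measurable_integrable. Qed.

Lemma prob_integral_indic m (A : set Y) : measurable A ->
  (\int[m]_x (\1_A x : R) = fine (m A))%R.
Proof. by move=> mA; rewrite /Rintegral integral_indic// setIT. Qed.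

Lemma prob_integral_staircase m N f : measurable_fun [set: Y] f ->
  (\int[m]_x staircase N f x =
   N%:R^-1 * \sum_(k < N) fine (m [set x | k.+1%:R <= N%:R * f x]))%R.
Proof.
move=> mf; rewrite staircaseE.
have bi k : bounded_measurable (\1_[set x | k.+1%:R <= N%:R * f x] : Y -> R).
  by apply: bounded_measurable_indic; exact: measurable_level.
rewrite prob_integralZ ?prob_integral_sum//; last exact: bounded_measurable_sum.
by congr (_ * _); apply: eq_bigr => k _; rewrite prob_integral_indic//; exact: measurable_level.
Qed.

Lemma bounded_measurable_staircase N f : measurable_fun [set: Y] f ->
  bounded_measurable (staircase N f).
Proof.
move=> mf; rewrite staircaseE; apply: bounded_measurableZ; apply: bounded_measurable_sum => k.
by apply: bounded_measurable_indic; exact: measurable_level.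
Qed.

Lemma le_inv_nat_eps (x y : R) : (forall N, (0 < N)%N -> x <= y + N%:R^-1) -> x <= y.
Proof.
move=> H; rewrite leNgt; apply/negP => yx.
have e0 : 0 < x - y by rewrite subr_gt0.
have := H (Num.truncn (x - y)^-1).+1 isT; apply/negP; rewrite -ltNge -ltrBrDl.
rewrite invf_plt ?posrE//; apply: truncnS_gt.
Qed.

(** After rescaling to [[0, 1]], the integral is up to [1 / N] the average of [N] level-set
    probabilities, and each of these changes by at most [D]. *)
Lemma le_prob_integral_dTV (m1 m2 : probability Y R) (D : R) f (lo hi : R) :
  (dTV m1 m2 <= D%:E)%E ->
  measurable_fun [set: Y] f -> (forall x, lo <= f x <= hi) ->
  (\int[m1]_x f x <= \int[m2]_x f x + D * (hi - lo))%R.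
Proof.
move=> HD mf fb.
have D0 B : measurable B -> fine (m1 B) <= fine (m2 B) + D.
  move=> mB; rewrite -lerBlDl; have : (`|m1 B - m2 B| <= D%:E)%E.
    by apply: le_trans HD; apply: ereal_sup_ubound; exists B.
  rewrite -(fineK (fin_num_measure m1 _ mB)) -(fineK (fin_num_measure m2 _ mB)).
  by rewrite -EFinB lee_fin; apply: le_trans; exact: ler_norm.
have bf : bounded_measurable f.
  split=> //; exists (`|lo| + `|hi|) => x; have /andP[H1 H2] := fb x.
  rewrite ler_norml; apply/andP; split.
    have := ler_norm (- lo); rewrite normrN; have := normr_ge0 hi; lra.
  by have := ler_norm hi; have := normr_ge0 lo; lra.
have [lohi|hilo|eqlh] := ltgtP lo hi; last 2 first.
(* A probability lives on a nonempty type, so the case [hi < lo] is contradictory. *)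
- have [y _] : exists y : Y, True.
    apply: contrapT => H; have /eqP := probability_setT m1.
    rewrite (_ : setT = set0) ?measure0; last first.
      by apply/seteqP; split=> // x _; apply: H; exists x.
    by rewrite eq_sym eqe oner_eq0.
  by have := fb y => /andP[H1 H2]; have := lt_le_trans hilo (le_trans H1 H2); rewrite ltxx.
- have -> : f = fun=> hi by apply/funext => x; apply/eqP; rewrite eq_le -{2}eqlh andbC fb.
  by rewrite !prob_integral_cst eqlh subrr mulr0 addr0.
have w0 : 0 < hi - lo by rewrite subr_gt0.
pose h x := (hi - lo)^-1 * (f x - lo).
have bh : bounded_measurable h.
  by apply: bounded_measurableZ; apply: bounded_measurableD => //; exact: bounded_measurable_cst.
have [mh _] := bh.
have h01 x : 0 <= h x <= 1.
  have /andP[H1 H2] := fb x; rewrite /h mulr_ge0 ?invr_ge0 ?subr_ge0 ?(ltW lohi)//=.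
  by rewrite mulrC ler_pdivrMr// mul1r lerD2r.
have fh : f = fun x => lo + (hi - lo) * h x.
  by apply/funext => y; rewrite /h mulrA divff ?gt_eqF// mul1r addrC subrK.
suff H : (\int[m1]_x h x <= \int[m2]_x h x + D)%R.
  have bc := bounded_measurable_cst Y lo; have bwh := bounded_measurableZ (hi - lo) bh.
  rewrite fh !prob_integralD// !prob_integral_cst (prob_integralZ m1 _ bh) (prob_integralZ m2 _ bh).
  rewrite -addrA lerD2l.
  by rewrite [D * _]mulrC -mulrDr ler_wpM2l// ltW.
apply: le_inv_nat_eps => N N0.
have bs := bounded_measurable_staircase N mh; have bc := bounded_measurable_cst Y (N%:R^-1 : R).
apply: (@le_trans _ _ (\int[m1]_x (staircase N h x + N%:R^-1))%R).
  apply: le_prob_integral => //; first exact: bounded_measurableD.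
  by move=> x; apply: le_staircase => //; case/andP: (h01 x).
rewrite prob_integralD// prob_integral_cst lerD2r.
apply: (@le_trans _ _ ((\int[m2]_x staircase N h x)%R + D)); last first.
  rewrite lerD2r; apply: le_prob_integral => // x.
  by apply: staircase_le; case/andP: (h01 x).
have NR : (0 : R) < N%:R by rewrite ltr0n.
rewrite !prob_integral_staircase// mulrC ler_pdivrMr// mulrDl mulrAC mulVf ?gt_eqF// mul1r.
apply: (@le_trans _ _ (\sum_(k < N) (fine (m2 [set x | k.+1%:R <= N%:R * h x]) + D))).
  by apply: ler_sum => k _; apply: D0; exact: measurable_level.
by rewrite big_split/= sumr_const card_ord mulr_natr.
Qed.

End ProbabilityIntegral.

(** * Resampling a coordinate of a random vector *)

(** The base consists of the preimages of balls with radius [1 / (k + 1)] around the points of a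
    countable dense set. *)
Lemma polish_second_countable (R : realType) (T : topologicalType) :
  polish R T -> @second_countable T.
Proof.
move=> [[D cD dD] [M [f [g [fg gf cf cg _]]]]].
pose U (p : T * nat) : set T := f @^-1` (ball (f p.1) p.2.+1%:R^-1)°.
exists [set U p | p in D `*` setT].
  apply: (@sub_countable _ _ _ (D `*` [set: nat])); first exact: card_image_le.
  exact: countableX.
split=> [_ [p _ <-]|x V xV].
  by apply: open_comp; [move=> y _; exact: cf|exact: open_interior].
have : nbhs (f x) (g @^-1` V) by apply: cg; rewrite fg.
rewrite -nbhs_ballE => -[e /= e0 eV].
pose k := Num.truncn (2 / e); pose r : R := k.+1%:R^-1.
have r0 : 0 < r by rewrite invr_gt0.
have r2 : 0 < r / 2 by rewrite divr_gt0.
have re : r + r / 2 <= e.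
  have : 2 / e < k.+1%:R by exact: truncnS_gt.
  rewrite ltr_pdivrMr// => H.
  have H2 : 2 * r < e by rewrite mulrC -ltr_pdivlMl ?invr_gt0// invrK.
  lra.
have [||y [yx Dy]] := dD (f @^-1` (ball (f x) (r / 2))°).
- by exists x => /=; apply: nbhsx_ballx.
- by apply: open_comp; [move=> y _; exact: cf|exact: open_interior].
have {}yx : ball (f x) (r / 2) (f y) by exact: interior_subset yx.
exists (U (y, k)); first split.
- by exists (y, k).
- rewrite /U/=/interior -nbhs_ballE; exists (r / 2) => //= z xz.
  have -> : k.+1%:R^-1 = r / 2 + r / 2 by rewrite -splitr.
  by apply: ball_triangle xz; exact: ball_sym.
move=> z /interior_subset /= yz; rewrite -[z]fg; apply: eV.
apply: (le_ball re); rewrite addrC; exact: ball_triangle yx yz.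
Qed.

Lemma countable_bigcup_measurable d (T : measurableType d) (U : Type)
    (B : set U) (F : U -> set T) : countable B ->
  (forall b, B b -> measurable (F b)) -> measurable (\bigcup_(b in B) F b).
Proof.
move=> /countable_injP[e einj] mF.
have -> : \bigcup_(b in B) F b = \bigcup_k \bigcup_(b in B `&` [set b | e b = k]) F b.
  apply/seteqP; split=> [x [b Bb Fx]|x [k _ [b [Bb _] Fx]]]; last by exists b.
  by exists (e b) => //; exists b.
apply: bigcupT_measurable => k; have [[b [Bb bk]]|nb] :=
    pselect (exists b, B b /\ e b = k); last first.
  rewrite (_ : _ `&` _ = set0) ?bigcup_set0//.
  by apply/seteqP; split=> // b [Bb bk]; apply: nb; exists b.
rewrite (_ : _ `&` _ = [set b]) ?bigcup_set1; first exact: mF.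
apply/seteqP; split=> [b' [Bb' b'k]|_ ->//].
by apply: einj; rewrite ?inE// b'k.
Qed.

Lemma continuous_borel_measurable (S S' : ptopologicalType) (h : S -> S') :
  continuous h -> measurable_fun setT (h : borel S -> borel S').
Proof.
move=> ch; apply: measurability; first by [].
move=> _ [U oU <-]; rewrite setTI; apply: sub_sigma_algebra.
by apply: open_comp => // x _; exact: ch.
Qed.

Lemma continuous_prod_topology (I : eqType) (K : I -> topologicalType)
    (S : topologicalType) (h : S -> prod_topology K) :
  (forall j, continuous (fun s => h s j)) -> continuous h.
Proof.
move=> ch s; apply/cvg_sup => j; move=> U [V] [[W] oW <-] WfN WU.
apply: filterS WU _; apply: (ch j s W).
by apply: open_nbhs_nbhs.
Qed.

Section Insertion.
Context {n : nat} (L : 'I_n -> ptopologicalType).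
Variable i : 'I_n.

(** The default [point] occurs only at index [i], where [dfwith] overwrites it by [s]. *)
Definition insert_coord (z : omit L i) (s : L i) : prod_topology L :=
  @dfwith 'I_n L (fun j => match boolP (j != i) with
                   | AltTrue h => z (exist _ j h)
                   | AltFalse _ => point
                   end) i s.

Lemma insert_in z s : insert_coord z s i = s.
Proof. exact: dfwithin. Qed.

Lemma insert_out z s j (h : j != i) : insert_coord z s j = z (exist _ j h).
Proof.
rewrite /insert_coord dfwithout; last by rewrite eq_sym.
case: {-}_ / boolP => [h'|/negP//].
by rewrite (bool_irrelevance h h').
Qed.

Lemma insert_drop_in (x : prod_topology L) : insert_coord (drop_coord i x) (x i) = x.
Proof.
apply: functional_extensionality_dep => j; have [->|h] := eqVneq j i.
  by rewrite insert_in.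
by rewrite insert_out.
Qed.

Lemma insert_drop_out (x : prod_topology L) s j : j != i ->
  insert_coord (drop_coord i x) s j = x j.
Proof. by move=> h; rewrite insert_out. Qed.

Lemma drop_coord_continuous : continuous (@drop_coord n L i).
Proof.
apply: (@continuous_prod_topology _ (fun j : {j : 'I_n | j != i} => L (val j))) => j.
exact: (@proj_continuous _ L (val j)).
Qed.

Lemma insert_continuous : continuous (fun p : omit L i * L i => insert_coord p.1 p.2).
Proof.
apply: continuous_prod_topology => j; have [->|h] := eqVneq j i.
  under eq_fun do rewrite insert_in.
  by move=> p; exact: cvg_snd.
under eq_fun do rewrite insert_out.
move=> p; apply: (@continuous_comp _ _ _ fst (fun z : omit L i => z (exist _ j h))).
  exact: cvg_fst.
exact: (@proj_continuous _ (fun j : {j : 'I_n | j != i} => L (val j))).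
Qed.

(* Only the inserted coordinate needs a countable base: the preimage of an open
   [W] is the union over basic open [b] of [slice b `*` b]. *)
Lemma insert_measurable : @second_countable (L i) ->
  measurable_fun setT (fun p : borel (omit L i) * borel (L i) =>
    insert_coord p.1 p.2 : borel (prod_topology L)).
Proof.
move=> [B cB [oB bB]]; apply: measurability; first by [].
move=> _ [W oW <-]; rewrite setTI.
pose slice (b : set (L i)) : set (omit L i) :=
  (~` [set z | exists2 s, b s & ~ W (insert_coord z s)])°.
have -> : (fun p : omit L i * L i => insert_coord p.1 p.2) @^-1` W =
  \bigcup_(b in B) (slice b `*` b).
  apply/seteqP; split=> [[z s] /= Wzs|[z s] [b Bb [/= zb sb]]]; last first.
    by apply: contrapT => nW; apply: (interior_subset zb); exists s.
  have : nbhs (insert_coord z s) W by apply: open_nbhs_nbhs; split.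
  move=> /(@insert_continuous (z, s)) /=.
  case=> -[P Q] /= [zP sQ] PQW; have [b [Bb bs] bQ] := bB s Q sQ.
  exists b => //; split=> //=; rewrite /slice/interior; apply: filterS zP.
  by move=> z' Pz' [s' bs']; apply; apply: (PQW (z', s')); split=> //; exact: bQ.
apply: countable_bigcup_measurable => // b Bb; apply: measurableX.
  by apply: sub_sigma_algebra; exact: open_interior.
by apply: sub_sigma_algebra; exact: oB.
Qed.

End Insertion.

Section Disintegration.
Local Open Scope ereal_scope.
Context d (T : measurableType d) (R : realType) (P : probability T R)
  d1 (T1 : measurableType d1) d2 (T2 : measurableType d2)
  (Y : T -> T1) (Z : T -> T2) (k : R.-pker T2 ~> T1).
Hypotheses (mY : measurable_fun setT Y) (mZ : measurable_fun setT Z).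
Hypothesis kYZ : cond_dist P Y Z k.

Lemma measurable_kernel_xsection (B : set (T2 * T1)) : measurable B ->
  measurable_fun setT (fun w => k (Z w) (xsection B (Z w))).
Proof.
move=> mB; apply: (@measurableT_comp _ _ _ _ _ _ (fun z => k z (xsection B z))) => //.
by apply: measurable_fun_xsection_finite_kernel; rewrite inE.
Qed.

(** [cond_dist] gives the identity on rectangles, which are stable under intersection. The sets
    satisfying it form a Dynkin system. *)
Lemma cond_dist_xsection (B : set (T2 * T1)) : measurable B ->
  \int[P]_w k (Z w) (xsection B (Z w)) = P [set w | B (Z w, Y w)].
Proof.
have mYZ : measurable_fun setT (fun w => (Z w, Y w)) by exact: measurable_fun_pair.
have mP (C : set (T2 * T1)) : measurable C -> measurable [set w | C (Z w, Y w)].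
  by move=> mC; rewrite -[X in measurable X]setTI; exact: mYZ.
have E := @measurable_prod_measurableType _ _ T2 T1.
have rect (A1 : set T2) (A2 : set T1) : measurable A1 -> measurable A2 ->
    \int[P]_w k (Z w) (xsection (A1 `*` A2) (Z w)) = P [set w | (A1 `*` A2) (Z w, Y w)].
  move=> m1 m2; have := kYZ m2 m1; rewrite integral_mkcond => H.
  transitivity (P (Y @^-1` A2 `&` Z @^-1` A1)).
    rewrite H; apply: eq_integral => w _; rewrite patchE.
    have -> : (w \in Z @^-1` A1) = (Z w \in A1) by apply/idP/idP; rewrite !inE.
    have [wA|wA] := boolP (Z w \in A1); first by rewrite in_xsectionX.
    by rewrite notin_xsectionX// measure0.
  by congr (P _); apply/seteqP; split=> w /= [].
move=> mB; move: (mB); rewrite E; 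
apply: (@dynkin_induction _ _ _ [set B | \int[P]_w k (Z w) (xsection B (Z w)) =
  P [set w | B (Z w, Y w)]] E).
- move=> _ _ [A1 mA1 [A2 mA2 <-]] [B1 mB1 [B2 mB2 <-]].
  exists (A1 `&` B1); first exact: measurableI.
  by exists (A2 `&` B2); [exact: measurableI|rewrite setXI].
- by rewrite -setXTT; exact: rect.
- by move=> _ [A1 mA1 [A2 mA2 <-]]; exact: rect.
- move=> S mS IH; have mCS := measurableC mS.
  have fP : P [set w | S (Z w, Y w)] \is a fin_num by apply: fin_num_measure; exact: (mP S).
  (* The quantity for [S] is finite, so it may be added to both sides; with it both sides equal
     [1]. *)
  rewrite /= -[LHS](addeK _ fP) -[RHS](addeK _ fP); congr (_ - _).
  rewrite -[X in _ + X = _]IH -ge0_integralD//; try exact: measurable_kernel_xsection.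
  transitivity (1 : \bar R).
    transitivity (\int[P]_w (1 : \bar R)).
      have xC w : xsection (~` S) (Z w) = ~` xsection S (Z w) by rewrite !xsectionE.
      apply: eq_integral => w _; have mx := measurable_xsection (Z w) mS.
      rewrite -measureU ?xC ?setvU//; [exact: prob_kernel|exact: measurableC|exact: setICl].
    by rewrite integral_cst// mul1e; exact: probability_setT.
  rewrite -measureU; [|exact: (mP (~` S))|exact: (mP S)|]; last first.
    by apply/seteqP; split=> // w [].
  rewrite (_ : _ `|` _ = setT); first by apply: esym; exact: probability_setT.
  by apply/seteqP; split=> // w _ /=; case: (EM (S (Z w, Y w))); [right|left].
- move=> F mF tF IH.
  transitivity (\int[P]_w \sum_(n <oo) k (Z w) (xsection (F n) (Z w))).
    apply: eq_integral => w _; rewrite xsection_bigcup measure_semi_bigcup//.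
    + by move=> n; exact: measurable_xsection.
    + exact: trivIset_xsection.
    + by apply: bigcupT_measurable => n; exact: measurable_xsection.
  rewrite integral_nneseries//; last by move=> n; exact: measurable_kernel_xsection.
  under eq_eseriesr do rewrite IH.
  rewrite -measure_semi_bigcup.
  + by congr (P _); apply/seteqP; split=> w /= [n _ Fn]; exists n.
  + by move=> n; exact: (mP (F n)).
  + move=> i j _ _ [w [/= Fi Fj]]; apply: (tF i j) => //.
    by exists (Z w, Y w).
  + by apply: bigcupT_measurable => n; exact: (mP (F n)).
Qed.

End Disintegration.

Section KernelProbability.
Context d1 d2 (T1 : measurableType d1) (T2 : measurableType d2) (R : realType).
Variables (k : R.-pker T2 ~> T1) (z : T2).

(** A named copy of the measure [k z] that carries the probability structure, so that the integral
    lemmas apply to each conditional law. *)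
Definition kernel_prob : set T1 -> \bar R := k z.

HB.instance Definition _ := Measure.copy kernel_prob (k z).

HB.instance Definition _ :=
  Measure_isProbability.Build _ _ _ kernel_prob (prob_kernel z).

End KernelProbability.

Section Resampling.
Context (R : realType) (n : nat) (L : 'I_n -> ptopologicalType).
Hypothesis scL : forall i, @second_countable (L i).
Context (d : measure_display) (T : measurableType d) (P : probability T R)
    (X : {RV P >-> borel (prod_topology L)})
    (mu_ : forall i, R.-pker (borel (omit L i)) ~> (borel (L i))).
Hypothesis (mu_X : forall i, cond_dist P (fun w => X w i : borel (L i))
                        (fun w => drop_coord i (X w) : borel (omit L i))
                        (mu_ i)).
Variable (A : 'M[R]_n).
Hypothesis (dobA : dobrushin_matrix mu_ A).

Local Notation Om := (prod_topology L).

Local Notation stair := (@staircase _ (borel Om) R).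

Definition adjacent (i : 'I_n) (x y : Om) := forall j, j != i -> x j = y j.

Definition borel_bounded (F : Om -> R) := @bounded_measurable _ (borel Om) R F.

Definition resample i (F : Om -> R) (x : Om) : R :=
  (\int[kernel_prob (mu_ i) (drop_coord i x)]_s F (insert_coord (drop_coord i x) s))%R.

Definition mean (F : Om -> R) : R := (\int[P]_w F (X w))%R.

Lemma bounded_measurable_comp d1 d2 (Y1 : measurableType d1) (Y2 : measurableType d2)
    (h : Y1 -> Y2) (F : Y2 -> R) : measurable_fun setT h ->
  bounded_measurable F -> bounded_measurable (fun y => F (h y)).
Proof.
move=> mh [mF [M FM]]; split; last by exists M.
exact: (@measurableT_comp _ _ _ _ _ _ F).
Qed.

Lemma bounded_X F : borel_bounded F -> bounded_measurable (fun w => F (X w)).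
Proof. by apply: bounded_measurable_comp; exact: measurable_funP. Qed.

Lemma bounded_insert i (z : borel (omit L i)) F : borel_bounded F ->
  @bounded_measurable _ (borel (L i)) R (fun s => F (insert_coord z s)).
Proof.
apply: (@bounded_measurable_comp _ _ (borel (L i)) (borel Om) (insert_coord z)).
exact: (measurable_fun_pair2 z (insert_measurable (scL i))).
Qed.

Lemma adjacent_drop i x y : adjacent i x y -> drop_coord i x = drop_coord i y.
Proof.
move=> xy; apply: functional_extensionality_dep => -[j h]; exact: xy.
Qed.

Lemma insert_adjacent i x s : adjacent i x (insert_coord (drop_coord i x) s).
Proof. by move=> j h; rewrite insert_drop_out. Qed.

Lemma measurable_drop i : measurable_fun setT
  (fun x : borel Om => drop_coord i x : borel (omit L i)).
Proof. by apply: continuous_borel_measurable; exact: drop_coord_continuous. Qed.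

Lemma measurable_coord i : measurable_fun setT (fun x : borel Om => x i : borel (L i)).
Proof. by apply: continuous_borel_measurable; exact: (@proj_continuous _ L i). Qed.

Lemma borel_bounded_resample i F : borel_bounded F -> borel_bounded (resample i F).
Proof.
move=> bF; have [mF [M FM]] := bF.
split; last first.
  exists M => x; have bz := bounded_insert (drop_coord i x) bF.
  rewrite ler_norml; apply/andP; split.
    rewrite -[leLHS](prob_integral_cst (kernel_prob (mu_ i) (drop_coord i x))).
    apply: le_prob_integral => //; first exact: bounded_measurable_cst.
    by move=> s; have := FM (insert_coord (drop_coord i x) s); rewrite ler_norml => /andP[].
  rewrite -[leRHS](prob_integral_cst (kernel_prob (mu_ i) (drop_coord i x))).
  apply: le_prob_integral => //; first exact: bounded_measurable_cst.
  by move=> s; exact: le_trans (ler_norm _) (FM _).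
(* Measurability of kernel integrals is applied to a nonnegative integrand, hence the shift by the
   bound [M]. *)
pose g z : \bar R := (\int[mu_ i z]_s (F (insert_coord z s) + M)%:E)%E.
have mg : measurable_fun [set: borel (omit L i)] g.
  apply: (@measurable_fun_integral_sfinite_kernel _ _ (borel (omit L i)) (borel (L i)) R
    (fun p => (F (insert_coord p.1 p.2) + M)%:E) (mu_ i)).
    by move=> p; rewrite lee_fin -lerBlDr sub0r; have := FM (insert_coord p.1 p.2); rewrite ler_norml => /andP[].
  apply/measurable_EFinP; apply: measurable_funD => //.
  exact: (measurableT_comp mF (insert_measurable (scL i))).
have -> : resample i F = fun x => fine (g (drop_coord i x)) - M.
  apply/funext => x; rewrite /resample.
  have bz := bounded_insert (drop_coord i x) bF.
  have := prob_integralD (kernel_prob (mu_ i) (drop_coord i x)) bz (bounded_measurable_cst _ M).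
  by rewrite prob_integral_cst => H; rewrite -[LHS](addrK M) -H.
apply: measurable_funB => //; apply: measurableT_comp => //.
exact: (measurableT_comp mg (@measurable_drop i)).
Qed.

Lemma resample_const i x F c : (forall y, adjacent i x y -> F y = c) ->
  resample i F x = c.
Proof.
move=> Fc; rewrite /resample; under eq_Rintegral => s _.
  by rewrite Fc; [over|exact: insert_adjacent].
by rewrite prob_integral_cst.
Qed.

Lemma resampleD i F G x : borel_bounded F -> borel_bounded G ->
  resample i (fun y => F y + G y) x = resample i F x + resample i G x.
Proof. by move=> bF bG; apply: prob_integralD; exact: bounded_insert. Qed.

Lemma resampleM i g F x : borel_bounded F ->
  (forall y z, adjacent i y z -> g y = g z) ->
  resample i (fun y => g y * F y) x = g x * resample i F x.
Proof.
move=> bF ig; rewrite /resample -prob_integralZ; last exact: bounded_insert.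
by apply: eq_Rintegral => s _; rewrite (ig x _ (insert_adjacent x s)).
Qed.

Lemma le_resample i F G x : borel_bounded F -> borel_bounded G ->
  (forall y, F y <= G y) -> resample i F x <= resample i G x.
Proof. by move=> bF bG FG; apply: le_prob_integral => //; exact: bounded_insert. Qed.

Lemma meanD F G : borel_bounded F -> borel_bounded G ->
  mean (fun y => F y + G y) = mean F + mean G.
Proof. by move=> bF bG; apply: prob_integralD; exact: bounded_X. Qed.

Lemma meanZ c F : borel_bounded F -> mean (fun y => c * F y) = c * mean F.
Proof. by move=> bF; apply: prob_integralZ; exact: bounded_X. Qed.

Lemma le_mean F G : borel_bounded F -> borel_bounded G ->
  (forall y, F y <= G y) -> mean F <= mean G.
Proof. by move=> bF bG FG; apply: le_prob_integral => //; exact: bounded_X. Qed.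

Lemma mean_sum m (h : 'I_m -> Om -> R) : (forall k, borel_bounded (h k)) ->
  mean (fun x => \sum_(k < m) h k x) = \sum_(k < m) mean (h k).
Proof. by move=> bh; apply: prob_integral_sum => k; exact: bounded_X. Qed.

Lemma resample_sum i x m (h : 'I_m -> Om -> R) : (forall k, borel_bounded (h k)) ->
  resample i (fun x => \sum_(k < m) h k x) x = \sum_(k < m) resample i (h k) x.
Proof. by move=> bh; apply: prob_integral_sum => k; exact: bounded_insert. Qed.

(** Pull [B] back to pairs of remaining coordinates and inserted value. Its section has the
    conditional probability that is integrated, and inserting the true coordinate gives [X] back. *)
Lemma mean_resample_indic i (B : set (borel Om)) : measurable B ->
  mean (resample i \1_B) = mean \1_B.
Proof.
move=> mB; pose B' := (fun p : borel (omit L i) * borel (L i) =>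
  insert_coord p.1 p.2) @^-1` B.
have mB' : measurable B'.
  by rewrite -[B']setTI; exact: (insert_measurable (scL i)).
have mX : measurable_fun setT X by exact: measurable_funP.
have mXB : measurable [set w | B (X w)] by rewrite -[X in measurable X]setTI; exact: mX.
have indX F : F =1 (\1_B : Om -> R) -> (\int[P]_w F (X w))%R = fine (P [set w | B (X w)]).
  move=> FB; rewrite -prob_integral_indic//; apply: eq_Rintegral => w _.
  by rewrite FB !indicE; congr (nat_of_bool _)%:R; apply/idP/idP; rewrite !inE.
rewrite [RHS]indX//.
have := cond_dist_xsection (measurableT_comp (@measurable_coord i) mX)
  (measurableT_comp (@measurable_drop i) mX) (@mu_X i) mB'.
rewrite (_ : [set w | _] = [set w | B (X w)]); last first.
  by apply/seteqP; split=> w; rewrite /B'/= insert_drop_in.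
move=> <-; rewrite /mean /Rintegral; congr fine; apply: eq_integral => w _.
rewrite /resample; set z := drop_coord i (X w).
have mx : measurable (xsection B' z) by exact: measurable_xsection.
rewrite -[RHS]fineK; last exact: (fin_num_measure (kernel_prob (mu_ i) z)).
congr (_%:E); rewrite -(prob_integral_indic (kernel_prob (mu_ i) z))//.
apply: eq_Rintegral => s _; rewrite !indicE; congr (nat_of_bool _)%:R.
by rewrite mem_xsection; apply/idP/idP; rewrite !inE.
Qed.

Lemma mean_resample_staircase i N F : borel_bounded F ->
  mean (resample i (stair N F)) = mean (stair N F).
Proof.
move=> [mF _]; pose I (k : 'I_N) : Om -> R := \1_[set x | k.+1%:R <= N%:R * F x].
have -> : stair N F = fun x => N%:R^-1 * \sum_(k < N) I k x.
  exact: staircaseE.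
have mI (k : 'I_N) : measurable ([set x | k.+1%:R <= N%:R * F x] : set (borel Om)).
  exact: measurable_level.
have bi k : borel_bounded (I k) by exact: bounded_measurable_indic.
have bs : borel_bounded (fun x => \sum_(k < N) I k x).
  exact: (@bounded_measurable_sum _ (borel Om) R _ _ I).
rewrite meanZ// mean_sum//.
have -> : resample i (fun x => N%:R^-1 * \sum_(k < N) I k x) =
  fun x => N%:R^-1 * \sum_(k < N) resample i (I k) x.
  apply/funext => x; rewrite (@resampleM _ (fun=> N%:R^-1) (fun x => \sum_(k < N) I k x))//.
  by rewrite resample_sum.
have bK k : borel_bounded (resample i (I k)) by exact: borel_bounded_resample.
rewrite meanZ; last exact: (@bounded_measurable_sum _ (borel Om) R _ _ (fun k => resample i (I k))).
rewrite (@mean_sum N (fun k => resample i (I k)))//; congr (_ * _).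
by apply: eq_bigr => k _; exact: mean_resample_indic.
Qed.

(** After rescaling to [[0, 1]], the identity for staircases passes to [h]: both sides are monotone
    and lie within [1 / N] of their staircase values. *)
Lemma mean_resample i F : borel_bounded F -> mean (resample i F) = mean F.
Proof.
move=> bF; have [mF [M0 FM0]] := bF.
pose M := `|M0| + 1; have M_gt0 : 0 < M by rewrite ltr_pwDr.
have FM x : `|F x| <= M.
  by apply: le_trans (FM0 x) _; apply: le_trans (ler_norm _) _; rewrite lerDl.
pose h x := (M + M)^-1 * (F x + M).
have M2 : 0 < M + M by exact: addr_gt0.
have bF' : borel_bounded (fun x => F x + M).
  by apply: bounded_measurableD => //; exact: bounded_measurable_cst.
have bh : borel_bounded h by exact: bounded_measurableZ.
have h01 x : 0 <= h x <= 1.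
  have := FM x; rewrite ler_norml => /andP[H1 H2]; rewrite /h.
  rewrite mulr_ge0 ?invr_ge0 ?(ltW M2)//=; last by rewrite -lerBlDr sub0r.
  by rewrite ler_pdivrMl// mulr1 lerD2r.
have Fh : F = fun x => (M + M) * h x + (- M).
  by apply/funext => x; rewrite /h mulrA divff ?gt_eqF// mul1r addrK.
have bc c : borel_bounded (fun=> c) by exact: bounded_measurable_cst.
have bMh : borel_bounded (fun x => (M + M) * h x) by exact: bounded_measurableZ.
suff H : mean (resample i h) = mean h.
  have mc c : mean (fun=> c) = c by exact: prob_integral_cst.
  rewrite Fh; have -> : resample i (fun x => (M + M) * h x + - M) =
     fun x => (M + M) * resample i h x + (- M).
    apply/funext => x; rewrite resampleD// (resampleM _ bh)//.
    by rewrite (@resample_const _ _ (fun=> - M) (- M)).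
  have bKh := borel_bounded_resample i bh.
  by rewrite !meanD// ?(meanZ _ bKh) ?(meanZ _ bh) ?mc ?H//; exact: bounded_measurableZ.
have key N : (0 < N)%N -> mean h <= mean (stair N h) + N%:R^-1 /\
    mean (resample i h) <= mean (resample i (stair N h)) + N%:R^-1.
  move=> N0; have [mh _] := bh.
  have bs : borel_bounded (stair N h) by exact: bounded_measurable_staircase.
  have bsN : borel_bounded (fun x => stair N h x + N%:R^-1).
    by apply: bounded_measurableD => //; exact: bounded_measurable_cst.
  have hs x : h x <= stair N h x + N%:R^-1.
    by apply: le_staircase => //; case/andP: (h01 x).
  have mc c : mean (fun=> c) = c by exact: prob_integral_cst.
  split.
    by apply: le_trans (le_mean bh bsN hs) _; rewrite meanD// mc.
  apply: (@le_trans _ _ (mean (fun x => resample i (stair N h) x + N%:R^-1))).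
    have bKs := borel_bounded_resample i bs.
    apply: le_mean; [exact: borel_bounded_resample|exact: (bounded_measurableD bKs (bc _))|].
    move=> x; apply: le_trans (le_resample i x bh bsN hs) _.
    by rewrite resampleD// (@resample_const _ _ (fun=> N%:R^-1) (N%:R^-1)).
  by rewrite meanD ?mc//; exact: borel_bounded_resample.
have hs N x : stair N h x <= h x.
  by apply: staircase_le; case/andP: (h01 x).
have bs N : borel_bounded (stair N h).
  by apply: bounded_measurable_staircase; case: bh.
apply/eqP; rewrite eq_le; apply/andP; split; apply: le_inv_nat_eps => N N0.
  have [_ H] := key N N0; apply: le_trans H _; rewrite lerD2r mean_resample_staircase//.
  exact: le_mean.
have [H _] := key N N0; apply: le_trans H _; rewrite lerD2r -(mean_resample_staircase i N bh).
apply: le_mean; [exact: borel_bounded_resample|exact: borel_bounded_resample|move=> x].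
exact: le_resample.
Qed.

(** First compare [F] with [F'] under the conditional law at [x], then change the law to that at
    [y]. Only coordinate [k] differs, so the Dobrushin sum reduces to one term. *)
Lemma resample_dobrushin j k x y F F' m M : j != k -> adjacent k x y ->
  borel_bounded F -> borel_bounded F' ->
  (forall x' y', adjacent j x x' -> adjacent j y y' -> adjacent k x' y' -> F x' <= F' y') ->
  (forall y', adjacent j y y' -> m <= F' y' <= M) ->
  resample j F x <= resample j F' y + A j k * (M - m).
Proof.
move=> jk xy bF bF' FF' bnd.
apply: (@le_trans _ _ (\int[kernel_prob (mu_ j) (drop_coord j x)]_s
   F' (insert_coord (drop_coord j y) s))%R).
  apply: le_prob_integral; [exact: bounded_insert|exact: bounded_insert|move=> s].
  apply: FF'; [exact: insert_adjacent|exact: insert_adjacent|move=> l lk].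
  have [->|lj] := eqVneq l j; first by rewrite !insert_in.
  by rewrite !insert_drop_out// xy.
apply: le_prob_integral_dTV.
- have [_ _ H] := dobA; apply: le_trans (H j x y) _; rewrite lee_fin.
  have [A0 _ _] := dobA.
  rewrite (bigD1 k) 1?eq_sym//= big1 ?addr0.
    by rewrite ler_piMr// lern1 leq_b1.
  by move=> l /andP[_ lk]; rewrite xy// eqxx mulr0.
- by case: (bounded_insert (drop_coord j y) bF').
- by move=> s; apply: bnd; exact: insert_adjacent.
Qed.

Lemma gibbs_resample :
  gibbs adjacent borel_bounded mean resample (fun i j => A i j).
Proof.
split.
- by move=> i x j _.
- by move=> i x y xy j ji; rewrite xy.
- by move=> i x y z xy yz j ji; rewrite xy// yz.
- move=> i j x y z xy yz; exists (insert_coord (drop_coord i x) (z i)).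
    exact: insert_adjacent.
  move=> l lj; have [->|li] := eqVneq l i; first by rewrite insert_in.
  by rewrite insert_drop_out// xy// yz.
- by move=> c; exact: bounded_measurable_cst.
- by move=> F G; exact: bounded_measurableD.
- by move=> F G; exact: bounded_measurableM.
- by move=> F m; exact: bounded_measurableV.
- by move=> F; exact: bounded_measurable_expR.
- by move=> i F; exact: borel_bounded_resample.
- by move=> F [].
- by move=> c; exact: prob_integral_cst.
- exact: meanD.
- exact: meanZ.
- by move=> F bF F0; exact: Rintegral_ge0.
- by move=> i F G x; exact: resampleD.
- by move=> i g F x bg; exact: resampleM.
- move=> i F x c bF Fc.
  rewrite -[leRHS](prob_integral_cst (kernel_prob (mu_ i) (drop_coord i x))).
  apply: le_prob_integral; [exact: bounded_insert|exact: bounded_measurable_cst|move=> s].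
  by apply: Fc; exact: insert_adjacent.
- by move=> i F bF x y xy; rewrite /resample (adjacent_drop xy).
- exact: mean_resample.
- by move=> j k x y F F' m M; exact: resample_dobrushin.
Qed.

Lemma adjacent_path x y : exists z : nat -> Om,
  [/\ z 0%N = x, z n = y & forall i : 'I_n, adjacent i (z i) (z i.+1)].
Proof.
exists (fun k (j : 'I_n) => if (j < k)%N then y j else x j); split.
- by [].
- by apply: functional_extensionality_dep => j; rewrite ltn_ord.
- move=> i j; rewrite -val_eqE => /negbTE ji.
  by rewrite (ltnS j i) (leq_eqVlt j i) ji.
Qed.

End Resampling.

(** * Convex distance *)

Section ConvexDistance.
Context (R : realType) (n : nat) (L : 'I_n -> ptopologicalType).
Local Notation Om := (prod_topology L).
Implicit Types (c : 'rV[R]_n) (x y : Om) (K S : set Om) (C : set 'rV[R]_n).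

Definition unit_weights : set 'rV[R]_n :=
  [set c | (forall i, 0 <= c 0 i) /\ Num.sqrt (\sum_(i < n) c 0 i ^+ 2) = 1].

(** [convex_dist] is, by conversion, the case [unit_weights]. The case [weights_off i] is
    insensitive to coordinate [i] and supplies the functions [b i]. *)
Definition partial_dist C x K : R := sup [set weighted_hamming_set c x K | c in C].

Lemma unit_weights_sum c : unit_weights c -> \sum_(i < n) c 0 i ^+ 2 = 1.
Proof.
move=> [_ c1]; have s0 : 0 <= \sum_(i < n) c 0 i ^+ 2.
  by apply: sumr_ge0 => i _; exact: sqr_ge0.
by rewrite -[LHS]sqr_sqrtr// c1 expr1n.
Qed.

Lemma unit_weights_le1 c i : unit_weights c -> c 0 i <= 1.
Proof.
move=> uc; have [c0 _] := uc; rewrite -(@ler_pXn2r _ 2) ?nnegrE//.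
rewrite expr1n -(unit_weights_sum uc) (bigD1 i)//= lerDl.
by apply: sumr_ge0 => j _; exact: sqr_ge0.
Qed.

Lemma weighted_hamming_ge0 c x y : (forall i, 0 <= c 0 i) -> 0 <= weighted_hamming c x y.
Proof. by move=> c0; apply: sumr_ge0 => i _; rewrite mulr_ge0. Qed.

Lemma weighted_hamming_le c x y : unit_weights c -> weighted_hamming c x y <= n%:R.
Proof.
move=> uc; have [c0 _] := uc.
apply: (@le_trans _ _ (\sum_(i < n) 1)); last by rewrite sumr_const card_ord.
apply: ler_sum => i _; apply: mulr_ile1 => //; first exact: unit_weights_le1.
by rewrite lern1 leq_b1.
Qed.

Lemma has_inf_hamming c x K : (forall i, 0 <= c 0 i) -> K !=set0 ->
  has_inf [set weighted_hamming c x y | y in K].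
Proof.
move=> c0 [y Ky]; split; first by exists (weighted_hamming c x y); exists y.
by exists 0 => _ [z _ <-]; exact: weighted_hamming_ge0.
Qed.

Lemma whs_le c x y K : (forall i, 0 <= c 0 i) -> K y ->
  weighted_hamming_set c x K <= weighted_hamming c x y.
Proof.
move=> c0 Ky; apply: ge_inf; last by exists y.
by have [] := @has_inf_hamming c x K c0 (ex_intro _ y Ky).
Qed.

Lemma le_whs c x K (r : R) : K !=set0 -> (forall y, K y -> r <= weighted_hamming c x y) ->
  r <= weighted_hamming_set c x K.
Proof.
move=> [y Ky] H; apply: lb_le_inf; first by exists (weighted_hamming c x y); exists y.
by move=> _ [z Kz <-]; exact: H.
Qed.

Lemma whs_ge0 c x K : (forall i, 0 <= c 0 i) -> K !=set0 ->
  0 <= weighted_hamming_set c x K.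
Proof. by move=> c0 K0; apply: le_whs => // y _; exact: weighted_hamming_ge0. Qed.

Lemma whs_bound c x K : unit_weights c -> K !=set0 -> weighted_hamming_set c x K <= n%:R.
Proof.
move=> uc [y Ky]; have [c0 _] := uc.
exact: le_trans (whs_le x c0 Ky) (weighted_hamming_le _ _ uc).
Qed.

Lemma whs_le_partial C c x K : C `<=` unit_weights -> K !=set0 -> C c ->
  weighted_hamming_set c x K <= partial_dist C x K.
Proof.
move=> CU K0 Cc; apply: ub_le_sup; last by exists c.
by exists n%:R => _ [c' Cc' <-]; apply: whs_bound => //; exact: CU.
Qed.

(** The condition [0 <= r] covers the empty [C], where the supremum takes its default value [0]. *)
Lemma partial_le C x K (r : R) : 0 <= r ->
  (forall c, C c -> weighted_hamming_set c x K <= r) -> partial_dist C x K <= r.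
Proof.
move=> r0 H; case: (pselect (C !=set0)) => [[c Cc]|nC].
  apply: ge_sup; first by exists (weighted_hamming_set c x K); exists c.
  by move=> _ [c' Cc' <-]; exact: H.
rewrite /partial_dist (_ : [set _ | _ in _] = set0) ?sup0//.
by apply/seteqP; split=> // s [c Cc _]; apply: nC; exists c.
Qed.

Lemma partial_ge0 C x K : C `<=` unit_weights -> K !=set0 -> 0 <= partial_dist C x K.
Proof.
move=> CU K0; case: (pselect (C !=set0)) => [[c Cc]|nC].
  apply: le_trans (whs_le_partial x CU K0 Cc); apply: whs_ge0 => //.
  by have [] := CU _ Cc.
rewrite /partial_dist (_ : [set _ | _ in _] = set0) ?sup0//.
by apply/seteqP; split=> // s [c Cc _]; apply: nC; exists c.
Qed.

Lemma partial_bound C x K : C `<=` unit_weights -> K !=set0 -> partial_dist C x K <= n%:R.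
Proof. by move=> CU K0; apply: partial_le => // c Cc; apply: whs_bound => //; exact: CU. Qed.

Lemma partial_mono C C' x K : C `<=` C' -> C' `<=` unit_weights -> K !=set0 ->
  partial_dist C x K <= partial_dist C' x K.
Proof.
move=> CC' C'U K0; apply: partial_le; first exact: partial_ge0.
by move=> c Cc; apply: whs_le_partial => //; exact: CC'.
Qed.

Lemma convex_dist_in x K : K x -> convex_dist x K = 0 :> R.
Proof.
move=> Kx; have K0 : K !=set0 by exists x.
apply/eqP; rewrite eq_le; apply/andP; split; last exact: (@partial_ge0 unit_weights).
apply: (@partial_le unit_weights) => // c [c0 _]; apply: le_trans (whs_le x c0 Kx) _.
by rewrite /weighted_hamming big1// => i _; rewrite eqxx mulr0.
Qed.

Lemma convex_dist_anti x K S : K !=set0 -> K `<=` S ->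
  convex_dist x S <= convex_dist x K :> R.
Proof.
move=> K0 KS; apply: (@partial_le unit_weights); first exact: (@partial_ge0 unit_weights).
move=> c uc; apply: le_trans (whs_le_partial x (@subset_refl _ _) K0 uc).
apply: le_whs => // y Ky; apply: whs_le; [by case: uc|exact: KS].
Qed.

Section FixedCoordinate.
Variables (K : set Om) (K0 : K !=set0) (i : 'I_n).

(** For [n = 1] this set is empty, and the restricted distance is then [0]. *)
Definition weights_off : set 'rV[R]_n := unit_weights `&` [set c | c 0 i = 0].

Lemma weights_off_sub : weights_off `<=` unit_weights. Proof. by move=> c []. Qed.

Local Notation Di x := (partial_dist weights_off x K).

Lemma partial_dist_ind x y : (forall j, j != i -> x j = y j) -> Di x = Di y.
Proof.
move=> xy; congr sup; apply/seteqP; split=> [_ [c [uc ci] <-]|_ [c [uc ci] <-]];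
  exists c => //; congr inf; apply/seteqP; split=> [_ [z Kz <-]|_ [z Kz <-]];
  exists z => //; apply: eq_bigr => j _;
  by have [->|/xy ->] := eqVneq j i; rewrite ?ci ?mul0r.
Qed.

(** Dropping coordinate [i] from [c] lowers the distance by at most [c_i]. The remaining weights
    have norm [sqrt (1 - c_i^2)] and are renormalized, unless this norm vanishes. *)
Lemma whs_split c x : unit_weights c ->
  weighted_hamming_set c x K <= c 0 i + Num.sqrt (1 - c 0 i ^+ 2) * Di x.
Proof.
move=> uc; have [c0 _] := uc; have c1 := unit_weights_le1 i uc.
have s1 := unit_weights_sum uc.
pose c' : 'rV[R]_n := \row_j (if j == i then 0 else c 0 j).
have c'0 j : 0 <= c' 0 j by rewrite mxE; case: ifP.
have sc' : \sum_(j < n) c' 0 j ^+ 2 = 1 - c 0 i ^+ 2.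
  rewrite -s1 (bigD1 i)//= [X in _ = X - _](bigD1 i)//= mxE eqxx expr0n/= add0r.
  rewrite [c 0 i ^+ 2 + _]addrC addrK; apply: eq_bigr => j /negbTE ji.
  by rewrite mxE ji.
have H : weighted_hamming_set c x K <= c 0 i + weighted_hamming_set c' x K.
  rewrite -lerBlDl; apply: le_whs => // y Ky; rewrite lerBlDl.
  apply: le_trans (whs_le x c0 Ky) _; rewrite /weighted_hamming.
  rewrite [leLHS](bigD1 i)//= [X in _ <= _ + X](bigD1 i)//= mxE eqxx mul0r add0r.
  apply: lerD; first by rewrite ler_piMr// lern1 leq_b1.
  by apply: ler_sum => j /negbTE ji; rewrite mxE ji.
apply: le_trans H _; rewrite lerD2l; set t := Num.sqrt _.
have t0 : 0 <= t by exact: sqrtr_ge0.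
have t2 : t ^+ 2 = 1 - c 0 i ^+ 2.
  by rewrite sqr_sqrtr// subr_ge0 -[leRHS](expr1n _ 2) lerXn2r ?nnegrE.
have := t0; rewrite le_eqVlt => /predU1P[t00|t_gt0].
  have c'00 j : c' 0 j = 0.
    have : \sum_(j < n) c' 0 j ^+ 2 == 0 by rewrite sc' -t2 -t00 expr0n.
    rewrite psumr_eq0; last by move=> k _; exact: sqr_ge0.
    by move=> /allP/(_ j (mem_index_enum _))/=; rewrite sqrf_eq0 => /eqP.
  have [y Ky] := K0; rewrite -t00 mul0r; apply: le_trans (whs_le x c'0 Ky) _.
  by rewrite /weighted_hamming big1// => j _; rewrite c'00 mul0r.
pose e : 'rV[R]_n := t^-1 *: c'.
have e0 j : 0 <= e 0 j by rewrite mxE mulr_ge0// invr_ge0.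
have ue : weights_off e.
  split; last by rewrite /= mxE mxE eqxx mulr0.
  split=> //; under eq_bigr do rewrite mxE exprMn.
  by rewrite -mulr_sumr sc' -t2 -exprMn mulVf ?gt_eqF// expr1n sqrtr1.
rewrite -ler_pdivrMl//; apply: le_trans (whs_le_partial x weights_off_sub K0 ue).
apply: le_whs => // y Ky; rewrite ler_pdivrMl//; apply: le_trans (whs_le x c'0 Ky) _.
rewrite /weighted_hamming mulr_sumr; apply: ler_sum => j _.
by rewrite [e _ _]mxE !mulrA divff ?gt_eqF// mul1r.
Qed.

Lemma partial_dist_le x : Di x <= convex_dist x K.
Proof. by apply: (@partial_mono _ unit_weights) => //; exact: weights_off_sub. Qed.

(** By the Cauchy-Schwarz inequality [c_i + sqrt (1 - c_i^2) * D_i] is at most [sqrt (1 + D_i^2)],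
    whatever [c_i] is. *)
Lemma convex_dist_sqr_le x : convex_dist x K ^+ 2 <= Di x ^+ 2 + 1.
Proof.
have D0 := partial_ge0 x weights_off_sub K0.
have T0 : 0 <= convex_dist x K :> R by exact: (@partial_ge0 unit_weights).
have q0 : 0 <= Di x ^+ 2 + 1 by rewrite addr_ge0 ?sqr_ge0.
suff : convex_dist x K <= Num.sqrt (Di x ^+ 2 + 1).
  by move=> H; rewrite -[leRHS]sqr_sqrtr// lerXn2r ?nnegrE ?sqrtr_ge0.
apply: (@partial_le unit_weights); first exact: sqrtr_ge0.
move=> c uc; apply: le_trans (whs_split x uc) _.
have [c0 _] := uc; have c1 := unit_weights_le1 i uc.
set s := Num.sqrt (1 - _); have s0 : 0 <= s by exact: sqrtr_ge0.
have s2 : s ^+ 2 = 1 - c 0 i ^+ 2.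
  by rewrite sqr_sqrtr// subr_ge0 -[leRHS](expr1n _ 2) lerXn2r ?nnegrE.
have l0 : 0 <= c 0 i + s * Di x by rewrite addr_ge0 ?mulr_ge0.
rewrite -[leLHS](ger0_norm l0) -sqrtr_sqr ler_wsqrtr//.
have := sqr_ge0 (c 0 i * Di x - s); move: s2; move: (c 0 i) (Di x) => a b s2.
have -> : (a * b - s) ^+ 2 = a ^+ 2 * b ^+ 2 - 2 * (a * b * s) + s ^+ 2 by ring.
have -> : (a + s * b) ^+ 2 = a ^+ 2 + 2 * (a * b * s) + s ^+ 2 * b ^+ 2 by ring.
rewrite s2; lra.
Qed.

End FixedCoordinate.

(** One nearly optimal [c] works for all [i]: by [whs_split], [D - D_i <= c_i + e], hence
    [D^2 - D_i^2 <= 2 * D * (c_i + e)]. The squares [c_i^2] add up to [1]; then [e] tends to [0], so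
    no maximizer is required. *)
Lemma sum_sqr_partial_dist x K : (0 < n)%N -> K !=set0 ->
  \sum_(i < n) (convex_dist x K ^+ 2 - partial_dist (weights_off i) x K ^+ 2) ^+ 2 <=
  4 * convex_dist x K ^+ 2 :> R.
Proof.
move=> n0 K0; set D := convex_dist x K.
have D0 : 0 <= D by exact: (@partial_ge0 unit_weights).
have key e : 0 < e -> e <= 1 ->
  \sum_(i < n) (D ^+ 2 - partial_dist (weights_off i) x K ^+ 2) ^+ 2 <=
  4 * D ^+ 2 * (1 + 3 * n%:R * e).
  move=> e0 e1.
  have ne : [set weighted_hamming_set c x K | c in unit_weights] !=set0.
    pose c : 'rV[R]_n := \row_j (j == Ordinal n0)%:R.
    exists (weighted_hamming_set c x K); exists c => //; split.
      by move=> j; rewrite mxE.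
    rewrite (bigD1 (Ordinal n0))//= big1 ?addr0.
      by rewrite mxE eqxx expr1n sqrtr1.
    by move=> j /negbTE h; rewrite mxE h expr0n.
  have hs : has_sup [set weighted_hamming_set c x K | c in unit_weights].
    by split=> //; exists n%:R => _ [c uc <-]; exact: whs_bound.
  have [_ [c uc <-] ec] := sup_adherent e0 hs.
  have [c0 _] := uc.
  apply: (@le_trans _ _ (\sum_(i < n) 4 * D ^+ 2 * (c 0 i + e) ^+ 2)).
    apply: ler_sum => i _; set Di := partial_dist _ x K.
    have Di0 : 0 <= Di by apply: partial_ge0 => //; exact: weights_off_sub.
    have DiD : Di <= D by exact: partial_dist_le.
    have H : D - Di <= c 0 i + e.
      have := whs_split K0 i x uc; rewrite -/Di.
      have : Num.sqrt (1 - c 0 i ^+ 2) * Di <= Di.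
        rewrite ler_piMl// -[leRHS]sqrtr1 ler_wsqrtr// lerBlDr lerDl; exact: sqr_ge0.
      by move: ec; rewrite -/(convex_dist x K) -/D; lra.
    have -> : D ^+ 2 - Di ^+ 2 = (D - Di) * (D + Di) by ring.
    rewrite exprMn mulrC; apply: ler_pM; rewrite ?sqr_ge0//.
      have -> : 4 * D ^+ 2 = (2 * D) ^+ 2 by ring.
      by rewrite lerXn2r ?nnegrE//; lra.
    by rewrite lerXn2r ?nnegrE//; lra.
  rewrite -mulr_sumr ler_wpM2l//; first by rewrite mulr_ge0// sqr_ge0.
  rewrite -[X in _ <= X + _](unit_weights_sum uc).
  have -> : 3 * n%:R * e = \sum_(i < n) 3 * e :> R.
    by rewrite sumr_const card_ord -mulr_natr; ring.
  rewrite -big_split/=; apply: ler_sum => i _.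
  have := unit_weights_le1 i uc; have := c0 i; move: (c 0 i) => a a0 a1.
  have : a * e <= e by rewrite ler_piMl// ltW.
  have : e ^+ 2 <= e by rewrite expr2 ler_piMl// ltW.
  have -> : (a + e) ^+ 2 = a ^+ 2 + 2 * (a * e) + e ^+ 2 by ring.
  lra.
apply/ler_addgt0Pr => eps eps0.
pose q := 4 * D ^+ 2 * (3 * n%:R); have q0 : 0 <= q.
  by apply: mulr_ge0; apply: mulr_ge0 => //; exact: sqr_ge0.
pose e := Num.min 1 (eps / (q + 1)).
have q1 : 0 < q + 1 by exact: ltr_wpDl.
have e0 : 0 < e by rewrite lt_min ltr01 divr_gt0.
have e1 : e <= 1 by rewrite ge_min lexx.
apply: le_trans (key e e0 e1) _; rewrite mulrDr mulr1 lerD2l mulrA -/q.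
apply: (@le_trans _ _ ((q + 1) * e)); first by apply: ler_wpM2r; [exact: ltW|rewrite lerDl].
rewrite -ler_pdivlMl// mulrC; by rewrite ge_min lexx orbT.
Qed.

End ConvexDistance.

(** * Borel measurability of the distances to a compact set *)

Section ConvexDistanceMeasurable.
Context (R : realType) (n : nat) (L : 'I_n -> ptopologicalType).
Local Notation Om := (prod_topology L).
Hypothesis hausL : forall i, hausdorff_space (L i).
Variables (K : set Om) (K0 : K !=set0) (cK : compact K).

Let reset (D : {set 'I_n}) (x : Om) : Om := fun i => if i \in D then point else x i.

Let reset_continuous D : continuous (reset D).
Proof.
apply: continuous_prod_topology => j; rewrite /reset; case: (j \in D).
  by move=> x; exact: cvg_cst.
exact: (@proj_continuous _ L j).
Qed.

(** [reset D] erases the coordinates in [D]. The set is the preimage under this continuous map of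
    the image of [K], which is compact and therefore closed. *)
Lemma closed_cylinder_hull (D : {set 'I_n}) :
  closed [set x : Om | exists2 y, K y & forall i, i \notin D -> x i = y i].
Proof.
have -> : [set x : Om | exists2 y, K y & forall i, i \notin D -> x i = y i] =
  reset D @^-1` (reset D @` K).
  apply/seteqP; split=> x /= [y Ky xy]; exists y => //.
    apply: functional_extensionality_dep => i; rewrite /reset.
    by case: (boolP (i \in D)) => // iD; rewrite xy.
  move=> i iD; have := congr1 (fun z : Om => z i) xy; rewrite /reset.
  by rewrite (negbTE iD).
apply: closed_comp; first by move=> x _; exact: reset_continuous.
apply: compact_closed; first exact: hausdorff_product.
apply: continuous_compact => //; apply: continuous_subspaceT; exact: reset_continuous.
Qed.

(** The weighted distance of [x] and [y] depends only on the set [D] of coordinates where they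
    differ. There are finitely many such sets, so the sublevel set is an intersection of finite
    unions of closed sets. *)
Lemma closed_whs_le (c : 'rV[R]_n) (r : R) : (forall i, 0 <= c 0 i) ->
  closed [set x : Om | weighted_hamming_set c x K <= r].
Proof.
move=> c0.
have -> : [set x : Om | weighted_hamming_set c x K <= r] =
  \bigcap_(e in [set e : R | 0 < e]) \bigcup_(D in [set D : {set 'I_n} | \sum_(i in D) c 0 i < r + e])
     [set x : Om | exists2 y, K y & forall i, i \notin D -> x i = y i].
  apply/seteqP; split=> [x /= xr e /= e0|x H].
    have [||_ [y Ky <-] yr] := @inf_lt R [set weighted_hamming c x y | y in K] (r + e).
    + by have [] := has_inf_hamming x c0 K0.
    + by apply: le_lt_trans xr _; rewrite ltrDl.
    exists [set i | x i != y i]%SET => /=.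
      rewrite (le_lt_trans _ yr)// /weighted_hamming big_mkcond/=.
      by apply: ler_sum => i _; rewrite inE; case: (x i != y i); rewrite ?mulr1 ?mulr0.
    by exists y => // i; rewrite inE negbK => /eqP.
  rewrite /=; apply/ler_addgt0Pr => e e0; have [D /= De [y Ky xy]] := H e e0.
  apply: le_trans (whs_le x c0 Ky) _; apply: le_trans (ltW De).
  rewrite /weighted_hamming [leRHS]big_mkcond/=; apply: ler_sum => i _.
  case: (boolP (i \in D)) => [_|/xy ->]; last by rewrite eqxx mulr0.
  by rewrite ler_piMr// lern1 leq_b1.
apply: closed_bigI => e _; apply: closed_bigcup => [|D _].
  exact: finite_finset.
exact: closed_cylinder_hull.
Qed.

(** A sublevel set of the supremum is an intersection of closed sets, hence closed, although
    uncountably many weights occur. *)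
Lemma measurable_partial_dist (C : set 'rV[R]_n) : C `<=` @unit_weights R n ->
  measurable_fun setT (fun x : borel Om => partial_dist C x K).
Proof.
move=> CU; apply: (measurability _ (RGenOInfty.measurableE R)).
move=> _ [_ [r ->] <-]; rewrite setTI.
have -> : (fun x : borel Om => partial_dist C x K) @^-1` `]r, +oo[ =
  ~` [set x : Om | partial_dist C x K <= r].
  by apply/seteqP; split=> x /=; rewrite in_itv/= andbT ltNge => /negP.
apply: measurableC; have [r0|r0] := leP 0 r; last first.
  rewrite (_ : [set x | _] = set0)//; apply/seteqP; split=> // x /=.
  by rewrite leNgt (lt_le_trans r0)// partial_ge0.
have -> : [set x : Om | partial_dist C x K <= r] =
  \bigcap_(c in C) [set x : Om | weighted_hamming_set c x K <= r].
  apply/seteqP; split=> [x /= H c Cc|x H /=].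
    by apply: le_trans H; exact: whs_le_partial.
  by apply: partial_le.
rewrite -[X in measurable X]setCK; apply: measurableC; apply: sub_sigma_algebra.
rewrite openC; apply: closed_bigI => c Cc; apply: closed_whs_le.
by have [] := CU _ Cc.
Qed.

Lemma borel_bounded_partial_sqr (C : set 'rV[R]_n) : C `<=` @unit_weights R n ->
  borel_bounded (fun x : Om => partial_dist C x K ^+ 2).
Proof.
move=> CU; have bp : borel_bounded (fun x : Om => partial_dist C x K).
  split; first exact: measurable_partial_dist.
  by exists n%:R => x; rewrite ger0_norm ?partial_ge0// partial_bound.
exact: (bounded_measurableM bp bp).
Qed.

End ConvexDistanceMeasurable.

(** * Inner regularity *)

Section SmallSets.
Context d (T : measurableType d) (R : realType) (P : probability T R).

Lemma small_decreasing (F : nat -> set T) (e : R) : (forall k, measurable (F k)) ->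
  nonincreasing_seq F -> \bigcap_k F k = set0 -> 0 < e ->
  exists N, (P (F N) <= e%:E)%E.
Proof.
move=> mF dF F0 e0.
have : P \o F @ \oo --> P (\bigcap_k F k).
  apply: nonincreasing_cvg_mu => //; last exact: bigcapT_measurable.
  exact: le_lt_trans (probability_le1 P (mF 0%N)) (ltry _).
rewrite F0 measure0 => /fine_cvgP[_ /cvgrPdist_le/(_ e e0)][N _ /(_ N (leqnn N))].
rewrite /= sub0r normrN => H; exists N.
rewrite -[leLHS]fineK ?fin_num_measure// lee_fin; exact: le_trans (ler_norm _) H.
Qed.

Lemma small_bigcup (F : nat -> set T) (e : R) : (forall k, measurable (F k)) -> 0 <= e ->
  (forall k, (P (F k) <= (e / (2 ^ k.+1)%:R)%:E)%E) -> (P (\bigcup_k F k) <= e%:E)%E.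
Proof.
move=> mF e0 H; apply: le_trans (epsilon_trick0 xpredT e0).
apply: (@le_trans _ _ (\sum_(k <oo) P (F k))%E).
  by apply: measure_sigma_subadditive => //; exact: bigcupT_measurable.
by apply: lee_nneseries => k.
Qed.

End SmallSets.

Section ClosedRegularity.
Context (S : ptopologicalType) (R : realType).
Context d (T : measurableType d) (P : probability T R).
Variable Y : T -> borel S.
Hypothesis mY : measurable_fun setT Y.
Hypothesis FsigmaS : forall W : set S, open W -> Fsigma W.

Lemma measurable_pre (A : set (borel S)) : measurable A -> measurable (Y @^-1` A).
Proof. by move=> mA; rewrite -[X in measurable X]setTI; exact: mY. Qed.

Lemma closed_borel (F : set S) : closed F -> measurable (F : set (borel S)).
Proof.
move=> cF; rewrite -[F]setCK; apply: measurableC; apply: sub_sigma_algebra.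
by rewrite openC.
Qed.

Definition closed_regular (A : set (borel S)) := forall e : R, 0 < e ->
  exists F : set S, [/\ closed F, F `<=` A & (P (Y @^-1` (A `\` F)) <= e%:E)%E].

Lemma closed_regular_closed (F : set S) : closed F -> closed_regular F.
Proof.
by move=> cF e e0; exists F; split=> //; rewrite setDv preimage_set0 measure0 lee_fin ltW.
Qed.

Lemma closed_regular_choice (A : nat -> set (borel S)) (e : R) : 0 < e ->
  (forall k, closed_regular (A k)) ->
  exists F : nat -> set S, [/\ forall k, closed (F k), forall k, F k `<=` A k &
    forall k, (P (Y @^-1` (A k `\` F k)) <= (e / (2 ^ k.+1)%:R)%:E)%E].
Proof.
move=> e0 rA.
have H k : exists F : set S, [/\ closed F, F `<=` A k &
    (P (Y @^-1` (A k `\` F)) <= (e / (2 ^ k.+1)%:R)%:E)%E].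
  by apply: rA; rewrite divr_gt0// ltr0n expn_gt0.
have [F HF] := choice H.
by exists F; split=> k; have [] := HF k.
Qed.

(** An infinite union of closed sets need not be closed, so it is cut at a finite stage. Half of [e]
    pays for the approximations, half for the tail. *)
Lemma closed_regular_bigcup (A : nat -> set (borel S)) : (forall k, measurable (A k)) ->
  (forall k, closed_regular (A k)) -> closed_regular (\bigcup_k A k).
Proof.
move=> mA rA e e0; have e2 : 0 < e / 2 by rewrite divr_gt0.
have [F [cF FA PF]] := closed_regular_choice e2 rA.
have mF k : measurable (F k : set (borel S)) by exact: closed_borel.
pose G N : set (borel S) := \bigcup_(k in `I_N) F k.
have mG N : measurable (G N) by apply: bigcup_measurable => k _.
have mU : measurable (\bigcup_k F k : set (borel S)) by exact: bigcupT_measurable.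
have [|||N HN] := @small_decreasing _ T R P
   (fun N => Y @^-1` ((\bigcup_k F k) `\` G N)) (e / 2) _ _ _ e2.
- by move=> N; apply: measurable_pre; exact: measurableD.
- move=> N M NM; apply/subsetPset => w [Fw nG]; split=> // -[k /= kN Fk].
  by apply: nG; exists k => //=; exact: leq_trans kN NM.
- apply/seteqP; split=> // w H; have [[k _ Fk] _] := H 0%N I.
  by have [_ []] := H k.+1 I; exists k => /=.
exists (G N); split.
- by apply: closed_bigcup => [|k _]; [exact: finite_II|exact: cF].
- by move=> x [k _ Fk]; exists k => //; exact: FA.
apply: (@le_trans _ _ (P (Y @^-1` (\bigcup_k (A k `\` F k)) `|`
    Y @^-1` ((\bigcup_k F k) `\` G N)))).
  have m1 : measurable (Y @^-1` (\bigcup_k (A k `\` F k))).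
    by apply: measurable_pre; apply: bigcupT_measurable => k; exact: measurableD.
  have m2 : measurable (Y @^-1` ((\bigcup_k F k) `\` G N)).
    by apply: measurable_pre; exact: measurableD.
  apply: le_measure; rewrite ?inE; [|exact: measurableU|].
    by apply: measurable_pre; apply: measurableD => //; exact: bigcupT_measurable.
  move=> w /= [[k _ Aw] nG]; have [Fw|nF] := pselect ((\bigcup_k F k) (Y w)).
    by right.
  by left; exists k => //; split=> // Fw; apply: nF; exists k.
have -> : e%:E = ((e / 2)%:E + (e / 2)%:E)%E by rewrite -EFinD -splitr.
apply: le_trans (measureU2 _ _ _) _.
- by apply: measurable_pre; apply: bigcupT_measurable => k; exact: measurableD.
- by apply: measurable_pre; exact: measurableD.
apply: leeD => //; rewrite preimage_bigcup; apply: small_bigcup => //; last exact: ltW.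
by move=> k; apply: measurable_pre; exact: measurableD.
Qed.

Lemma closed_regular_bigcap (A : nat -> set (borel S)) : (forall k, measurable (A k)) ->
  (forall k, closed_regular (A k)) -> closed_regular (\bigcap_k A k).
Proof.
move=> mA rA e e0; have [F [cF FA PF]] := closed_regular_choice e0 rA.
have mF k : measurable (F k : set (borel S)) by exact: closed_borel.
exists (\bigcap_k F k); split.
- by apply: closed_bigI => k _; exact: cF.
- by move=> x H k _; apply: FA; exact: H.
apply: (@le_trans _ _ (P (\bigcup_k Y @^-1` (A k `\` F k)))); last first.
  by apply: small_bigcup => //; [move=> k; apply: measurable_pre; exact: measurableD|exact: ltW].
apply: le_measure; rewrite ?inE.
- apply: measurable_pre; apply: measurableD; first exact: bigcapT_measurable.
  exact: bigcapT_measurable.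
- by apply: bigcupT_measurable => k; apply: measurable_pre; exact: measurableD.
move=> w /= [HA HF]; apply: contrapT => H; apply: HF => k _; apply: contrapT => nF.
by apply: H; exists k => //; split; [exact: HA|].
Qed.

(** The sets that are regular together with their complements form a sigma-algebra. It contains the
    open sets, which are countable unions of closed sets and have closed complements. *)
Lemma borel_closed_regular (A : set (borel S)) : measurable A -> closed_regular A.
Proof.
suff : <<s @open S >> `<=` [set A : set (borel S) |
    measurable A /\ closed_regular A /\ closed_regular (~` A)].
  by move=> H /H[_ []].
have c0 : closed_regular set0 by apply: closed_regular_closed; exact: closed0.
have cT : closed_regular setT by apply: closed_regular_closed; exact: closedT.
apply: smallest_sub; first split.
- by split=> //; rewrite setC0.
- move=> B [mB [rB rCB]]; rewrite setTD /= setCK; split=> //; exact: measurableC.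
- move=> B HB; have mB k : measurable (B k : set (borel S)) by have [] := HB k.
  split; first exact: bigcupT_measurable.
  split; first by apply: closed_regular_bigcup => // k; have [_ []] := HB k.
  rewrite setC_bigcup; apply: closed_regular_bigcap => k; have [mk [_ Hk]] := HB k => //.
  exact: measurableC.
move=> W oW; have [F cF WF] := FsigmaS oW; split; first exact: sub_sigma_algebra.
split; last by apply: closed_regular_closed; rewrite closedC.
rewrite WF; apply: closed_regular_bigcup => k; first exact: closed_borel.
exact: closed_regular_closed.
Qed.

End ClosedRegularity.

(** The closed pieces remove the balls of radius [1 / (k + 1)] around the points outside [W]. *)
Lemma pseudometric_open_Fsigma (R : realType) (M : pseudoMetricType R) (W : set M) :
  open W -> Fsigma W.
Proof.
move=> oW; pose U k : set M := \bigcup_(y in ~` W) (ball y k.+1%:R^-1)°.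
exists (fun k => ~` U k).
  by move=> k; rewrite closedC; apply: bigcup_open => y _; exact: open_interior.
apply/seteqP; split=> [x Wx|x [k _ nU]]; last first.
  apply: contrapT => nW; apply: nU; exists x => //.
  by apply: nbhsx_ballx; rewrite invr_gt0.
have : nbhs x W by apply: open_nbhs_nbhs.
rewrite -nbhs_ballE => -[e /= e0 eW]; exists (Num.truncn e^-1) => //.
move=> [y nWy /interior_subset xy]; apply: nWy; apply: eW.
apply: ball_sym; apply: le_ball xy; rewrite invf_ple ?posrE//.
exact: ltW (truncnS_gt _).
Qed.

Lemma homeo_open_Fsigma (S S' : topologicalType) (f : S -> S') (g : S' -> S) :
  cancel f g -> continuous f -> continuous g ->
  (forall W : set S', open W -> Fsigma W) -> forall W : set S, open W -> Fsigma W.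
Proof.
move=> fg cf cg HS W oW.
have oW' : open (g @^-1` W) by apply: open_comp => // y _; exact: cg.
have [F cF WF] := HS _ oW'; exists (fun k => f @^-1` F k).
  by move=> k; apply: closed_comp => // y _; exact: cf.
rewrite -preimage_bigcup -WF; apply/seteqP.
by split=> x /=; rewrite fg.
Qed.

Section Polish.
Context (R : realType) (S : ptopologicalType).
Hypothesis polishS : polish R S.

Lemma polish_hausdorff : hausdorff_space S.
Proof.
have [_ [M [f [g [fg _ cf _ _]]]]] := polishS.
rewrite open_hausdorff => x y xy.
have fxy : f x != f y by apply: contra xy => /eqP/(congr1 g); rewrite !fg => ->.
have := @metric_hausdorff R M; rewrite open_hausdorff => /(_ _ _ fxy).
move=> [[U V] /= [xU yV] [oU oV UV]].
exists (f @^-1` U, f @^-1` V) => /=.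
  by split; move: xU yV; rewrite !inE.
split.
- by apply: open_comp => // z _; exact: cf.
- by apply: open_comp => // z _; exact: cf.
- by rewrite -preimage_setI (eqP UV) preimage_set0 eqxx.
Qed.

(** Ulam's argument: at every radius finitely many closed balls around dense points carry almost all
    the mass. Their intersection [C] is totally bounded and closed, hence compact by
    completeness. *)
Lemma polish_tight d (T : measurableType d) (P : probability T R) (Y : T -> borel S)
    (e : R) : measurable_fun setT Y -> 0 < e ->
  exists C : set S, [/\ compact C, closed C & (P (Y @^-1` (~` C)) <= e%:E)%E].
Proof.
move=> mY e0; have [[D cD dD] [M [f [g [fg gf cf cg comp]]]]] := polishS.
have /countable_injP[idx idx_inj] := cD.
(* An enumeration of the dense set. Indices that are not attained give [point], which only adds
   harmless balls. *)
pose dn j := xget point (D `&` [set s | idx s = j]).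
have dnK s : D s -> dn (idx s) = s.
  move=> Ds; have := @xgetPex _ point (D `&` [set s' | idx s' = idx s]) (ex_intro _ s (conj Ds erefl)).
  by move=> [Dx]; apply: idx_inj; rewrite inE.
pose r k : R := k.+1%:R^-1; have r0 k : 0 < r k by rewrite invr_gt0.
pose B k j : set S := f @^-1` closure (ball (f (dn j)) (r k)).
have cB k j : closed (B k j).
  by apply: closed_comp; [move=> y _; exact: cf|exact: closed_closure].
pose A k N : set S := \bigcup_(j in `I_N) B k j.
have cA k N : closed (A k N) by apply: closed_bigcup => // ; exact: finite_II.
have mA k N : measurable (Y @^-1` (~` A k N)).
  by apply: measurable_pre => //; apply: measurableC; exact: closed_borel.
have HN k : exists N, (P (Y @^-1` (~` A k N)) <= (e / (2 ^ k.+1)%:R)%:E)%E.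
  apply: (@small_decreasing _ T R P (fun N => Y @^-1` (~` A k N))) => //.
  - move=> N N' NN'; apply/subsetPset => w /= nA [j /= jN Bj]; apply: nA.
    by exists j => //=; exact: leq_trans jN NN'.
  - apply/seteqP; split=> // w H.
    have [||s [sw Ds]] := dD (f @^-1` (ball (f (Y w)) (r k))°).
    + by exists (Y w) => /=; apply: nbhsx_ballx.
    + by apply: open_comp; [move=> y _; exact: cf|exact: open_interior].
    apply: (H (idx s).+1 I); exists (idx s) => //=.
    rewrite /B/= dnK//; apply: subset_closure; apply: ball_sym.
    exact: interior_subset sw.
  - by rewrite divr_gt0// ltr0n expn_gt0.
have [N PN] := choice HN; pose C := \bigcap_k A k (N k).
have cC : closed C by apply: closed_bigI => k _; exact: cA.
exists C; split=> //; last first.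
  rewrite setC_bigcap preimage_bigcup; apply: small_bigcup => //; exact: ltW.
rewrite compact_ultra => F FU FC.
(* An ultrafilter that contains a finite union contains one of its members. With one ball at every
   radius it is Cauchy. *)
have ballF k : exists j, F (B k j).
  have : F (A k (N k)) by apply: filterS FC => x; exact.
  elim: (N k) => [|m IH]; first by rewrite /A II0 bigcup_set0 => /filter_ex[].
  have [Bm _|nB FA] := in_ultra_setVsetC (B k m) FU; first by exists m.
  apply: IH; apply: filterS (filterI FA nB) => x [[j /= jm Bj] nBm].
  exists j => //=; move: jm; rewrite ltnS leq_eqVlt => /orP[/eqP jm|//].
  by exfalso; apply: nBm; rewrite -jm.
have FF : ProperFilter F by exact: ultra_proper.
have cau : cauchy (f @ F).
  apply: cauchy_exP => eps eps0; pose k := Num.truncn (2 / eps).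
  have rk : r k + r k <= eps.
    have : 2 / eps < k.+1%:R by exact: truncnS_gt.
    rewrite ltr_pdivrMr// => H.
    have : 2 * r k < eps by rewrite mulrC -ltr_pdivlMl ?invr_gt0// invrK.
    lra.
  have [j Fj] := ballF k; exists (f (dn j)).
  change (F (f @^-1` ball (f (dn j)) eps)); apply: filterS Fj => x /= xB.
  have [z [zj xz]] := xB _ (nbhsx_ballx (f x) (r k) (r0 k)).
  by apply: (le_ball rk); apply: (ball_triangle zj); exact: ball_sym.
have [l fl] := comp _ _ cau.
have Fgl : F --> g l.
  move=> V Vgl; have Fv : F (f @^-1` (g @^-1` V)) := fl _ (cg l V Vgl).
  apply: filterS Fv => x /=.
  by rewrite fg.
exists (g l); split=> //; apply: cC => V Vgl.
exact: (filter_ex (filterI FC (Fgl V Vgl))).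
Qed.

End Polish.

Section ProductRegularity.
Context (R : realType) (n : nat) (L : 'I_n -> ptopologicalType).
Hypothesis polishL : forall i, polish R (L i).
Local Notation Om := (prod_topology L).

(** The property holds in the product of the metric models and is transported back along the
    coordinatewise homeomorphism. *)
Lemma product_open_Fsigma (W : set Om) : open W -> Fsigma W.
Proof.
have H i : exists Mfg : {M : metricType R & ((L i -> M) * (M -> L i))%type},
    [/\ cancel (projT2 Mfg).1 (projT2 Mfg).2, continuous (projT2 Mfg).1 &
        continuous (projT2 Mfg).2].
  have [_ [M [f [g [fg _ cf cg _]]]]] := polishL i.
  by exists (existT _ M (f, g)).
pose Mfg i := projT1 (cid (H i)).
pose M i : metricType R := projT1 (Mfg i).
pose f i : L i -> M i := (projT2 (Mfg i)).1.
pose g i : M i -> L i := (projT2 (Mfg i)).2.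
have fg i : cancel (f i) (g i) by have [] := projT2 (cid (H i)).
have cf i : continuous (f i) by have [] := projT2 (cid (H i)).
have cg i : continuous (g i) by have [] := projT2 (cid (H i)).
pose fO (x : Om) : prod_topology M := fun i => f i (x i).
pose gO (y : prod_topology M) : Om := fun i => g i (y i).
apply: (@homeo_open_Fsigma Om (prod_topology M) fO gO).
- by move=> x; apply: functional_extensionality_dep => i; rewrite /fO /gO fg.
- apply: continuous_prod_topology => i x.
  apply: (@continuous_comp _ _ _ (fun x : Om => x i) (f i)); last exact: cf.
  exact: (@proj_continuous _ L i).
- apply: continuous_prod_topology => i y.
  apply: (@continuous_comp _ _ _ (fun y : prod_topology M => y i) (g i)); last exact: cg.
  exact: (@proj_continuous _ M i).
exact: (@pseudometric_open_Fsigma R (prod_topology M)).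
Qed.

(** A closed inner approximation of [S] is intersected with a product of compact sets, one for each
    coordinate by tightness; each of the two losses is at most [e / 2]. *)
Lemma exists_compact_regular d (T : measurableType d) (P : probability T R)
    (X : T -> borel Om) (S : set (borel Om)) (e : R) :
  measurable_fun setT X -> measurable S -> 0 < e ->
  exists K : set Om, [/\ compact K, K `<=` S & (P (X @^-1` (S `\` K)) <= e%:E)%E].
Proof.
move=> mX mS e0.
have e2 : 0 < e / 2 by rewrite divr_gt0.
have [F [cF FS PF]] := borel_closed_regular P mX product_open_Fsigma mS e2.
pose e' k := (e / 2) / (2 ^ k.+1)%:R : R.
have e'0 k : 0 < e' k by rewrite divr_gt0// ltr0n expn_gt0.
have HC i : exists C : set (L i), [/\ compact C, closed C &
    (P ((fun w => X w i : borel (L i)) @^-1` (~` C)) <= (e' i)%:E)%E].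
  apply: polish_tight => //.
  exact: (measurableT_comp (@measurable_coord n L i) mX).
pose C i := projT1 (cid (HC i)).
have cC i : compact (C i) by have [] := projT2 (cid (HC i)).
have clC i : closed (C i) by have [] := projT2 (cid (HC i)).
have PC i : (P ((fun w => X w i : borel (L i)) @^-1` (~` C i)) <= (e' i)%:E)%E.
  by have [] := projT2 (cid (HC i)).
pose K0 : set Om := [set x | forall i, C i (x i)].
have cK0 : compact K0 by exact: tychonoff.
exists (K0 `&` F); split.
- exact: compact_closedI.
- by move=> x [_ Fx]; exact: FS.
(* The coordinates are indexed by natural numbers and padded with empty sets, so the masses [e' k]
   sum to at most [e / 2]. *)
pose Bk k : set T := if insub k is Some i then X @^-1` [set x : Om | ~ C i (x i)] else set0.
have mB k : measurable (Bk k).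
  rewrite /Bk; case: insubP => [i _ _|_]//.
  apply: (@measurable_pre (L i) _ _ (fun w => X w i : borel (L i)) _ (~` C i)).
    exact: (measurableT_comp (@measurable_coord n L i) mX).
  by apply: measurableC; exact: closed_borel.
have PB : (P (\bigcup_k Bk k) <= (e / 2)%:E)%E.
  apply: small_bigcup => //; first exact: ltW.
  move=> k; rewrite /Bk; case: insubP => [i _ <-|_]; first exact: PC.
  by rewrite measure0 lee_fin; exact: ltW (e'0 k).
have mSF : measurable (X @^-1` (S `\` F)).
  by apply: measurable_pre => //; apply: measurableD => //; exact: closed_borel.
have -> : e%:E = ((e / 2)%:E + (e / 2)%:E)%E by rewrite -EFinD -splitr.
apply: le_trans (leeD PF PB); apply: le_trans (measureU2 _ mSF (bigcupT_measurable _ mB)).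
apply: le_measure; rewrite ?inE.
- apply: measurable_pre => //; apply: measurableD => //; apply: closed_borel.
  apply: compact_closed; last exact: compact_closedI.
  by apply: hausdorff_product => i; exact: polish_hausdorff.
- by apply: measurableU => //; exact: bigcupT_measurable.
move=> w /= [Sw nKF]; have [Fw|nF] := pselect (F (X w)); last by left.
right; apply: contrapT => H; apply: nKF; split=> // i; apply: contrapT => nC.
by apply: H; exists (val i) => //; rewrite /Bk valK.
Qed.

End ProductRegularity.

(** * The exponential moment bound *)

(** The integral of a nonnegative function is a supremum over the simple functions below it, so it
    is monotone even for functions that are not measurable. This allows replacing [d_T(., S)] by the
    Borel function [d_T(., K)]. *)
Lemma ge0_le_integralT d (T : measurableType d) (R : realType)
    (m : {measure set T -> \bar R}) (f g : T -> \bar R) :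
  (forall x, (0 <= f x)%E) -> (forall x, (f x <= g x)%E) ->
  (\int[m]_x f x <= \int[m]_x g x)%E.
Proof.
move=> f0 fg; have g0 x : (0 <= g x)%E by exact: le_trans (f0 x) (fg x).
rewrite !ge0_integralTE//; apply: ereal_sup_le => _ [h hf <-].
by exists h => // x; exact: le_trans (hf x) (fg x).
Qed.

Section MatrixNorm.
Context (R : realType) (n : nat) (A : 'M[R]_n).
Hypothesis A0 : forall i j, 0 <= A i j.

Lemma mx_norm_1_col j : \sum_i A i j <= mx_norm_1 A.
Proof.
have -> : \sum_i A i j = \sum_i `|A i j| by apply: eq_bigr => i _; rewrite ger0_norm.
exact: (le_bigmax_cond 0 (fun j => \sum_i `|A i j|)).
Qed.

Lemma mx_norm_oo_row i : \sum_j A i j <= mx_norm_oo A.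
Proof.
have -> : \sum_j A i j = \sum_j `|A i j| by apply: eq_bigr => j _; rewrite ger0_norm.
exact: (le_bigmax_cond 0 (fun i => \sum_j `|A i j|)).
Qed.

Lemma mx_norm_1_ge0 : 0 <= mx_norm_1 A.
Proof. exact: bigmax_ge_id. Qed.

End MatrixNorm.

Section CompactTarget.
Context (R : realType) (n : nat) (L : 'I_n -> ptopologicalType).
Hypothesis polishL : forall i, polish R (L i).
Context (d : measure_display) (T : measurableType d) (P : probability T R)
    (X : {RV P >-> borel (prod_topology L)})
    (mu_ : forall i, R.-pker (borel (omit L i)) ~> (borel (L i))).
Hypothesis (mu_X : forall i, cond_dist P (fun w => X w i : borel (L i))
                        (fun w => drop_coord i (X w) : borel (omit L i))
                        (mu_ i)).
Variable (A : 'M[R]_n).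
Hypotheses (dobA : dobrushin_matrix mu_ A) (A1 : mx_norm_1 A < 1) (Aoo : mx_norm_oo A <= 1).
Hypothesis n_gt0 : (0 < n)%N.
Local Notation Om := (prod_topology L).
Variables (K : set Om) (K0 : K !=set0) (cK : compact K).

Lemma mean_exp_convex_dist :
  mean X (fun x => expR (convex_dist x K ^+ 2 * (1 - mx_norm_1 A) / (261 / 10))) *
  fine (P (X @^-1` K)) <= 1.
Proof.
have scL i : @second_countable (L i) by exact: polish_second_countable (polishL i).
have hausL i : hausdorff_space (L i) by exact: polish_hausdorff (polishL i).
have G := gibbs_resample scL mu_X dobA.
have [A0 Ad _] := dobA.
set dl := 1 - mx_norm_1 A.
have dl01 : 0 < dl <= 1 by rewrite subr_gt0 A1/= gerBl mx_norm_1_ge0.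
pose f (x : Om) : R := convex_dist x K ^+ 2.
pose b i (x : Om) : R := partial_dist (@weights_off R n i) x K ^+ 2.
have offs i := @weights_off_sub R n i.
have bf : borel_bounded f.
  exact: (borel_bounded_partial_sqr hausL K0 cK (@subset_refl _ (@unit_weights R n))).
have bb i : borel_bounded (b i) by exact: (borel_bounded_partial_sqr hausL K0 cK (offs i)).
have DT0 (x : Om) : 0 <= convex_dist x K :> R by exact: (@partial_ge0 R n L (@unit_weights R n)).
have f0 x : 0 <= f x by exact: sqr_ge0.
have ib i : ind (@adjacent n L) i (b i).
  by move=> x y xy; rewrite /b (@partial_dist_ind R n L K i x y xy).
have bf1 i x : b i x <= f x <= b i x + 1.
  rewrite convex_dist_sqr_le// andbT lerXn2r ?nnegrE ?partial_ge0//.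
  exact: partial_dist_le.
have fb x : \sum_i (f x - b i x) ^+ 2 <= 4 * f x by exact: sum_sqr_partial_dist.
have row i : \sum_j A i j <= 1 by exact: le_trans (mx_norm_oo_row A0 i) Aoo.
have col j : \sum_i A i j <= 1 - dl by rewrite /dl opprB addrC subrK mx_norm_1_col.
have H := exp_moments G A0 Ad dl01 row col n_gt0 (@adjacent_path n L) bf f0 bb ib bf1 fb.
apply: le_trans H.
have -> : (fun x : Om => expR (convex_dist x K ^+ 2 * dl / (261 / 10))) =
   (fun x => expR (10 / 261 * dl * f x)).
  by apply/funext => x; congr expR; rewrite /f; field.
apply: ler_pM => //.
- by apply: Rintegral_ge0 => w _; exact: expR_ge0.
- by rewrite fine_ge0.
have mK : measurable (K : set (borel Om)).
  by apply: closed_borel; apply: compact_closed => //; exact: hausdorff_product.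
have bi : borel_bounded (\1_K : Om -> R) by exact: bounded_measurable_indic.
have mXK : measurable (X @^-1` K) by apply: measurable_pre.
rewrite -prob_integral_indic//.
apply: (@le_trans _ _ (mean X (\1_K : Om -> R))).
  by rewrite le_eqVlt; apply/orP; left; apply/eqP.
apply: le_mean => //; first exact: (bm_exp G).
move=> x; rewrite indicE; have [xK|xK] := boolP (x \in K); last exact: expR_ge0.
by rewrite /f convex_dist_in ?expr0n/= ?mulr0 ?expR0//; rewrite inE in xK.
Qed.

Lemma borel_bounded_exp_dist (t c : R) :
  borel_bounded (fun x : Om => expR (convex_dist x K ^+ 2 * t / c)).
Proof.
have hausL i : hausdorff_space (L i) by exact: polish_hausdorff (polishL i).
apply: bounded_measurable_expR.
have := borel_bounded_partial_sqr hausL K0 cK (@subset_refl _ (@unit_weights R n)).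
move=> /(@bounded_measurableZ _ (borel Om) R (t / c)); congr bounded_measurable.
by apply/funext => x; rewrite mulrC mulrA.
Qed.

End CompactTarget.

Theorem theorem3p3 (R : realType) (n : nat) (L : 'I_n -> ptopologicalType)
    (polishL : forall i, polish R (L i))
    (d : measure_display) (T : measurableType d) (P : probability T R)
    (X : {RV P >-> borel (prod_topology L)})
    (mu_ : forall i, R.-pker (borel (omit L i)) ~> (borel (L i)))
    (mu_X : forall i, cond_dist P (fun w => X w i : borel (L i))
                        (fun w => drop_coord i (X w) : borel (omit L i))
                        (mu_ i))
    (A : 'M[R]_n) (dobA : dobrushin_matrix mu_ A)
    (A1 : mx_norm_1 A < 1) (Aoo : mx_norm_oo A <= 1)
    (S : set (borel (prod_topology L))) (mS : measurable S) :
  ('E_P[(fun w => expR (convex_dist (X w) S ^+ 2 * (1 - mx_norm_1 A)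
                        / (261 / 10)))]
   <= (distribution P X S)^-1)%E.
Proof.
have mX : measurable_fun setT X by exact: measurable_funP.
have mXS : measurable (X @^-1` S) by apply: measurable_pre.
rewrite unlock; change (distribution P X S) with (P (X @^-1` S)).
set V := (\int[P]_w _)%E.
(* Without coordinates there is no unit weight vector; the convex distance is the supremum of the
   empty set, [0], and the expectation is [1]. *)
have [n0|n_gt0] := posnP n.
  have V1 : V = 1%E.
    transitivity (\int[P]_w (1 : \bar R))%E; last first.
      by rewrite integral_cst// mul1e; exact: probability_setT.
    apply: eq_integral => w _; rewrite /convex_dist (_ : [set _ | _ in _] = set0).
      by rewrite sup0 expr0n/= !mul0r expR0.
    apply/seteqP; split=> // r [c [_ c1] _]; move: c1; rewrite big1 ?sqrtr0.
      by move/eqP; rewrite eq_sym oner_eq0.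
    by move=> i; have := ltn_ord i; rewrite {2}n0.
  by rewrite V1 inve_ge1//; exact: probability_le1.
have fS : P (X @^-1` S) \is a fin_num by exact: fin_num_measure.
set s := fine (P (X @^-1` S)).
have sE : P (X @^-1` S) = s%:E by rewrite fineK.
rewrite sE inver; have s0 : 0 <= s by exact: fine_ge0.
(* For [s = 0] the inverse is [+oo]. *)
case: eqP => [_|/eqP s_neq0]; first exact: leey.
have s_gt0 : 0 < s by rewrite lt_neqAle eq_sym s_neq0.
have V0 : (0 <= V)%E by apply: integral_ge0 => w _; rewrite lee_fin expR_ge0.
have key e : 0 < e -> e < s -> exists2 v : R, (V <= v%:E)%E & 0 <= v /\ v * (s - e) <= 1.
  move=> e0 es.
  have [K [cK KS PK]] := exists_compact_regular polishL P mX mS e0.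
  have mK : measurable (K : set (borel (prod_topology L))).
    apply: closed_borel; apply: compact_closed => //; apply: hausdorff_product => i.
    exact: polish_hausdorff (polishL i).
  have mXK : measurable (X @^-1` K) by apply: measurable_pre.
  have sK : s - e <= fine (P (X @^-1` K)).
    rewrite -lee_fin fineK ?fin_num_measure// EFinB leeBlDr// -sE addeC.
    apply: le_trans (leeD2r _ PK).
    have mSK : measurable (X @^-1` (S `\` K)).
      by apply: measurable_pre => //; exact: measurableD.
    rewrite -[X in (P X <= _)%E](setDKU (_ : X @^-1` K `<=` X @^-1` S)); last first.
      by move=> w; exact: KS.
    exact: measureU2.
  have K0 : K !=set0.
    apply/set0P/eqP => K00; move: sK; rewrite K00 preimage_set0 measure0 /=.
    by rewrite leNgt subr_gt0 es.
  have H := mean_exp_convex_dist polishL mu_X dobA A1 Aoo n_gt0 K0 cK.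
  set g := (fun x => expR _) in H.
  have G0 x : 0 <= g x by exact: expR_ge0.
  have g0 : 0 <= mean X g by apply: Rintegral_ge0.
  exists (mean X g); last by split=> //; apply: le_trans H; exact: ler_wpM2l.
  have bg : borel_bounded g by exact: borel_bounded_exp_dist.
  have -> : ((mean X g)%:E = \int[P]_w (g (X w))%:E)%E.
    rewrite fineK//; apply: integrable_fin_num => //.
    exact: bounded_measurable_integrable (bounded_X X bg).
  apply: ge0_le_integralT => w; rewrite lee_fin ?expR_ge0// ler_expR.
  rewrite !ler_wpM2r ?invr_ge0 ?subr_ge0 ?(ltW A1)//.
  have S0 : (S : set (prod_topology L)) !=set0 by case: K0 => x /KS Sx; exists x.
  rewrite lerXn2r ?nnegrE; [by []| | |exact: convex_dist_anti].
  - exact: (@partial_ge0 R n L (@unit_weights R n)).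
  - exact: (@partial_ge0 R n L (@unit_weights R n)).
apply/lee_addgt0Pr => eps eps0; rewrite -EFinD.
have q0 : 0 < 1 + eps * s by rewrite addr_gt0// mulr_gt0.
(* The lost mass is chosen so that the remaining mass [s / (1 + eps * s)] has reciprocal
   [1 / s + eps]. *)
have se : s - eps * s ^+ 2 / (1 + eps * s) = s / (1 + eps * s).
  by field; rewrite gt_eqF.
have [||v Vv [v0 vs]] := key (eps * s ^+ 2 / (1 + eps * s)).
- by rewrite divr_gt0// mulr_gt0// exprn_gt0.
- by rewrite -subr_gt0 se divr_gt0.
apply: le_trans Vv _; rewrite lee_fin; rewrite se mulrA ler_pdivrMr// mul1r in vs.
by rewrite -(ler_pM2r s_gt0) mulrDl mulVf.
Qed.
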